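(* Let $f\in L^\infty([0,1]\times\mathbb{R}\times\mathbb{R})$ be real-valued and satisfy, for a constant $K>0$, $$|f(x,t,v_1)-f(x,t,v_2)|\le K|v_1-v_2|,\qquad 0\le x\le 1,\ t\in\mathbb{R},\ v_1,v_2\in\mathbb{R}.$$ Let $p>0$, let $g,h,g^\delta,h^\delta\in L^2(\mathbb{R})$ satisfy $\|g^\delta-g\|_{L^2(\mathbb{R})}+\|h^\delta-h\|_{L^2(\mathbb{R})}\le\delta$, and let $u$ be the exact solution of the exact problem with data $(g,h)$. Suppose there exist constants $M_2>0$, $\gamma>0$ and $\mu>\max\{4-\alpha,\,4p-\alpha\}$ such that $$\int_{-\infty}^{+\infty}\exp\Big(2(1+\gamma-x)|\omega|^{\frac{\alpha+\mu}{2}}\cos\tfrac{\alpha\pi}{4}\Big)|\widehat u(x,\omega)|^2\,d\omega<M_2^2,\qquad 0\le x<1 .$$ Put $A=\frac p2+1+K^2 2^p$, $B=\frac12\gamma\cos\frac{\alpha\pi}{4}$, $q=\max\{2,\frac\alpha2,2p\}$ and $C_2=4+2M_2$. Let $0<\delta<1$ be such that $$\left(\frac{A+B}{\ln\frac1\delta}\right)^{\frac{2}{\alpha+\mu}}<\min\left\{1,\ \left(\frac BA\right)^{\frac{1}{\frac{\alpha+\mu}{2}-q}},\ \left[\frac{\frac{\alpha+\mu}{2}\,\gamma\cos\frac{\alpha\pi}{4}}{p}\right]^{\frac{2}{\alpha+\mu}}\right\},$$ and choose $\epsilon=\left(\dfrac{A+B}{\ln\frac1\delta}\right)^{\frac{2}{\alpha+\mu}}$.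 Let $u_\epsilon^\delta$ be the regularized solution with parameter $\epsilon$ and data $(g^\delta,h^\delta)$. Then $$\|u_\epsilon^\delta(x,\cdot)-u(x,\cdot)\|_{H^p(\mathbb{R})}\le C_2\,\delta^{\frac{B}{A+B}},\qquad 0\le x<1 .$$
   Context: Fix $0<\alpha<1$. $L^2(\mathbb{R})$ consists of real-valued functions of $t\in\mathbb{R}$. The Fourier transform in $t$ is $\widehat v(\omega)=\frac{1}{\sqrt{2\pi}}\int_{-\infty}^{\infty}v(t)e^{-i\omega t}\,dt$, and $\|v\|_{H^p(\mathbb{R})}=\left(\int_{\mathbb{R}}(1+\omega^2)^p|\widehat v(\omega)|^2\,d\omega\right)^{1/2}$. Put $$k(\omega)=(i\omega)^{\alpha/2}=|\omega|^{\alpha/2}\Big(\cos\tfrac{\alpha\pi}{4}+i\,\mathrm{sign}(\omega)\sin\tfrac{\alpha\pi}{4}\Big),$$ and interpret $\sinh(k(\omega)y)/k(\omega)$ as $y$ at $\omega=0$. For a function $w$ on $[0,1]\times\mathbb{R}$, $\widehat w(x,\omega)$ denotes the Fourier transform of $w(x,\cdot)$, and $\widehat f(z,\omega,w(z,\omega))$ denotes the Fourier transform with respect to $t$ of $t\mapsto f(z,t,w(z,t))$. Standing assumption: $(z,t)\mapsto f(z,t,w(z,t))$ belongs to $L^2((0,1)\times\mathbb{R})$ for every $w\in C([0,1];L^2(\mathbb{R}))$, so that these Fourier transforms are those of $L^2$ functions. Exact problem with data $(g,h)$: find $u\in C([0,1];L^2(\mathbb{R}))$ such that for $0\le x\le1$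 and a.e. $\omega\in\mathbb{R}$ $$\widehat u(x,\omega)=\cosh(k(\omega)x)\,\widehat g(\omega)+\frac{\sinh(k(\omega)x)}{k(\omega)}\,\widehat h(\omega)-\int_0^x\frac{\sinh(k(\omega)(x-z))}{k(\omega)}\,\widehat f(z,\omega,u(z,\omega))\,dz .$$ (This is the integral form of the problem $D_t^\alpha u-u_{xx}=f(x,t,u)$, $u(x,0)=0$, $u(0,t)=g(t)$, $u_x(0,t)=h(t)$, with $D_t^\alpha$ the Caputo derivative.) Regularized solution with parameter $\epsilon>0$ and data $(g^\delta,h^\delta)$: the unique $u_\epsilon^\delta\in C([0,1];L^2(\mathbb{R}))$ such that $w=u_\epsilon^\delta$ satisfies, for $0\le x\le1$ and a.e. $\omega\in\mathbb{R}$, $$\widehat w(x,\omega)=\chi_{[-1/\epsilon,1/\epsilon]}(\omega)\left[\cosh(k(\omega)x)\,\widehat{g^\delta}(\omega)+\frac{\sinh(k(\omega)x)}{k(\omega)}\,\widehat{h^\delta}(\omega)-\int_0^x\frac{\sinh(k(\omega)(x-z))}{k(\omega)}\,\widehat f(z,\omega,w(z,\omega))\,dz\right],$$ where $\chi_I$ is the indicator function of $I$. *)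

(* Defs.v *)
From HB Require Import structures.
From mathcomp Require Export all_boot all_order all_algebra.
From mathcomp Require Export complex.
From mathcomp Require Export all_classical all_reals all_analysis.
Export Order.TTheory GRing.Theory Num.Theory.
Export numFieldNormedType.Exports.

Set Implicit Arguments.
Unset Strict Implicit.
Unset Printing Implicit Defensive.

Local Open Scope classical_set_scope.
Local Open Scope complex_scope.
Local Open Scope ring_scope.

Notation leb R := (@lebesgue_measure R).
Notation leb2 R := (@lebesgue_measure R \x @lebesgue_measure R)%E.
Notation leb3 R :=
  ((@lebesgue_measure R \x @lebesgue_measure R) \x @lebesgue_measure R)%E.

Section complex_functions.
Context {R : realType}.
Implicit Types z : R[i].

Definition expC z : R[i] :=
  (expR (complex.Re z))%:C * (cos (complex.Im z) +i* sin (complex.Im z)).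
Definition coshC z : R[i] := (expC z + expC (- z)) / 2%:R.
Definition sinhC z : R[i] := (expC z - expC (- z)) / 2%:R.

Definition Cintegral (D : set R) (F : R -> R[i]) : R[i] :=
  (\int[leb R]_(t in D) complex.Re (F t)) +i*
  (\int[leb R]_(t in D) complex.Im (F t)).

End complex_functions.

Section L2_spaces.
Context {R : realType}.

Definition L2 (v : R -> R) : Prop := v \in Lfun (leb R) 2%:E.

Definition L2C (V : R -> R[i]) : Prop :=
  L2 (fun w => complex.Re (V w)) /\ L2 (fun w => complex.Im (V w)).

(* L^2((0,1) x R), the functions being extended by 0 outside the strip *)
Definition L2strip (v : R -> R -> R) : Prop :=
  (fun q : R * R => v q.1 q.2) \_ (`]0, 1[ `*` setT)
    \in Lfun (leb2 R) 2%:E.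

Definition L2Cstrip (V : R -> R -> R[i]) : Prop :=
  L2strip (fun z w => complex.Re (V z w)) /\
  L2strip (fun z w => complex.Im (V z w)).

(* Every continuous curve [0,1] -> L^2(R) has a representative that is jointly
   measurable in (x, t); without joint measurability (z, t) |-> f z t (w z t)
   need not be measurable. *)
Definition C01_L2 (w : R -> R -> R) : Prop :=
  [/\ @measurable_fun _ _ (measurableTypeR R * measurableTypeR R)%type
        (measurableTypeR R) (`[0, 1] `*` setT) (fun q => w q.1 q.2),
      forall x, 0 <= x <= 1 -> L2 (w x)
    & forall x0, 0 <= x0 <= 1 ->
        Lnorm (leb R) 2%:E (EFin \o (w x \- w x0))
          @[x --> within `[0, 1] (nbhs x0)] --> 0%E].

End L2_spaces.

Section Fourier.
Context {R : realType}.

Definition fourier_trunc (n : nat) (v : R -> R) (w : R) : R[i] :=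
  ((Num.sqrt (2 * pi))^-1)%:C *
  Cintegral `[- n%:R, n%:R] (fun t => (v t)%:C * expC (0 +i* (- (w * t)))).

(* The Fourier integral of an L^2 function is the L^2 limit of its truncations
   to [-n, n]; this determines the transform up to a null set. *)
Definition is_fourier (v : R -> R) (V : R -> R[i]) : Prop :=
  L2C V /\
  (\int[leb R]_w ((Normc.normc (fourier_trunc n v w - V w) ^+ 2)%:E))%E
    @[n --> \oo] --> 0%E.

Definition fourier (v : R -> R) : R -> R[i] :=
  xget (fun=> 0) [set V | is_fourier v V].

(* V is the element of L^2((0,1) x R) obtained from v by the Fourier transform
   in the second variable: choosing fourier (v z) independently for each z
   would not give a function measurable in z. *)
Definition is_partial_fourier (v : R -> R -> R) (V : R -> R -> R[i]) : Prop :=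
  L2Cstrip V /\
  {ae leb R, forall z, 0 < z < 1 ->
    {ae leb R, forall w, V z w = fourier (v z) w}}.

Definition Hnorm (p : R) (v : R -> R) : \bar R :=
  ((\int[leb R]_w
     (((1 + w ^+ 2) `^ p * Normc.normc (fourier v w) ^+ 2)%:E))
   `^ (2^-1)%R)%E.

End Fourier.

Section problem.
Context {R : realType}.
Variable alpha : R.

Definition k (w : R) : R[i] :=
  (`|w| `^ (alpha / 2))%:C *
  (cos (alpha * pi / 4) +i* (Num.sg w * sin (alpha * pi / 4))).

(* sinh (k(w) y) / k(w) *)
Definition sinhk (w y : R) : R[i] :=
  if w == 0 then y%:C else sinhC (k w * y%:C) / k w.

(* F is the transform in t of f(z, t, u(z, t)) *)
Definition solution_formula (g h : R -> R) (F : R -> R -> R[i]) (x w : R)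
    : R[i] :=
  coshC (k w * x%:C) * fourier g w + sinhk w x * fourier h w
  - Cintegral `[0, x] (fun z => sinhk w (x - z) * F z w).

Definition exact_solution (f : R -> R -> R -> R) (g h : R -> R)
    (u : R -> R -> R) : Prop :=
  C01_L2 u /\
  exists2 F, is_partial_fourier (fun z t => f z t (u z t)) F &
    forall x, 0 <= x <= 1 ->
      {ae leb R, forall w, fourier (u x) w = solution_formula g h F x w}.

Definition regularized_solution (f : R -> R -> R -> R) (eps : R)
    (g h : R -> R) (u : R -> R -> R) : Prop :=
  C01_L2 u /\
  exists2 F, is_partial_fourier (fun z t => f z t (u z t)) F &
    forall x, 0 <= x <= 1 ->
      {ae leb R, forall w, fourier (u x) w =
        (\1_(`[- (1 / eps), 1 / eps] : set R) w)%:C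
          * solution_formula g h F x w}.

End problem.

(* Main.v *)
(* Put [N = 1 / eps], [X = N^((alpha + mu) / 2)] and [L = N^(alpha / 2)]. By Plancherel
   the error splits into the frequencies above and below [N]. Above [N] it is
   the transform of [u], which the a priori weight makes smaller than [exp (- 4 B X)].
   Below [N] one has [|cosh (k y)|, |sinh (k y) / (k y)| <= exp (L y)], so, subtracting
   the two integral equations and using the Lipschitz condition, the energy
   [E z] of the low frequencies satisfies
     [E x <= 4 exp (2 L x) delta^2
             + 2 int_0^x (x - z)^2 exp (2 L (x - z)) K^2 (E z + exp (- 4 B X) M2^2) dz].
   After division by [exp ((2 L + 2 K) x)] the integral operator has norm at most 1/2,
   since [2 K^2 r^2 exp (- 2 K r) <= 1/2], which bounds [E]. The choice of
   [eps] means [delta = exp (- (A + B) X)], and [A], [B] absorb the remaining factors.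

   Plancherel's theorem: for [v] bounded and integrable, weighting [|v^|^2] by
   [(sin (eta w) / (eta w))^2] gives the integral of [v] against its average over
   a tent of width [eta], by [int (1 - cos (a w)) / w^2 dw = pi |a|]; let [eta] tend
   to 0, then pass to [L^2] by density and completeness. *)

Require Import Defs.
From mathcomp Require Import ring lra measurable_realfun.

Set Implicit Arguments.
Unset Strict Implicit.
Unset Printing Implicit Defensive.

Local Open Scope classical_set_scope.
Local Open Scope ring_scope.

(** * Plancherel's identity for bounded integrable functions *)

(** The obstacle is that the Lipschitz condition acts in time while the cut-off acts in frequency:
    bounding the source difference costs the energy of the error at all frequencies, so the part of
    [u] beyond [N] returns as a forcing term in the inequality for the low ones. It is harmless
    because, for [x < 1], the a priori weight is at least [exp (4 B |w|^((alpha + mu) / 2))],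
    whereas amplification and Sobolev weight together cost at most [(2 N^2)^p exp (2 L + 2 K) <= 2
    exp (2 A N^q)]. Since [q < (alpha + mu) / 2], the smallness of [eps] turns [A N^q] into at most
    [B X].

    Transforms are determined only almost everywhere, and the null set in the integral equation
    depends on [x]. Hence energies are integrated over [w] at a fixed [x], and Tonelli then brings
    the [z] integral outside. No regularity of the energy in [x] is used: it is compared with its
    own supremum over [[0, 1)], which is finite because the sources are square integrable on the
    strip. *)

Section improper_integrals.
Context {R : realType}.
Implicit Types (a x y w l : R) (f F G : R -> R).

Lemma measurable_cos : measurable_fun [set: R] cos.
Proof. by apply: continuous_measurable_fun => x; exact: continuous_cos. Qed.

Lemma measurable_sin : measurable_fun [set: R] sin.
Proof. by apply: continuous_measurable_fun => x; exact: continuous_sin. Qed.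

Lemma measurable_invr : measurable_fun [set: R] (@GRing.inv R).
Proof.
have -> : [set: R] = [set 0] `|` [set~ 0] by rewrite setUv.
apply/measurable_funU => //; first exact: measurableC.
split; first exact: measurable_fun_set1.
apply: open_continuous_measurable_fun.
  by apply: closed_openC; exact: accessible_closed_set1 (hausdorff_accessible (@Rhausdorff R)) _.
by move=> x; rewrite inE /= => /eqP x0; exact: inv_continuous.
Qed.

Lemma tonelliR (h : R * R -> R) : measurable_fun setT h ->
  (forall q, 0 <= h q) ->
  (\int[leb R]_x \int[leb R]_y (h (x, y))%:E =
   \int[leb R]_y \int[leb R]_x (h (x, y))%:E)%E.
Proof.
move=> mh h0; apply: (@fubini_tonelli _ _ _ _ R (leb R) (leb R) (EFin \o h)).
  exact/measurable_EFinP.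
by move=> q; rewrite lee_fin.
Qed.

Lemma is_deriveP F x l : is_derive x 1 F l -> derivable F x 1 /\ 'D_1 F x = l.
Proof. by case. Qed.

Lemma ge0_integral_derive_y f F l : (forall x, 0 <= x -> 0 <= f x) ->
  continuous f -> (forall x, derivable F x 1 /\ 'D_1 F x = f x) ->
  F x @[x --> +oo] --> l ->
  (\int[leb R]_(x in `[0%R, +oo[) (f x)%:E = (l - F 0)%:E)%E.
Proof.
move=> f0 cf dF Fl.
have cF x : {for x, continuous F}.
  apply/differentiable_continuous/derivable1_diffP.
  by case: (dF x).
rewrite (ge0_continuous_FTC2y f0 _ Fl).
- by rewrite EFinB.
- exact: continuous_subspaceT.
- by move=> x _; by case: (dF x).
- exact/cvg_at_right_filter/cF.
- by move=> x _; rewrite derive1E; case: (dF x).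
Qed.

Lemma cvgy_expRN y : 0 < y -> expR (- (y * x)) @[x --> +oo] --> (0 : R).
Proof.
move=> y0; apply: (cvg_comp (fun x => y * x) (fun x => expR (- x))).
  exact: gt0_cvgMry.
exact: cvgr_expR.
Qed.

Lemma cvgy_le_expRN F y (C : R) : 0 < y ->
  (forall x, 0 <= x -> `|F x| <= C * expR (- (y * x))) ->
  F x @[x --> +oo] --> (0 : R).
Proof.
move=> y0 FC; apply: norm_cvg0.
apply: (@squeeze_cvgr _ _ _ _ (cst 0) (fun x => C * expR (- (y * x)))).
- near=> x; rewrite normr_ge0/= FC//.
- exact: cvg_cst.
- by rewrite -(mulr0 C); apply: cvgMl_tmp; exact: cvgy_expRN.
Unshelve. all: by end_near. Qed.

(** Writes [w^-2] as a superposition of exponentials; this is how [integral_1Bcos_div_sqr] gets rid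
    of its singular denominator. *)
Lemma integral_Mexp w : 0 < w ->
  (\int[leb R]_(y in `[0%R, +oo[) (y * expR (- (y * w)))%:E = (w ^- 2)%:E)%E.
Proof.
move=> w0.
pose F y := - (y / w + w ^- 2) * expR (- (y * w)).
rewrite (@ge0_integral_derive_y _ F 0).
- by rewrite /F !(mul0r, oppr0, expR0, mulr1, add0r, opprK).
- by move=> x x0; rewrite mulr_ge0// expR_ge0.
- move=> x; apply: cvgM; first exact: cvg_id.
  apply: (@continuous_comp _ _ _ (fun x : R => - (x * w)) expR).
    by apply: cvgN; apply: cvgMr_tmp; exact: cvg_id.
  exact: continuous_expR.
- move=> x; apply: is_deriveP; rewrite /F; apply: is_derive_eq.
  by rewrite /GRing.scale/= !mulr1 /comp; field; rewrite gt_eqF.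
- apply: (@cvgy_le_expRN _ (w / 2) (2 * w ^- 2 + w ^- 2)); first lra.
  move=> x x0; rewrite /F normrM normrN (ger0_norm (expR_ge0 _)).
  have xw0 : 0 <= x / w by rewrite divr_ge0// ltW.
  have wi0 : 0 <= w ^- 2 by rewrite invr_ge0 exprn_ge0// ltW.
  rewrite ger0_norm ?addr_ge0//.
  (* Half of the decay is spent on the linear factor, through [r exp (- r) <= 1] at [r = w x / 2];
     the other half remains as the bound. *)
  have -> : - (x * w) = - (w / 2 * x) + - (w / 2 * x) by field.
  rewrite expRD mulrA ler_wpM2r ?expR_ge0//.
  have e1 : expR (- (w / 2 * x)) <= 1 
    by rewrite -expR0 ler_expR oppr_le0 mulr_ge0// divr_ge0// ltW.
  rewrite mulrDl lerD//; last first.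
    by rewrite ler_piMr.
  have -> : x / w = (2 * w ^- 2) * (w / 2 * x) by field; rewrite gt_eqF.
  rewrite -[leLHS]mulrA ler_piMr//; first by rewrite mulr_ge0.
  by rewrite expRN ler_pdivrMr ?expR_gt0// mul1r (le_trans _ (expR_ge1Dx _))// lerDr.
Unshelve. all: by end_near. Qed.

Lemma integral_exp_1Bcos a y : 0 < y ->
  (\int[leb R]_(w in `[0%R, +oo[) (expR (- (y * w)) * (1 - cos (a * w)))%:E
   = (a ^+ 2 / (y * (y ^+ 2 + a ^+ 2)))%:E)%E.
Proof.
move=> y0.
have d0 : 0 < y ^+ 2 + a ^+ 2 by rewrite ltr_wpDr ?sqr_ge0// exprn_gt0.
(* The first quotient is the antiderivative of [- exp (- y w) cos (a w)] found by two integrations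
   by parts, and [- y^-1] accounts for the constant 1. *)
pose F w := expR (- (y * w)) *
  ((y * cos (a * w) - a * sin (a * w)) / (y ^+ 2 + a ^+ 2) - y^-1).
rewrite (@ge0_integral_derive_y _ F 0).
- rewrite /F !mulr0 oppr0 expR0 cos0 sin0; congr EFin.
  by field; rewrite !gt_eqF.
- by move=> x x0; rewrite mulr_ge0// ?expR_ge0// subr_ge0 cos_le1.
- move=> x; apply: cvgM.
    apply: (@continuous_comp _ _ _ (fun x : R => - (y * x)) expR).
      by apply: cvgN; apply: cvgMl_tmp; exact: cvg_id.
    exact: continuous_expR.
  apply: cvgB; first exact: cvg_cst.
  apply: (@continuous_comp _ _ _ (fun x : R => (a * x)) cos).
    by apply: cvgMl_tmp; exact: cvg_id.
  exact: continuous_cos.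
- move=> x; apply: is_deriveP; rewrite /F; apply: is_derive_eq.
  by rewrite /GRing.scale/= !mulr1 /comp; field; rewrite !gt_eqF.
- apply: (@cvgy_le_expRN _ y ((y + `|a|) / (y ^+ 2 + a ^+ 2) + y^-1)) => // x x0.
  rewrite /F normrM (ger0_norm (expR_ge0 _)) mulrC ler_wpM2r ?expR_ge0//.
  rewrite (le_trans (ler_normB _ _))// lerD//; last by rewrite ger0_norm// invr_ge0 ltW.
  rewrite normrM [X in _ * X]gtr0_norm ?invr_gt0// ler_pM2r ?invr_gt0//.
  rewrite (le_trans (ler_normB _ _))// lerD//.
    rewrite normrM gtr0_norm//; apply: ler_piMr; first exact: ltW.
    by rewrite ler_norml cos_geN1 cos_le1.
  by rewrite normrM ler_piMr// ler_norml sin_geN1 sin_le1.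
Qed.

Lemma integral_atan a :
  (\int[leb R]_(y in `[0%R, +oo[) (a ^+ 2 / (y ^+ 2 + a ^+ 2))%:E
   = (`|a| * (pi / 2))%:E)%E.
Proof.
have [->|a0] := eqVneq a 0.
  rewrite normr0 mul0r.
  by apply: integral0_eq => y _; rewrite expr0n/= mul0r.
have na0 : 0 < `|a| by rewrite normr_gt0.
have aE : a ^+ 2 = `|a| ^+ 2 by rewrite real_normK// num_real.
rewrite aE; move: (`|a|) na0 => {a0 aE}a a0.
have d0 y : 0 < y ^+ 2 + a ^+ 2 by rewrite ltr_wpDl ?sqr_ge0// exprn_gt0.
pose F y := a * atan (a^-1 * y).
rewrite (@ge0_integral_derive_y _ F (a * (pi / 2))).
- by rewrite /F mulr0 atan0 mulr0 subr0.
- by move=> x _; rewrite divr_ge0// ltW// exprn_gt0.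
- move=> x; apply: cvgMl_tmp; apply: cvgV; first by rewrite gt_eqF.
  by apply: cvgD; [exact: exprn_continuous|exact: cvg_cst].
- move=> x; apply: is_deriveP; rewrite /F; apply: is_derive_eq.
  rewrite /GRing.scale/= !mulr1 /comp; field.
  by rewrite !gt_eqF//= addrC.
- apply: cvgMl_tmp; apply: (cvg_comp (fun y => a^-1 * y) (@atan R)).
    by apply: gt0_cvgMry => //; rewrite invr_gt0.
  exact: cvgy_atan.
Qed.

Lemma integral_exp_abs_1Bcos a y : 0 < y ->
  (\int[leb R]_w (expR (- (y * `|w|)) * (1 - cos (a * w)))%:E
   = (2 * a ^+ 2 / (y * (y ^+ 2 + a ^+ 2)))%:E)%E.
Proof.
move=> y0; rewrite ge0_symfun_integralT.
- rewrite -set_itvcy.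
  transitivity (2%:E * \int[leb R]_(w in `[0%R, +oo[)
      (expR (- (y * w)) * (1 - cos (a * w)))%:E)%E.
    congr (_ * _)%E; apply: eq_integral => w.
    by rewrite inE/= in_itv/= andbT => w0; rewrite ger0_norm.
  by rewrite integral_exp_1Bcos// -EFinM mulrA.
- by move=> w; rewrite mulr_ge0// ?expR_ge0// subr_ge0 cos_le1.
- move=> x; apply: cvgM.
    apply: (@continuous_comp _ _ _ (fun x : R => - (y * `|x|)) expR).
      by apply: cvgN; apply: cvgMl_tmp; exact: norm_continuous.
    exact: continuous_expR.
  apply: cvgB; first exact: cvg_cst.
  apply: (@continuous_comp _ _ _ (fun x : R => (a * x)) cos).
    by apply: cvgMl_tmp; exact: cvg_id.
  exact: continuous_cos.
- by move=> w /=; rewrite normrN mulrN cosN.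
Qed.

(** Replace [w^-2] by the integral of [y exp (- y |w|)] over [y > 0]. The integrand is nonnegative,
    so Tonelli applies without any integrability check; integrating in [w] first leaves the rational
    function of [integral_atan]. *)
Lemma integral_1Bcos_div_sqr a :
  (\int[leb R]_w ((1 - cos (a * w)) / w ^+ 2)%:E = (pi * `|a|)%:E)%E.
Proof.
(* Taking [Num.max q.2 0] for [y] makes the integrand vanish for [y <= 0], so that Tonelli can be
   used on the whole plane. *)
pose h (q : R * R) := Num.max q.2 0 * expR (- (Num.max q.2 0 * `|q.1|))
  * (1 - cos (a * q.1)).
have mh : measurable_fun setT h.
  apply: measurable_funM; last first.
    apply: measurable_funB => //; apply: measurableT_comp.
      exact: measurable_cos.
    by apply: measurable_funM => //.
  have m2 : measurable_fun setT (fun q : R * R => Num.max q.2 0).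
    exact: measurable_maxr.
  apply: measurable_funM => //; apply: measurableT_comp => //.
  apply: measurableT_comp => //; apply: measurable_funM => //.
  exact: measurableT_comp.
have h0 q : 0 <= h q.
  by rewrite mulr_ge0// ?subr_ge0 ?cos_le1// mulr_ge0 ?expR_ge0// le_max lexx orbT.
have hE (G : R -> R) : (\int[leb R]_y (Num.max y 0 * G (Num.max y 0))%:E =
    \int[leb R]_(y in `]0%R, +oo[) (y * G y)%:E)%E.
  rewrite [RHS]integral_mkcond; apply: eq_integral => y _.
  rewrite patchE mem_setE in_itv/= andbT; case: ltP => y0//.
  by rewrite mul0r.
have mexp w : measurable_fun (`]0, +oo[%classic : set R) (fun y => (y * expR (- (y * w)))%:E).
  apply/measurable_EFinP/measurable_funTS; apply: measurable_funM => //.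
  by apply: measurableT_comp => //; apply: measurableT_comp => //; exact: measurable_funM.
have mexpc y : measurable_fun setT
    (fun w => (expR (- (y * `|w|)) * (1 - cos (a * w)))%:E).
  apply/measurable_EFinP; apply: measurable_funM => //.
    apply: measurableT_comp => //; apply: measurableT_comp => //.
    by apply: measurable_funM.
  apply: measurable_funB => //; apply: measurableT_comp.
    exact: measurable_cos.
  exact: measurable_funM.
have matan : measurable_fun (`]0, +oo[%classic : set R) (fun y => (a ^+ 2 / (y ^+ 2 + a ^+ 2))%:E).
  apply/measurable_EFinP/measurable_funTS; apply: measurable_funM => //.
  by apply: measurableT_comp; [exact: measurable_invr|exact: measurable_funD].
transitivity (\int[leb R]_w \int[leb R]_y (h (w, y))%:E)%E.
  apply: eq_integral => w _; rewrite /h/=.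
  have [->|w0] := eqVneq w 0.
    rewrite mulr0 cos0 subrr mul0r.
    by rewrite integral0_eq// => y _; rewrite mulr0.
  have cw0 : 0 <= 1 - cos (a * w) by rewrite subr_ge0 cos_le1.
  under eq_integral do rewrite -mulrA.
  rewrite (hE (fun y => expR (- (y * `|w|)) * (1 - cos (a * w)))).
  under eq_integral do rewrite mulrA EFinM muleC.
  rewrite ge0_integralZl//=.
  - rewrite integral_itv_obnd_cbnd//.
      by rewrite integral_Mexp ?normr_gt0// real_normK ?num_real// -EFinM.
    exact: mexp.
  - by move=> y; rewrite in_itv/= andbT => y0; rewrite lee_fin mulr_ge0 ?expR_ge0// ltW.
rewrite (tonelliR mh h0).
transitivity (\int[leb R]_(y in `]0%R, +oo[) (2 * (a ^+ 2 / (y ^+ 2 + a ^+ 2)))%:E)%E.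
  rewrite [RHS]integral_mkcond; apply: eq_integral => y _.
  rewrite patchE mem_setE in_itv/= andbT; case: ltP => y0; rewrite /h/=; last first.
    by rewrite integral0_eq// => w _; rewrite max_r// !mul0r.
  rewrite max_l ?ltW//.
  under eq_integral do rewrite -mulrA EFinM.
  rewrite ge0_integralZl//=.
  - rewrite integral_exp_abs_1Bcos// -EFinM; congr EFin; field.
    by rewrite !gt_eqF// ltr_wpDr ?sqr_ge0// exprn_gt0.
  - exact: mexpc.
  - by rewrite lee_fin ltW.
under eq_integral do rewrite EFinM.
rewrite ge0_integralZl//=.
- rewrite integral_itv_obnd_cbnd; last exact: matan.
  by rewrite integral_atan -EFinM; congr EFin; field.
- by move=> w _; rewrite lee_fin divr_ge0 ?addr_ge0 ?sqr_ge0.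
Qed.

End improper_integrals.

Notation L1 v := ((leb _).-integrable setT (EFin \o v)).

(** * Exchange of integrals for bounded kernels *)

Section fubini.
Context {R : realType}.
Implicit Types (v a b : R -> R) (C : R).

Lemma L1_measurable v : L1 v -> measurable_fun setT v.
Proof. by move=> /integrableP[/measurable_EFinP]. Qed.

Lemma le_L1 v a : measurable_fun setT v -> (forall x, `|v x| <= a x) ->
  L1 a -> L1 v.
Proof.
move=> mv va; apply: le_integrable => //; first exact/measurable_EFinP.
by move=> x _ /=; rewrite lee_fin (le_trans (va x))// ler_norm.
Qed.

Lemma L1M_bounded v a C : L1 v -> measurable_fun setT a ->
  (forall x, `|a x| <= C) -> L1 (fun x => v x * a x).
Proof.
move=> iv ma aC; have mv := L1_measurable iv.
apply: (@le_L1 _ (fun x => C * `|v x|)).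
- exact: measurable_funM.
- by move=> x; rewrite normrM mulrC ler_wpM2r.
- apply: eq_integrable (integrableZl measurableT C (integrable_norm iv)) => //.
Qed.

Lemma normr_Rintegral_bounded v a C : L1 v -> measurable_fun setT a ->
  (forall x, `|a x| <= C) ->
  `|\int[leb R]_t (v t * a t)| <= C * \int[leb R]_t `|v t|.
Proof.
move=> iv ma aC.
have i2 := L1M_bounded iv ma aC.
apply: (le_trans (le_normr_Rintegral _ i2)) => //.
rewrite -RintegralZl//; last exact: (integrable_norm iv).
apply: le_Rintegral => //.
- exact: (integrable_norm i2).
- apply: eq_integrable (integrableZl measurableT C (integrable_norm iv)) => //.
- by move=> x _; rewrite normrM mulrC ler_wpM2r.
Qed.

Lemma EFin_Rintegral v : L1 v -> (\int[leb R]_t v t)%:E = (\int[leb R]_t (v t)%:E)%E.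
Proof. by move=> iv; rewrite /Rintegral fineK//; exact: integrable_fin_num. Qed.

Lemma measurable_section1 (m : R * R -> R) (x : R) : measurable_fun setT m ->
  measurable_fun setT (fun y => m (x, y)).
Proof. by move=> mm; apply: measurableT_comp => //; exact: measurable_pair1. Qed.

Lemma measurable_section2 (m : R * R -> R) (y : R) : measurable_fun setT m ->
  measurable_fun setT (fun x => m (x, y)).
Proof. by move=> mm; apply: measurableT_comp => //; exact: measurable_pair2. Qed.

(** Tonelli gives measurability for nonnegative integrands; adding [C |b y|] makes the integrand
    nonnegative and changes the integral only by a constant independent of [x]. *)
Lemma measurable_Rintegral_bounded b (m : R * R -> R) C : L1 b ->
  measurable_fun setT m -> (forall q, `|m q| <= C) ->
  measurable_fun setT (fun x => \int[leb R]_y (b y * m (x, y))).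
Proof.
move=> ib mm mC; have mb := L1_measurable ib.
have C0 : 0 <= C by apply: le_trans (mC (0, 0)).
pose h (q : R * R) := (b q.2 * m q + C * `|b q.2|)%:E.
have mh : measurable_fun setT h.
  apply/measurable_EFinP; apply: measurable_funD.
    by apply: measurable_funM => //; exact: measurableT_comp.
  apply: measurable_funM => //; apply: measurableT_comp => //.
  exact: measurableT_comp.
have h0 q : (0 <= h q)%E.
  have : `|b q.2 * m q| <= C * `|b q.2| by rewrite normrM mulrC ler_wpM2r.
  by rewrite /h lee_fin ler_norml => /andP[bm _]; rewrite -lerBlDr sub0r.
have iC : L1 (fun y => C * `|b y|).
  apply: eq_integrable (integrableZl measurableT C (integrable_norm ib)) => //.
have -> : (fun x => \int[leb R]_y (b y * m (x, y))) =
    (fun x => fine (\int[leb R]_y h (x, y))%E - \int[leb R]_y (C * `|b y|)).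
  apply/funext => x; rewrite -[fine _]/(\int[leb R]_y (b y * m (x, y) + C * `|b y|)).
  rewrite RintegralD// ?addrK//.
  apply: (L1M_bounded ib _ (fun y => mC (x, y))).
  exact: measurable_section1.
apply: measurable_funB => //; apply: measurableT_comp => //.
exact: (@measurable_fun_fubini_tonelli_F _ _ _ _ R (leb R) h mh h0).
Qed.

(** The integrand is dominated by [C |a x| |b y|], which is integrable on the plane, so Fubini
    applies. *)
Lemma fubini_bounded a b (m : R * R -> R) C : L1 a -> L1 b ->
  measurable_fun setT m -> (forall q, `|m q| <= C) ->
  \int[leb R]_x (a x * \int[leb R]_y (b y * m (x, y))) =
  \int[leb R]_y (b y * \int[leb R]_x (a x * m (x, y))).
Proof.
move=> ia ib mm mC; have mb := L1_measurable ib; have ma := L1_measurable ia.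
have C0 : 0 <= C by apply: le_trans (mC (0, 0)).
pose f (q : R * R) := (a q.1 * (b q.2 * m q))%:E.
have mf : measurable_fun setT f.
  apply/measurable_EFinP; apply: measurable_funM; first exact: measurableT_comp.
  by apply: measurable_funM => //; exact: measurableT_comp.
have i1 x : L1 (fun y => b y * m (x, y)).
  by apply: (L1M_bounded ib _ (fun y => mC (x, y))); exact: measurable_section1.
have i2 y : L1 (fun x => a x * m (x, y)).
  by apply: (L1M_bounded ia _ (fun x => mC (x, y))); exact: measurable_section2.
have intf : (leb R \x leb R)%E.-integrable setT f.
  have [_] := @integrable12ltyP _ _ _ _ R (leb R) (leb R) f mf; apply.
  have iC : L1 (fun x => `|a x| * (C * \int[leb R]_y `|b y|)).
    apply: eq_integrable (integrableZr measurableT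
      (C * \int[leb R]_y `|b y|) (integrable_norm ia)) => //.
  apply: le_lt_trans (integrable_lty _ iC) => //.
  apply: ge0_le_integral => //.
  - by move=> x _; exact: integral_ge0.
  - apply: (@measurable_fun_fubini_tonelli_F _ _ _ _ R (leb R) (abse \o f)) => //.
      exact: measurableT_comp.
    by move=> q; exact: abse_ge0.
  - exact: (measurable_int _ iC).
  - move=> x _ /=.
    under eq_integral do rewrite normrM EFinM.
    rewrite integralZl//; last exact: (integrable_norm (i1 x)).
    rewrite -EFin_Rintegral; last exact: (integrable_norm (i1 x)).
    rewrite -EFinM lee_fin ler_wpM2l//.
    rewrite -RintegralZl//; last exact: (integrable_norm ib).
    apply: le_Rintegral => //.
    + exact: (integrable_norm (i1 x)).
    + apply: eq_integrable (integrableZl measurableT C (integrable_norm ib)) => //.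
    + by move=> y _; rewrite normrM mulrC ler_wpM2r.
have E1 : (\int[leb R]_x \int[leb R]_y f (x, y) =
    \int[leb R]_x (a x * \int[leb R]_y (b y * m (x, y)))%:E)%E.
  apply: eq_integral => x _; rewrite /f/=.
  under eq_integral do rewrite EFinM.
  by rewrite EFinM (EFin_Rintegral (i1 x)) integralZl//; exact: i1.
have E2 : (\int[leb R]_y \int[leb R]_x f (x, y) =
    \int[leb R]_y (b y * \int[leb R]_x (a x * m (x, y)))%:E)%E.
  apply: eq_integral => y _; rewrite /f/=.
  under eq_integral do rewrite mulrCA EFinM.
  by rewrite EFinM (EFin_Rintegral (i2 y)) integralZl//; exact: i2.
congr fine; exact: etrans (esym E1) (etrans (Fubini intf) E2).
Qed.

End fubini.

(** * Cosine and sine transforms of integrable functions *)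

Section trigonometric_transforms.
Context {R : realType}.
Implicit Types (v k : R -> R).

(** Up to the factor [1 / sqrt (2 pi)], [ct v] is the real part and [- st v] the imaginary part of
    the Fourier transform, so Plancherel's identity can be proved in real terms. *)
Definition ct v (w : R) := \int[leb R]_t (v t * cos (w * t)).
Definition st v (w : R) := \int[leb R]_t (v t * sin (w * t)).

Lemma normr_cos (x : R) : `|cos x| <= 1.
Proof. by rewrite ler_norml cos_geN1 cos_le1. Qed.

Lemma normr_sin (x : R) : `|sin x| <= 1.
Proof. by rewrite ler_norml sin_geN1 sin_le1. Qed.

Lemma measurable_cosM : measurable_fun setT (fun q : R * R => cos (q.1 * q.2)).
Proof.
by apply: measurableT_comp; [exact: measurable_cos|exact: measurable_funM].
Qed.

Lemma measurable_sinM : measurable_fun setT (fun q : R * R => sin (q.1 * q.2)).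
Proof.
by apply: measurableT_comp; [exact: measurable_sin|exact: measurable_funM].
Qed.

Lemma L1_cosM v (w : R) : L1 v -> L1 (fun t => v t * cos (w * t)).
Proof.
move=> iv; apply: (L1M_bounded iv _ (fun t => normr_cos (w * t))).
exact: (measurable_section1 w measurable_cosM).
Qed.

Lemma L1_sinM v (w : R) : L1 v -> L1 (fun t => v t * sin (w * t)).
Proof.
move=> iv; apply: (L1M_bounded iv _ (fun t => normr_sin (w * t))).
exact: (measurable_section1 w measurable_sinM).
Qed.

Lemma measurable_ct v : L1 v -> measurable_fun setT (ct v).
Proof.
move=> iv; apply: (measurable_Rintegral_bounded iv measurable_cosM).
by move=> q; exact: normr_cos.
Qed.

Lemma measurable_st v : L1 v -> measurable_fun setT (st v).
Proof.
move=> iv; apply: (measurable_Rintegral_bounded iv measurable_sinM).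
by move=> q; exact: normr_sin.
Qed.

Lemma normr_ct v (w : R) : L1 v -> `|ct v w| <= \int[leb R]_t `|v t|.
Proof.
move=> iv; rewrite -[leRHS]mul1r; apply: (normr_Rintegral_bounded iv).
  exact: (measurable_section1 w measurable_cosM).
by move=> t; exact: normr_cos.
Qed.

Lemma normr_st v (w : R) : L1 v -> `|st v w| <= \int[leb R]_t `|v t|.
Proof.
move=> iv; rewrite -[leRHS]mul1r; apply: (normr_Rintegral_bounded iv).
  exact: (measurable_section1 w measurable_sinM).
by move=> t; exact: normr_sin.
Qed.

Lemma ctB v1 v2 (w : R) : L1 v1 -> L1 v2 -> ct (v1 \- v2) w = ct v1 w - ct v2 w.
Proof.
move=> i1 i2; rewrite /ct -RintegralB//; [|exact: L1_cosM..].
by apply: eq_Rintegral => t _; rewrite mulrBl.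
Qed.

Lemma stB v1 v2 (w : R) : L1 v1 -> L1 v2 -> st (v1 \- v2) w = st v1 w - st v2 w.
Proof.
move=> i1 i2; rewrite /st -RintegralB//; [|exact: L1_sinM..].
by apply: eq_Rintegral => t _; rewrite mulrBl.
Qed.

(** Formally [ct v w ^+ 2 + st v w ^+ 2] is the double integral of [v s * v t * cos (w * (s - t))].
    Only one of the two copies of [v] is expanded at a time: the other stays inside the bounded
    function [m], and [fubini_bounded] is applied twice instead of a threefold Fubini. *)
Lemma Rintegral_kernel_ct_st v k : L1 v -> L1 k ->
  \int[leb R]_w (k w * (ct v w ^+ 2 + st v w ^+ 2)) =
  \int[leb R]_s (v s * \int[leb R]_t (v t * \int[leb R]_w (k w * cos (w * (s - t))))).
Proof.
move=> iv ik.
pose I := \int[leb R]_t `|v t|.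
pose m (q : R * R) := cos (q.1 * q.2) * ct v q.1 + sin (q.1 * q.2) * st v q.1.
have mm : measurable_fun setT m.
  apply: measurable_funD; apply: measurable_funM.
  - exact: measurable_cosM.
  - by apply: measurableT_comp; [exact: measurable_ct|].
  - exact: measurable_sinM.
  - by apply: measurableT_comp; [exact: measurable_st|].
have mI q : `|m q| <= I + I.
  apply: (le_trans (ler_normD _ _)); rewrite !normrM.
  by apply: lerD; rewrite -[leRHS]mul1r ler_pM ?normr_cos ?normr_sin ?normr_ct ?normr_st.
transitivity (\int[leb R]_w (k w * \int[leb R]_s (v s * m (w, s)))).
  apply: eq_Rintegral => w _; congr (_ * _).
  rewrite !expr2 {1}/ct {1}/st -RintegralZr//; last exact: L1_cosM.
  rewrite -RintegralZr//; last exact: L1_sinM.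
  rewrite -RintegralD//.
  - by apply: eq_Rintegral => s _; rewrite /m/= mulrDr !mulrA.
  - apply: eq_integrable (integrableZr measurableT (ct v w) (L1_cosM w iv)) => //.
  - apply: eq_integrable (integrableZr measurableT (st v w) (L1_sinM w iv)) => //.
rewrite (fubini_bounded ik iv mm mI).
apply: eq_Rintegral => s _; congr (_ * _).
pose m' (q : R * R) := cos (q.1 * (s - q.2)).
have mm' : measurable_fun setT m'.
  apply: measurableT_comp; first exact: measurable_cos.
  by apply: measurable_funM => //; exact: measurable_funB.
have := fubini_bounded ik iv mm' (fun q => normr_cos _).
rewrite /m'/= => <-; apply: eq_Rintegral => w _; congr (_ * _).
rewrite /m/= /ct /st [LHS]addrC mulrC -RintegralZr//; last exact: L1_sinM.
rewrite [X in _ + X]mulrC -RintegralZr//; last exact: L1_cosM.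
rewrite -RintegralD//.
- by apply: eq_Rintegral => t _; rewrite mulrBr cosB; ring.
- apply: eq_integrable (integrableZr measurableT (sin (w * s)) (L1_sinM w iv)) => //.
- apply: eq_integrable (integrableZr measurableT (cos (w * s)) (L1_cosM w iv)) => //.
Qed.

End trigonometric_transforms.

(** * The tent function as transform of the squared sinc *)

Section tent.
Context {R : realType}.
Implicit Types (eta r s : R) (v : R -> R).

(* [(sin (eta w) / (eta w))^2], in the form to which [integral_1Bcos_div_sqr] applies. *)
Definition sinc2 eta (w : R) := (2 * eta ^+ 2)^-1 * ((1 - cos (2 * eta * w)) / w ^+ 2).

(** The triangle of height [(2 * eta)^-1] on [[- 2 eta, 2 eta]], of total mass one, written as a
    second difference of the absolute value since that is what [Rintegral_1Bcos_div_sqr] produces;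
    [tentE] recovers the usual form. *)
Definition tent eta r :=
  (8 * eta ^+ 2)^-1 * (`|r + 2 * eta| + `|r - 2 * eta| - 2 * `|r|).

Lemma measurable_1Bcos_div_sqr (a : R) :
  measurable_fun setT (fun w : R => (1 - cos (a * w)) / w ^+ 2).
Proof.
apply: measurable_funM.
  apply: measurable_funB => //; apply: measurableT_comp; first exact: measurable_cos.
  exact: measurable_funM.
by apply: measurableT_comp; [exact: measurable_invr|exact: measurable_funX].
Qed.

Lemma L1_1Bcos_div_sqr (a : R) : L1 (fun w : R => (1 - cos (a * w)) / w ^+ 2).
Proof.
apply/integrableP; split.
  by apply/measurable_EFinP; exact: measurable_1Bcos_div_sqr.
under eq_integral => w _.
  rewrite /= ger0_norm; last by rewrite divr_ge0 ?sqr_ge0// subr_ge0 cos_le1.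
  over.
by rewrite integral_1Bcos_div_sqr ltry.
Qed.

Lemma Rintegral_1Bcos_div_sqr (a : R) :
  \int[leb R]_w ((1 - cos (a * w)) / w ^+ 2) = pi * `|a|.
Proof. by rewrite /Rintegral integral_1Bcos_div_sqr. Qed.

Lemma L1Zl (c : R) v : L1 v -> L1 (fun x => c * v x).
Proof.
by move=> iv; apply: eq_integrable (integrableZl measurableT c iv) => //.
Qed.

Lemma L1D v1 v2 : L1 v1 -> L1 v2 -> L1 (fun x => v1 x + v2 x).
Proof.
by move=> i1 i2; apply: eq_integrable (integrableD measurableT i1 i2) => //.
Qed.

Lemma L1B v1 v2 : L1 v1 -> L1 v2 -> L1 (fun x => v1 x - v2 x).
Proof.
by move=> i1 i2; apply: eq_integrable (integrableB measurableT i1 i2) => //.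
Qed.

Lemma L1_sinc2 eta : L1 (sinc2 eta).
Proof. by apply: L1Zl; exact: L1_1Bcos_div_sqr. Qed.

(** The product-to-sum formula for [(1 - cos (2 eta w)) cos (r w)] leaves three integrals of the
    form [(1 - cos (a w)) / w^2], at [a = r + 2 eta], [r - 2 eta] and [r]. *)
Lemma Rintegral_sinc2_cos eta r : 0 < eta ->
  \int[leb R]_w (sinc2 eta w * cos (w * r)) = 2 * pi * tent eta r.
Proof.
move=> eta0; pose D (a w : R) := (1 - cos (a * w)) / w ^+ 2.
transitivity (\int[leb R]_w ((2 * eta ^+ 2)^-1 *
    (2^-1 * D (r + 2 * eta) w + 2^-1 * D (r - 2 * eta) w - D r w))).
  apply: eq_Rintegral => w _; rewrite /sinc2 -mulrA; congr (_ * _).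
  rewrite /D (mulrDl r) (mulrBl w r) cosD cosB (mulrC w r).
  have -> : 2^-1 * ((1 - (cos (r * w) * cos (2 * eta * w) - sin (r * w) * sin (2 * eta * w))) / w ^+ 2)
   + 2^-1 * ((1 - (cos (r * w) * cos (2 * eta * w) + sin (r * w) * sin (2 * eta * w))) / w ^+ 2)
   - (1 - cos (r * w)) / w ^+ 2
   = ((1 - cos (2 * eta * w)) * cos (r * w)) / w ^+ 2.
    by move: (w ^+ 2)^-1 => z; field.
  by rewrite mulrAC.
have iD a : L1 (D a) by exact: L1_1Bcos_div_sqr.
rewrite RintegralZl//; last first.
  by apply: L1B => //; apply: L1D; exact: L1Zl.
rewrite RintegralB//; last by apply: L1D; exact: L1Zl.
rewrite RintegralD//; [|exact: L1Zl..].
rewrite !RintegralZl// !Rintegral_1Bcos_div_sqr /tent; field.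
by rewrite gt_eqF.
Qed.

Lemma tentE eta r : 0 < eta -> tent eta r =
  (4 * eta ^+ 2)^-1 * Num.max (2 * eta - `|r|) 0.
Proof.
move=> eta0; rewrite /tent; apply: (@mulfI _ (8 * eta ^+ 2)).
  by rewrite mulf_neq0// sqrf_eq0 gt_eqF.
rewrite mulrA mulfV ?mul1r; last by rewrite mulf_neq0// sqrf_eq0 gt_eqF.
rewrite mulrA; have -> : 8 * eta ^+ 2 / (4 * eta ^+ 2) = 2.
  by field; rewrite gt_eqF.
wlog r0 : r / 0 <= r => [H|].
  have [/H//|/ltW r0] := leP 0 r.
  have := H (- r); rewrite oppr_ge0 normrN => /(_ r0) <-.
  rewrite -[`|- r + 2 * eta|]normrN -[`|- r - 2 * eta|]normrN.
  have -> : - (- r + 2 * eta) = r - 2 * eta by ring.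
  have -> : - (- r - 2 * eta) = r + 2 * eta by ring.
  by rewrite (addrC `|_|).
rewrite (ger0_norm r0) (@ger0_norm _ (r + 2 * eta)); last lra.
case: leP => h.
  by rewrite ger0_norm; lra.
by rewrite ltr0_norm; lra.
Qed.

Lemma tent_ge0 eta r : 0 < eta -> 0 <= tent eta r.
Proof.
move=> eta0; rewrite tentE// mulr_ge0//.
  by rewrite invr_ge0; apply: mulr_ge0 => //; exact: sqr_ge0.
by rewrite le_max lexx orbT.
Qed.

Lemma tent_le eta r : 0 < eta -> tent eta r <= (2 * eta)^-1.
Proof.
move=> eta0; rewrite tentE//.
have -> : (2 * eta)^-1 = (4 * eta ^+ 2)^-1 * (2 * eta).
  by field; rewrite gt_eqF.
rewrite ler_wpM2l//.
  by rewrite invr_ge0; apply: mulr_ge0 => //; exact: sqr_ge0.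
by rewrite ge_max gerBl normr_ge0/= mulr_ge0// ltW.
Qed.

Lemma tent_eq0 eta r : 0 < eta -> 2 * eta <= `|r| -> tent eta r = 0.
Proof.
by move=> eta0 rl; rewrite tentE// max_r ?mulr0// subr_le0.
Qed.

Lemma continuous_tent eta s : continuous (fun t : R => tent eta (s - t)).
Proof.
move=> t; apply: cvgMl_tmp; apply: cvgB.
  by apply: cvgD; apply: cvg_norm; apply: cvgD => //; try exact: cvg_cst;
     apply: cvgB; [exact: cvg_cst|exact: cvg_id|exact: cvg_cst|exact: cvg_id].
by apply: cvgMl_tmp; apply: cvg_norm; apply: cvgB; [exact: cvg_cst|exact: cvg_id].
Qed.

Lemma integral_itv_derive (f f' F : R -> R) (a b : R) : a < b ->
  continuous f -> (forall x, derivable F x 1 /\ 'D_1 F x = f' x) ->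
  (forall x, a < x < b -> f' x = f x) ->
  (\int[leb R]_(x in `[a, b]) (f x)%:E = (F b - F a)%:E)%E.
Proof.
move=> ab cf dF ff'.
have cF x : {for x, continuous F}.
  apply/differentiable_continuous/derivable1_diffP.
  by case: (dF x).
rewrite (@continuous_FTC2 _ _ F)//.
- exact: continuous_subspaceT.
- split.
  + by move=> x _; case: (dF x).
  + exact/cvg_at_right_filter/cF.
  + exact/cvg_at_left_filter/cF.
- by move=> x; rewrite in_itv/= => xab; rewrite derive1E; case: (dF x) => _ ->; exact: ff'.
Qed.

Lemma integral_tent eta s : 0 < eta ->
  (\int[leb R]_t (tent eta (s - t))%:E = 1)%E.
Proof.
move=> eta0.
pose c := (8 * eta ^+ 2)^-1.
have c8 : c * (4 * eta ^+ 2) = 2^-1 by rewrite /c; field; rewrite gt_eqF.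
pose F1 (t : R) := c * (t - s + 2 * eta) ^+ 2.
pose F2 (t : R) := - c * (s - t + 2 * eta) ^+ 2.
have mt : measurable_fun setT (fun t : R => (tent eta (s - t))%:E).
  by apply/measurable_EFinP; apply: continuous_measurable_fun; exact: continuous_tent.
have dF1 (x : R) : is_derive x 1 F1 (2 * c * (x - s + 2 * eta)).
  by rewrite /F1; apply: is_derive_eq; rewrite /GRing.scale/=; ring.
have dF2 (x : R) : is_derive x 1 F2 (2 * c * (s - x + 2 * eta)).
  by rewrite /F2; apply: is_derive_eq; rewrite /GRing.scale/=; ring.
have I1 : (\int[leb R]_(t in `[(s - 2 * eta)%R, s]) (tent eta (s - t))%:E = (2^-1)%:E)%E.
  rewrite (integral_itv_derive _ _ (fun x => is_deriveP (dF1 x))).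
  - by congr EFin; rewrite /F1 -c8; ring.
  - by rewrite gtrBl; lra.
  - exact: continuous_tent.
  - move=> x /andP[x1 x2]; rewrite tentE// ger0_norm; last lra.
    rewrite max_l; last lra.
    by rewrite /c; field; rewrite gt_eqF.
have I2 : (\int[leb R]_(t in `[s, (s + 2 * eta)%R]) (tent eta (s - t))%:E = (2^-1)%:E)%E.
  rewrite (integral_itv_derive _ _ (fun x => is_deriveP (dF2 x))).
  - by congr EFin; rewrite /F2 -c8; ring.
  - by rewrite ltrDl; lra.
  - exact: continuous_tent.
  - move=> x /andP[x1 x2]; rewrite tentE// ler0_norm; last lra.
    rewrite max_l; last lra.
    by rewrite /c; field; rewrite gt_eqF.
transitivity (\int[leb R]_(t in `[(s - 2 * eta)%R, (s + 2 * eta)%R]) (tent eta (s - t))%:E)%E.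
  rewrite [RHS]integral_mkcond; apply: eq_integral => t _.
  rewrite patchE; case: ifPn => //; rewrite notin_setE /= in_itv/= => /negP h.
  rewrite tent_eq0//; move: h; rewrite negb_and -!ltNge => /orP[h|h].
    by rewrite ger0_norm; lra.
  by rewrite ler0_norm; lra.
rewrite (@itv_bndbnd_setU _ _ _ (BLeft s)); [|by rewrite bnd_simp; lra..].
rewrite ge0_integral_setU//=.
- rewrite integral_itv_bndo_bndc; last exact: measurable_funTS.
  by rewrite I1 I2 -EFinD; congr EFin; field.
- exact: measurable_funTS.
- by move=> t _; rewrite lee_fin tent_ge0.
- apply/disj_setPRL => t /=; rewrite !in_itv/= => /andP[st _].
  by apply/negP; rewrite negb_and -!leNgt st orbT.
Qed.

End tent.

(** * The tents as an approximate identity *)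

Section approximate_identity.
Context {R : realType}.
Implicit Types (eta r s w : R) (v : R -> R).

Lemma L1_tent eta s : 0 < eta -> L1 (fun t : R => tent eta (s - t)).
Proof.
move=> eta0; apply/integrableP; split.
  by apply/measurable_EFinP; apply: continuous_measurable_fun; exact: continuous_tent.
under eq_integral => t _ do rewrite /= ger0_norm ?tent_ge0//.
by rewrite integral_tent// ltry.
Qed.

Lemma measurable_tentB eta :
  measurable_fun setT (fun q : R * R => tent eta (q.1 - q.2)).
Proof.
have mB : measurable_fun setT (fun q : R * R => q.1 - q.2) by exact: measurable_funB.
apply: (measurableT_comp _ mB).
apply: measurable_funM => //; apply: measurable_funB.
  by apply: measurable_funD; apply: measurableT_comp => //; exact: measurable_funD.
by apply: measurable_funM => //; exact: measurableT_comp.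
Qed.

(** As the tent has mass one, [v s] can be taken under the integral. With [eta = r / 2] the tent
    lives on the ball of radius [r] and is at most [r^-1], twice the inverse of the length of that
    ball; hence the factor 2. *)
Lemma tent_average_le_davg v s r : 0 < r -> L1 v ->
  (`|\int[leb R]_t (v t * tent (r / 2) (s - t)) - v s|%:E <= 2%:E * davg v s r)%E.
Proof.
move=> r0 iv; set eta := r / 2.
have eta0 : 0 < eta by rewrite divr_gt0.
have mv := L1_measurable iv.
have mt : measurable_fun setT (fun t : R => tent eta (s - t)).
  by apply: continuous_measurable_fun; exact: continuous_tent.
have it : L1 (fun t : R => tent eta (s - t)) by exact: L1_tent.
have ivt : L1 (fun t => v t * tent eta (s - t)).
  apply: (L1M_bounded iv mt) => t.
  by rewrite ger0_norm ?tent_ge0//; exact: tent_le.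
have -> : \int[leb R]_t (v t * tent eta (s - t)) - v s =
    \int[leb R]_t ((v t - v s) * tent eta (s - t)).
  have vsE : v s = \int[leb R]_t (v s * tent eta (s - t)).
    by rewrite RintegralZl// /Rintegral integral_tent//= mulr1.
  rewrite {1}vsE -RintegralB//; last exact: L1Zl.
  by apply: eq_Rintegral => t _; rewrite mulrBl.
have id : L1 (fun t => (v t - v s) * tent eta (s - t)).
  apply: eq_integrable (L1B ivt (L1Zl (v s) it)) => // t _.
  by rewrite /= mulrBl.
rewrite EFin_normr_Rintegral//.
apply: (le_trans (le_abse_integral _ _ _)) => //; first exact: (measurable_int _ id).
rewrite /davg /iavg (lebesgue_measure_ball _ (ltW r0)).
rewrite muleA inver mulrn_eq0/= gt_eqF// -EFinM.
have -> : 2 * (r *+ 2)^-1 = r^-1 by rewrite -mulr_natr; field; rewrite gt_eqF.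
have mvBE : measurable_fun setT (fun x => (`|v x - v s|)%:E).
  apply/measurable_EFinP; apply: measurableT_comp => //.
  exact: measurable_funB.
have ri0 : 0 <= r^-1 by rewrite invr_ge0 ltW.
rewrite -ge0_integralZl_EFin//; first last.
- exact: measurable_funTS mvBE.
- exact: measurable_ball.
rewrite [leRHS]integral_mkcond; apply: ge0_le_integral => //.
- by apply/measurable_EFinP; apply: measurableT_comp => //; exact: (L1_measurable id).
- apply/(measurable_restrictT _ _).1; first exact: measurable_ball.
  by apply: measurable_funTS; apply: measurable_funeM; exact: mvBE.
- move=> t _; rewrite patchE /=; case: ifPn => tb.
    rewrite lee_fin normrM mulrC ler_wpM2r// ger0_norm ?tent_ge0//.
    have -> : r = 2 * eta by rewrite /eta; field.
    exact: tent_le.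
  rewrite tent_eq0 ?mulr0 ?normr0//.
  move: tb; rewrite notin_setE /ball/= => /negP; rewrite -leNgt.
  by have -> : 2 * eta = r by rewrite /eta; field.
Qed.

Lemma cvg_tent_average v s : L1 v -> lebesgue_pt v s ->
  \int[leb R]_t (v t * tent (n.+1%:R^-1 / 2) (s - t)) @[n --> \oo] --> v s.
Proof.
move=> iv sv.
have c0 : (2%:E * davg v s (n.+1%:R^-1 : R)%R)%E @[n --> \oo] --> (0 : \bar R)%E.
  rewrite -(mule0 2%:E); apply: cvgeZl => //.
  apply: (cvg_comp _ _ _ sv) => P [e /= e0 eP].
  near=> n; apply: eP => /=; last by rewrite invr_gt0.
  rewrite sub0r normrN gtr0_norm ?invr_gt0//.
  by near: n; exact: near_infty_natSinv_lt (PosNum e0).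
have : (`|\int[leb R]_t (v t * tent (n.+1%:R^-1 / 2) (s - t)) - v s|%:E
    @[n --> \oo] --> (0 : R)%:E)%E.
  apply: (squeeze_cvge _ (cvg_cst 0%E) c0); near=> n.
  by rewrite lee_fin normr_ge0/= tent_average_le_davg// invr_gt0.
move=> /fine_cvg /= /norm_cvg0 c1.
apply: (cvg_sub0 c1); exact: cvg_cst.
Unshelve. all: by end_near. Qed.

Lemma normr_sin_le (x : R) : `|sin x| <= `|x|.
Proof.
wlog x0 : x / 0 < x => [H|].
  have [x0|x0|<-] := ltgtP 0 x; first exact: H.
    by rewrite -normrN -sinN -[leRHS]normrN H// oppr_gt0.
  by rewrite sin0.
have [c _] := @MVT R sin cos 0 x x0 (fun x _ => is_derive_sin x)
  (continuous_subspaceT (@continuous_sin R)).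
rewrite sin0 !subr0 => ->; rewrite normrM ler_piMl//; exact: normr_cos.
Qed.

Lemma sinc2E eta w : eta * w != 0 -> sinc2 eta w = (sin (eta * w) / (eta * w)) ^+ 2.
Proof.
move=> ew; rewrite /sinc2 [X in cos X](_ : _ = (eta * w) *+ 2); last first.
  by rewrite -mulrA mulr_natl.
rewrite cos_mulr2n.
move: ew; rewrite mulf_eq0 negb_or => /andP[e0 w0].
have := cos2Dsin2 (eta * w).
move: (cos _) (sin _) => c s cs.
have -> : c ^+ 2 *+ 2 = 2 - 2 * s ^+ 2 
  by rewrite -mulr_natl -(addrK (s ^+ 2) (c ^+ 2)) cs; ring.
by field; rewrite e0 w0.
Qed.

Lemma sinc2_ge0 eta w : 0 <= sinc2 eta w.
Proof.
rewrite mulr_ge0 ?invr_ge0//; first by apply: mulr_ge0 => //; exact: sqr_ge0.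
by rewrite divr_ge0 ?sqr_ge0// subr_ge0 cos_le1.
Qed.

Lemma sinc2_le1 eta w : sinc2 eta w <= 1.
Proof.
(* The sine form of [sinc2] needs a nonzero argument. At [eta * w = 0] the numerator [1 - cos 0]
   vanishes, so [sinc2] takes the value 0 there and not its limit 1. *)
have [|ew] := eqVneq (eta * w) 0; last first.
  rewrite sinc2E// -real_normK ?num_real// exprn_ile1//.
  by rewrite normrM normfV ler_pdivrMr ?normr_gt0// mul1r normr_sin_le.
move=> ew; rewrite /sinc2 -mulrA ew mulr0 cos0 subrr mul0r mulr0.
exact: ler01.
Qed.

Lemma cvg_sinc2 w : w != 0 ->
  sinc2 (n.+1%:R^-1 / 2) w @[n --> \oo] --> (1 : R).
Proof.
move=> w0.
pose h n : R := n.+1%:R^-1 / 2 * w.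
have h0 n : h n != 0 by rewrite !mulf_neq0// invr_neq0.
have hc : h n @[n --> \oo] --> (0 : R).
  rewrite -(mul0r w) -(mul0r 2^-1).
  by apply: cvgMr_tmp; apply: cvgMr_tmp; exact: cvg_harmonic.
have -> : (fun n => sinc2 (n.+1%:R^-1 / 2) w) = (fun n => (sin (h n) / h n) ^+ 2).
  by apply/funext => n; exact: (sinc2E (h0 n)).
rewrite -[X in _ --> X]mulr1.
suff : sin (h n) / h n @[n --> \oo] --> (1 : R).
  by move=> c; exact: (cvgM c c).
(* The limit of [sin h / h] is read off as the derivative of [sin] at 0. *)
have D : x^-1 *: ((sin \o shift 0) (x *: (1 : R)) - sin 0) @[x --> (0 : R)^']
    --> 'D_1 sin (0 : R) by exact: (@derivable_sin R 0).
move/cvgr_dnbhsP : D => /(_ h (conj h0 hc)).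
rewrite derive_val cos0; apply: cvg_trans; apply: near_eq_cvg; near=> n.
by rewrite /= sin0 subr0 addr0 /GRing.scale/= mulr1 mulrC.
Unshelve. all: by end_near. Qed.

End approximate_identity.

Section almost_everywhere.
Context d (T : measurableType d) (R : realType) (mu : {measure set T -> \bar R}).
Implicit Types P Q S : T -> Prop.

Lemma ae_imp P Q : {ae mu, forall x, P x} -> (forall x, P x -> Q x) ->
  {ae mu, forall x, Q x}.
Proof.
move=> [N [mN N0 PN]] PQ; exists N; split => // x /= nQ.
by apply: PN => /= /PQ.
Qed.

Lemma ae_imp2 P Q S : {ae mu, forall x, P x} -> {ae mu, forall x, Q x} ->
  (forall x, P x -> Q x -> S x) -> {ae mu, forall x, S x}.
Proof.
move=> aP aQ PQS; have : {ae mu, forall x, P x /\ Q x}.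
  move: aP aQ => [N [mN N0 PN]] [M [mM M0 QM]].
  exists (N `|` M); split; first exact: measurableU.
    apply/eqP; rewrite eq_le measure_ge0 andbT.
    have <- : (mu N + mu M = 0)%E by rewrite N0 M0 adde0.
    exact: measureU2.
  move=> x /= /not_andP[nP|nQ]; first by left; exact: PN.
  by right; exact: QM.
by move=> PQ; apply: (ae_imp PQ) => x [Px Qx]; exact: PQS.
Qed.

End almost_everywhere.

Section fatou_le.
Context {R : realType}.

Lemma limn_einf_le (a b : nat -> \bar R) : (forall n, a n <= b n)%E ->
  (limn_einf a <= limn_einf b)%E.
Proof.
move=> ab; rewrite !limn_einf_lim; apply: lee_lim; [exact: is_cvg_einfs..|].
apply: nearW => n; apply: le_ereal_inf_tmp => _ [k /= nk <-].
by apply: le_trans (ab k); apply: ereal_inf_lbound; exists k.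
Qed.

Lemma fatou_le (f_ : nat -> R -> R) (f : R -> R) (u : nat -> \bar R) (l : \bar R) :
  (forall n, measurable_fun setT (f_ n)) -> (forall n x, 0 <= f_ n x) ->
  measurable_fun setT f -> (forall x, 0 <= f x) ->
  {ae leb R, forall x, f_ n x @[n --> \oo] --> f x} ->
  (forall n, \int[leb R]_x (f_ n x)%:E <= u n)%E -> u @ \oo --> l ->
  (\int[leb R]_x (f x)%:E <= l)%E.
Proof.
move=> mf_ f_0 mf f0 cf fu ul.
have <- : limn_einf u = l.
  rewrite is_cvg_limn_einfE; first exact/cvg_lim.
  by apply/cvg_ex; exists l.
apply: le_trans (limn_einf_le fu).
have mEf_ n : measurable_fun setT (EFin \o f_ n) by exact/measurable_EFinP.
apply: le_trans (fatou _ _ _ _) => //.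
(* Written this way, the limit inferior inherits measurability from [measurable_fun_limn_esup]. *)
have lE x : limn_einf (fun n => (f_ n x)%:E) = (- limn_esup (fun n => (- f_ n x)%:E))%E.
  by rewrite -limn_einfN; congr limn_einf; apply/funext => n /=; rewrite opprK.
apply: ae_ge0_le_integral => //.
- by move=> x _; rewrite lee_fin.
- exact/measurable_EFinP.
- move=> x _; rewrite limn_einf_lim; apply: lime_ge; first exact: is_cvg_einfs.
  by apply: nearW => n; apply: le_ereal_inf_tmp => _ [k /= nk <-]; rewrite lee_fin.
- under eq_fun do rewrite lE.
  apply: measurableT_comp => //; apply: measurable_fun_limn_esup => n.
  by apply/measurable_EFinP; apply: measurableT_comp => //; exact: mf_.
- apply: ae_imp cf _ => x cx _.
  have cE : (f_ n x)%:E @[n --> \oo] --> (f x)%:E by apply: cvg_EFin => //; exact: nearW.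
  rewrite is_cvg_limn_einfE; last by apply/cvg_ex; exists (f x)%:E.
  by rewrite (cvg_lim _ cE).
- by move=> n x _; rewrite lee_fin.
Qed.

End fatou_le.

(** * Passage to the limit in the weighted identity *)

Section plancherel_bounded.
Context {R : realType}.
Implicit Types (v : R -> R) (M : R).

Let eta_ (n : nat) : R := n.+1%:R^-1 / 2.

Let eta_gt0 n : 0 < eta_ n.
Proof. by rewrite divr_gt0// invr_gt0. Qed.

Definition tent_energy v n :=
  \int[leb R]_s (v s * \int[leb R]_t (v t * tent (eta_ n) (s - t))).

Lemma normr_tent_average v M n (s : R) : L1 v -> (forall t, `|v t| <= M) ->
  `|\int[leb R]_t (v t * tent (eta_ n) (s - t))| <= M.
Proof.
move=> iv vM; have it := L1_tent s (eta_gt0 n).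
under eq_Rintegral do rewrite mulrC.
apply: (le_trans (normr_Rintegral_bounded it (L1_measurable iv) vM)).
under eq_Rintegral do rewrite ger0_norm ?tent_ge0//.
by rewrite /Rintegral integral_tent//= mulr1.
Qed.

Lemma L1_sqr_bounded v M : L1 v -> (forall t, `|v t| <= M) ->
  L1 (fun t => v t ^+ 2).
Proof. by move=> iv vM; exact: (L1M_bounded iv (L1_measurable iv) vM). Qed.

(** The tent averages converge at every Lebesgue point, hence almost everywhere. Boundedness of [v]
    is what provides a dominating function: the averages are at most [M], so the integrand is at
    most [M |v s|]. *)
Lemma cvg_tent_energy v M : L1 v -> (forall t, `|v t| <= M) ->
  tent_energy v n @[n --> \oo] --> \int[leb R]_t (v t ^+ 2).
Proof.
move=> iv vM; have mv := L1_measurable iv.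
have mta n : measurable_fun setT
    (fun s : R => \int[leb R]_t (v t * tent (eta_ n) (s - t))).
  apply: (measurable_Rintegral_bounded iv (measurable_tentB (eta_ n))) => q.
  by rewrite ger0_norm ?tent_ge0//; exact: tent_le.
pose f_ n s := (v s * \int[leb R]_t (v t * tent (eta_ n) (s - t)))%:E.
have mf n : measurable_fun setT (f_ n).
  by apply/measurable_EFinP; exact: measurable_funM.
have mf' : measurable_fun setT (EFin \o (fun t => v t ^+ 2)).
  by apply/measurable_EFinP; exact: measurable_funX.
have cvgf : {ae leb R, forall s, setT s ->
    f_ ^~ s @ \oo --> (EFin \o (fun t => v t ^+ 2)) s}.
  have := lebesgue_differentiation (open_integrable_locally openT iv).
  move=> /ae_imp; apply => s sv _; apply: cvg_EFin.
    by near=> n.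
  rewrite /= expr2; apply: cvgMl_tmp; exact: cvg_tent_average.
have iM : L1 (fun s => M * `|v s|) by apply: L1Zl; exact: integrable_norm.
have domf : {ae leb R, forall s n, setT s -> (`|f_ n s| <= (EFin \o (fun s => (M * `|v s|)%R)) s)%E}.
  apply: aeW => s n _; rewrite /= lee_fin normrM mulrC ler_wpM2r//.
  exact: normr_tent_average.
have [_ _ /=] := @dominated_convergence _ _ R (leb R) setT measurableT _ _ _ mf mf' cvgf iM domf.
rewrite -EFin_Rintegral; last exact: (L1_sqr_bounded iv vM).
exact: fine_cvg.
Unshelve. all: by end_near. Qed.

Lemma sinc2_energy v n : L1 v ->
  (\int[leb R]_w (sinc2 (eta_ n) w * (ct v w ^+ 2 + st v w ^+ 2))%:E =
   (2 * pi * tent_energy v n)%:E)%E.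
Proof.
move=> iv.
pose I := \int[leb R]_t `|v t|.
have I2 w : `|ct v w ^+ 2 + st v w ^+ 2| <= I ^+ 2 + I ^+ 2.
  rewrite (le_trans (ler_normD _ _))// !normrX lerD// lerXn2r ?nnegrE//.
  - exact: le_trans (normr_ct 0 iv).
  - exact: normr_ct.
  - exact: le_trans (normr_ct 0 iv).
  - exact: normr_st.
have m2 : measurable_fun setT (fun w => ct v w ^+ 2 + st v w ^+ 2).
  apply: measurable_funD; apply: measurable_funX; first exact: measurable_ct.
  exact: measurable_st.
rewrite -EFin_Rintegral; last exact: (L1M_bounded (L1_sinc2 _) m2 I2).
congr EFin; rewrite Rintegral_kernel_ct_st//; last exact: L1_sinc2.
rewrite /tent_energy -RintegralZl//.
  apply: eq_Rintegral => s _; rewrite mulrCA; congr (_ * _).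
  rewrite -RintegralZl//.
    by apply: eq_Rintegral => t _; rewrite Rintegral_sinc2_cos// mulrCA.
  apply: (@L1M_bounded _ _ _ (2 * eta_ n)^-1 iv) => [|t].
    by apply: continuous_measurable_fun; exact: continuous_tent.
  by rewrite ger0_norm ?tent_ge0//; exact: tent_le.
have tb (q : R * R) : `|tent (eta_ n) (q.1 - q.2)| <= (2 * eta_ n)^-1.
  by rewrite ger0_norm ?tent_ge0//; exact: tent_le.
apply: (L1M_bounded iv).
  exact: (measurable_Rintegral_bounded iv (measurable_tentB _) tb).
move=> s; apply: (normr_Rintegral_bounded iv) => [|t]; last exact: (tb (s, t)).
by apply: continuous_measurable_fun; exact: continuous_tent.
Qed.

(** The two inequalities have different sources: [sinc2 <= 1] shows that the weighted energies,
    hence their limit, do not exceed the full energy, while [sinc2] tending to 1 and Fatou give the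
    converse. *)
Lemma plancherel_bounded v M : L1 v -> (forall t, `|v t| <= M) ->
  (\int[leb R]_w (ct v w ^+ 2 + st v w ^+ 2)%:E =
   (2 * pi * \int[leb R]_t (v t ^+ 2))%:E)%E.
Proof.
move=> iv vM.
have mE : measurable_fun setT (fun w => ct v w ^+ 2 + st v w ^+ 2).
  apply: measurable_funD; apply: measurable_funX; first exact: measurable_ct.
  exact: measurable_st.
have E0 w : 0 <= ct v w ^+ 2 + st v w ^+ 2 by rewrite addr_ge0 ?sqr_ge0.
pose g n w := (sinc2 (eta_ n) w * (ct v w ^+ 2 + st v w ^+ 2))%:E.
have mg n : measurable_fun setT (g n).
  apply/measurable_EFinP; apply: measurable_funM => //.
  exact: (L1_measurable (L1_sinc2 _)).
have g0 n w : (0 <= g n w)%E by rewrite lee_fin mulr_ge0// sinc2_ge0.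
have cg : (\int[leb R]_w g n w)%E @[n --> \oo] -->
    (2 * pi * \int[leb R]_t (v t ^+ 2))%:E.
  under eq_fun do rewrite sinc2_energy//.
  apply: cvg_EFin; first by near=> n.
  by apply: cvgMl_tmp; exact: (cvg_tent_energy iv vM).
apply/eqP; rewrite eq_le; apply/andP; split; last first.
  rewrite -(cvg_lim _ cg)//; apply: lime_le; first by apply/cvg_ex; eexists; exact: cg.
  apply: nearW => n; apply: ge0_le_integral => //.
  - exact: mg.
  - exact/measurable_EFinP.
  - by move=> w _; rewrite lee_fin ler_piMl// sinc2_le1.
apply: (@fatou_le _ (fun n w => sinc2 (eta_ n) w * (ct v w ^+ 2 + st v w ^+ 2)) _ _ _ _ _ _ _ _ (fun n => lexx _) cg) => //.
- by move=> n; apply: measurable_funM => //; exact: (L1_measurable (L1_sinc2 _)).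
(* The point 0 is discarded: there [sinc2] is 0 for every [n] and does not tend to 1. *)
- exists [set 0]; split => //; first exact: lebesgue_measure_set1.
  move=> w /= nc; apply: contrapT => /eqP w0; apply: nc.
  rewrite -[X in _ --> X]mul1r; apply: cvgMr_tmp; exact: cvg_sinc2.
Unshelve. all: by end_near. Qed.

End plancherel_bounded.

(** * The Fourier transform on L2 *)

Section square_norms.
Context {R : realType}.
Implicit Types (v a b : R -> R) (V W : R -> R[i]) (z : R[i]) (th : R).

Definition nsq v : \bar R := (\int[leb R]_t (v t ^+ 2)%:E)%E.

Definition cnsq V : \bar R := (\int[leb R]_w (Normc.normc (V w) ^+ 2)%:E)%E.

Definition measurableC V :=
  measurable_fun setT (fun w => complex.Re (V w)) /\
  measurable_fun setT (fun w => complex.Im (V w)).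

Lemma nsq_ge0 v : (0 <= nsq v)%E.
Proof. by apply: integral_ge0 => t _; rewrite lee_fin sqr_ge0. Qed.

Lemma integralZlR (c : R) v : 0 <= c -> measurable_fun setT v ->
  (forall t, 0 <= v t) ->
  (\int[leb R]_t (c * v t)%:E = c%:E * \int[leb R]_t (v t)%:E)%E.
Proof.
move=> c0 mv v0; under eq_integral do rewrite EFinM.
apply: ge0_integralZl_EFin => //; last exact/measurable_EFinP.
by move=> t _; rewrite lee_fin.
Qed.

Lemma sqr_normcE z : Normc.normc z ^+ 2 = complex.Re z ^+ 2 + complex.Im z ^+ 2.
Proof. by case: z => x y /=; rewrite sqr_sqrtr// addr_ge0 ?sqr_ge0. Qed.

Lemma cnsq_ge0 V : (0 <= cnsq V)%E.
Proof. by apply: integral_ge0 => t _; rewrite lee_fin sqr_ge0. Qed.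

Lemma ReB z1 z2 : complex.Re (z1 - z2) = complex.Re z1 - complex.Re z2.
Proof. by case: z1 z2 => [? ?] [? ?]. Qed.

Lemma ImB z1 z2 : complex.Im (z1 - z2) = complex.Im z1 - complex.Im z2.
Proof. by case: z1 z2 => [? ?] [? ?]. Qed.

Lemma ReD z1 z2 : complex.Re (z1 + z2) = complex.Re z1 + complex.Re z2.
Proof. by case: z1 z2 => [? ?] [? ?]. Qed.

Lemma ImD z1 z2 : complex.Im (z1 + z2) = complex.Im z1 + complex.Im z2.
Proof. by case: z1 z2 => [? ?] [? ?]. Qed.

Lemma measurable_sqr v : measurable_fun setT v ->
  measurable_fun setT (fun t => (v t ^+ 2)%:E).
Proof. by move=> mv; apply/measurable_EFinP; exact: measurable_funX. Qed.

Lemma measurable_sqr_normc V : measurableC V ->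
  measurable_fun setT (fun w => Normc.normc (V w) ^+ 2).
Proof.
move=> [mR mI]; under eq_fun do rewrite sqr_normcE.
by apply: measurable_funD; exact: measurable_funX.
Qed.

Lemma measurable_sqr_normcE V : measurableC V ->
  measurable_fun setT (fun w => (Normc.normc (V w) ^+ 2)%:E).
Proof. by move=> mV; apply/measurable_EFinP; exact: measurable_sqr_normc. Qed.

Lemma measurableCB V W : measurableC V -> measurableC W ->
  measurableC (fun w => V w - W w).
Proof.
move=> [a b] [c d]; split.
  by under eq_fun do rewrite ReB; exact: measurable_funB.
by under eq_fun do rewrite ImB; exact: measurable_funB.
Qed.

Lemma measurableCN V : measurableC V -> measurableC (fun w => - V w).
Proof.
move=> [a b]; split.
  have -> : (fun w => complex.Re (- V w)) = \- (fun w => complex.Re (V w)).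
    by apply/funext => w /=; case: (V w).
  exact: measurable_funN.
have -> : (fun w => complex.Im (- V w)) = \- (fun w => complex.Im (V w)).
  by apply/funext => w /=; case: (V w).
exact: measurable_funN.
Qed.

Lemma cnsqE V : measurableC V ->
  cnsq V = (nsq (fun w => complex.Re (V w)) + nsq (fun w => complex.Im (V w)))%E.
Proof.
move=> [mR mI]; rewrite /cnsq /nsq -ge0_integralD//.
- by apply: eq_integral => w _; rewrite sqr_normcE EFinD.
- by move=> w _; rewrite lee_fin sqr_ge0.
- exact: measurable_sqr.
- by move=> w _; rewrite lee_fin sqr_ge0.
- exact: measurable_sqr.
Qed.

Lemma Lnorm2E v : Lnorm (leb R) 2%:E (EFin \o v) = (nsq v `^ 2^-1)%E.
Proof.
rewrite unlock /nsq; congr (_ `^ _)%E; apply: eq_integral => t _ /=.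
by rewrite powR_mulrn// -normrX ger0_norm// sqr_ge0.
Qed.

Lemma nsqE v : nsq v = (Lnorm (leb R) 2%:E (EFin \o v) `^ 2)%E.
Proof. by rewrite Lnorm2E -poweRrM mulVf// poweRe1//; exact: nsq_ge0. Qed.

Lemma L2P v : L2 v <-> measurable_fun setT v /\ (nsq v < +oo)%E.
Proof.
rewrite /L2; split.
  move=> /andP[]; rewrite !inE /= => mv fv; split => //.
  by rewrite nsqE poweR_lty.
move=> [mv nv]; apply/andP; rewrite !inE/=; split => //.
by rewrite /finite_norm Lnorm2E poweR_lty.
Qed.

Lemma L2CP V : L2C V <-> measurableC V /\ (cnsq V < +oo)%E.
Proof.
split.
  move=> [/L2P[mR nR] /L2P[mI nI]]; have mV : measurableC V by [].
  by split => //; rewrite cnsqE// lte_add_pinfty.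
move=> [mV]; rewrite cnsqE// => nV; case: (mV) => mR mI.
split; apply/L2P; split => //; apply: le_lt_trans nV.
  by rewrite leeDl// nsq_ge0.
by rewrite leeDr// nsq_ge0.
Qed.

Lemma le_nsq a b : measurable_fun setT a -> measurable_fun setT b ->
  (forall t, `|a t| <= `|b t|) -> (nsq a <= nsq b)%E.
Proof.
move=> ma mb ab; apply: ge0_le_integral => //.
- by move=> t _; rewrite lee_fin sqr_ge0.
- exact: measurable_sqr.
- exact: measurable_sqr.
- move=> t _; rewrite lee_fin -(real_normK (num_real (a t))).
  by rewrite -(real_normK (num_real (b t))) lerXn2r ?nnegrE.
Qed.

Lemma young_sqr (x y th : R) : 0 < th ->
  (x + y) ^+ 2 <= (1 + th) * x ^+ 2 + (1 + th^-1) * y ^+ 2.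
Proof.
move=> th0; rewrite -subr_ge0.
have -> : (1 + th) * x ^+ 2 + (1 + th^-1) * y ^+ 2 - (x + y) ^+ 2 =
    th^-1 * (th * x - y) ^+ 2 by field; rewrite gt_eqF.
by rewrite mulr_ge0 ?sqr_ge0// invr_ge0 ltW.
Qed.

Lemma young_normc z1 z2 th : 0 < th ->
  Normc.normc (z1 + z2) ^+ 2 <=
  (1 + th) * Normc.normc z1 ^+ 2 + (1 + th^-1) * Normc.normc z2 ^+ 2.
Proof.
move=> th0; rewrite !sqr_normcE ReD ImD.
have := young_sqr (complex.Re z1) (complex.Re z2) th0.
have := young_sqr (complex.Im z1) (complex.Im z2) th0.
lra.
Qed.

Lemma le_integral_comb (F G H : R -> R) (x y : R) :
  measurable_fun setT F -> measurable_fun setT G -> measurable_fun setT H ->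
  (forall t, 0 <= F t) -> (forall t, 0 <= G t) -> (forall t, 0 <= H t) ->
  0 <= x -> 0 <= y -> {ae leb R, forall t, F t <= x * G t + y * H t} ->
  (\int[leb R]_t (F t)%:E <=
   x%:E * \int[leb R]_t (G t)%:E + y%:E * \int[leb R]_t (H t)%:E)%E.
Proof.
move=> mF mG mH F0 G0 H0 x0 y0 FGH.
rewrite -!ge0_integralZl_EFin//; try by [move=> t _; rewrite lee_fin | exact/measurable_EFinP].
rewrite -ge0_integralD//; first last.
- by apply/measurable_EFinP; exact: measurable_funM.
- by move=> t _; rewrite -EFinM lee_fin mulr_ge0.
- by apply/measurable_EFinP; exact: measurable_funM.
- by move=> t _; rewrite -EFinM lee_fin mulr_ge0.
apply: ae_ge0_le_integral => //.
- by move=> t _; rewrite lee_fin.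
- exact/measurable_EFinP.
- by move=> t _; rewrite -!EFinM -EFinD lee_fin addr_ge0// mulr_ge0.
- by apply/measurable_EFinP; apply: measurable_funD; exact: measurable_funM.
- by apply: ae_imp FGH _ => t h _; rewrite -!EFinM -EFinD lee_fin.
Qed.

Lemma young_nsq a b th : 0 < th -> measurable_fun setT a -> measurable_fun setT b ->
  (nsq (fun t => (a t + b t)%R) <= (1 + th)%:E * nsq a + (1 + th^-1)%:E * nsq b)%E.
Proof.
move=> th0 ma mb; apply: le_integral_comb => //.
- by apply: measurable_funX; exact: measurable_funD.
- exact: measurable_funX.
- exact: measurable_funX.
- by move=> t; exact: sqr_ge0.
- by move=> t; exact: sqr_ge0.
- by move=> t; exact: sqr_ge0.
- by rewrite addr_ge0// ltW.
- by rewrite addr_ge0// invr_ge0 ltW.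
- by apply: aeW => t; exact: young_sqr.
Qed.

Lemma young_cnsq V W1 W2 th : 0 < th -> measurableC V -> measurableC W1 ->
  measurableC W2 -> {ae leb R, forall w, V w = W1 w + W2 w} ->
  (cnsq V <= (1 + th)%:E * cnsq W1 + (1 + th^-1)%:E * cnsq W2)%E.
Proof.
move=> th0 mV m1 m2 VE; apply: le_integral_comb.
- exact: measurable_sqr_normc.
- exact: measurable_sqr_normc.
- exact: measurable_sqr_normc.
- by move=> t; exact: sqr_ge0.
- by move=> t; exact: sqr_ge0.
- by move=> t; exact: sqr_ge0.
- by rewrite addr_ge0// ltW.
- by rewrite addr_ge0// invr_ge0 ltW.
- by apply: ae_imp VE _ => t ->; exact: young_normc.
Qed.

(* Young's inequality with [th] tending to 0 replaces the triangle inequality of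
   the L2 norm, so that only squared norms are needed. *)
Lemma lee_Dth (x y : \bar R) : (0 <= y)%E ->
  (forall th, (0 < th)%R -> x <= (1 + th)%:E * y)%E -> (x <= y)%E.
Proof.
move=> y0 xy; case: y y0 xy => [y|_ _|//]; last exact: leey.
rewrite lee_fin => y0 xy; apply/lee_addgt0Pr => e e0.
have y1 : 0 < y + 1 by rewrite ltr_wpDl.
apply: (le_trans (xy (e / (y + 1)) _)); first by rewrite divr_gt0.
rewrite -EFinM -EFinD lee_fin mulrDl mul1r lerD2l.
by rewrite -mulrA; apply: ler_piMr; [exact: ltW|rewrite ler_pdivrMl// mulr1 lerDl].
Qed.

Lemma cvg_comb (b : \bar R) (u : nat -> \bar R) (th : R) :
  u @ \oo --> 0%E -> ((1 + th)%:E * b + (1 + th^-1)%:E * u n)%E @[n --> \oo]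
    --> ((1 + th)%:E * b)%E.
Proof.
move=> u0; rewrite -[X in _ --> X]adde0; apply: cvgeD.
- by rewrite fin_num_adde_defl.
- exact: cvg_cst.
- by rewrite -(mule0 (1 + th^-1)%:E); apply: cvgeZl.
Qed.

(** The order of the limits matters: [1 + th^-1] blows up as [th] tends to 0, so [n] goes to
    infinity first, at a fixed [th]. *)
Lemma lee_cvg_young (x y : \bar R) (u : nat -> \bar R) : (0 <= y)%E ->
  (forall th n, (0 < th)%R -> x <= (1 + th)%:E * y + (1 + th^-1)%:E * u n)%E ->
  u @ \oo --> 0%E -> (x <= y)%E.
Proof.
move=> y0 xy u0; apply: lee_Dth => // th th0.
have c := cvg_comb (b := y) (th := th) u0.
rewrite -(cvg_lim _ c)//; apply: lime_ge; first by apply/cvg_ex; eexists; exact: c.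
by apply: nearW => n; exact: xy.
Qed.

End square_norms.

(** * Completeness of L2 in terms of squared norms *)

Section L2_completeness.
Context {R : realType}.
Implicit Types (v : R -> R).

Lemma cvg_geometric_increments (u : nat -> R) (C : R) :
  (forall n, `|u n.+1 - u n| <= C * 2^-1 ^+ n) -> cvgn u.
Proof.
move=> uC.
have -> : u = (fun n => u 0%N + series (telescope u) n).
  by apply/funext => n; exact: eq_sum_telescope.
apply: is_cvgD; first exact: is_cvg_cst.
apply: normed_cvg; apply: (@series_le_cvg _ _ (geometric C 2^-1)).
- by move=> n; exact: normr_ge0.
- move=> n; rewrite /geometric/= mulr_ge0//.
  have := uC 0%N; rewrite expr0 mulr1; exact: le_trans.
- by move=> n; exact: uC.
- apply: is_cvg_geometric_series.
  by rewrite ger0_norm ?invr_ge0// invf_lt1// ltr1n.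
Qed.

Lemma cvge0_eps (u : nat -> \bar R) : (forall n, 0 <= u n)%E ->
  (forall e : R, 0 < e -> exists N, forall n, (N <= n)%N -> (u n <= e%:E)%E) ->
  u @ \oo --> 0%E.
Proof.
move=> u0 ue; apply/fine_cvgP; split.
  have [N NP] := ue 1 ltr01.
  near=> n; rewrite ge0_fin_numE//; apply: (@le_lt_trans _ _ 1%E); last by rewrite ltry.
  by apply: NP; near: n; exact: nbhs_infty_ge.
apply/cvgrPdist_le => e e0; have [N NP] := ue e e0.
near=> n; rewrite sub0r normrN ger0_norm ?fine_ge0//= -lee_fin fineK.
  by apply: NP; near: n; exact: nbhs_infty_ge.
rewrite ge0_fin_numE//; apply: (@le_lt_trans _ _ e%:E); last by rewrite ltry.
by apply: NP; near: n; exact: nbhs_infty_ge.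
Unshelve. all: by end_near. Qed.

Lemma eps_cvge0 (u : nat -> \bar R) (e : R) : (forall n, 0 <= u n)%E ->
  u @ \oo --> 0%E -> 0 < e ->
  exists N, forall n, (N <= n)%N -> (u n <= e%:E)%E.
Proof.
move=> u0 /fine_cvgP[[N1 _ N1P] /cvgrPdist_le /(_ e) + e0] => /(_ e0)[N2 _ N2P].
exists (maxn N1 N2) => n; rewrite geq_max => /andP[n1 n2].
rewrite -(fineK (N1P n n1)) lee_fin.
by have := N2P n n2; rewrite /= sub0r normrN; exact: le_trans (ler_norm _).
Qed.

Lemma nsqBC v1 v2 : nsq (v1 \- v2) = nsq (v2 \- v1) :> \bar R.
Proof. by apply: eq_integral => t _ /=; rewrite -sqrrN opprB. Qed.

Lemma L2_complete (f_ : nat -> R -> R) : (forall n, measurable_fun setT (f_ n)) ->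
  (forall e : R, 0 < e -> exists N, forall m n, (N <= m)%N -> (N <= n)%N ->
    (nsq (f_ m \- f_ n)%R <= e%:E)%E) ->
  exists f : R -> R, measurable_fun setT f /\ nsq (f_ n \- f)%R @[n --> \oo] --> 0%E.
Proof.
move=> mf cauchy.
(* Squared increments of size [8^-k] remain summable after multiplication by [4^k], since
   [4^k 8^-k = 2^-k]. *)
have p8 k : 0 < 8^-1 ^+ k :> R by rewrite exprn_gt0// invr_gt0.
(* Along the subsequence, [sum_k 4^k d_k^2] has a finite integral, so almost
   everywhere [|d_k| = O(2^-k)] and the subsequence converges. *)
have [N_ N_P] := boolp.choice (fun k => cauchy _ (p8 k)).
pose fix phi k := if k is k'.+1 then maxn (phi k') (maxn (N_ k) k) else N_ 0%N.
have phiN k : (N_ k <= phi k)%N by case: k => [|k] //=; rewrite !leq_max leqnn orbT.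
have phik k : (k <= phi k)%N by case: k => [|k] //=; rewrite !leq_max leqnn !orbT.
have phiS k : (phi k <= phi k.+1)%N by exact: leq_maxl.
pose d k t := f_ (phi k.+1) t - f_ (phi k) t.
have md k : measurable_fun setT (d k) by exact: measurable_funB.
have nd k : (nsq (d k) <= (8^-1 ^+ k)%:E)%E.
  by apply: N_P => //; exact: leq_trans (phiN k) (phiS k).
pose g t := (\sum_(0 <= k <oo) (4 ^+ k * d k t ^+ 2)%:E)%E.
have dk0 k t : (0 <= (4 ^+ k * d k t ^+ 2)%:E)%E.
  by rewrite lee_fin mulr_ge0 ?sqr_ge0// exprn_ge0.
have mdk k : measurable_fun setT (fun t => (4 ^+ k * d k t ^+ 2)%:E).
  apply/measurable_EFinP; apply: measurable_funM => //; exact: measurable_funX.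
have mg : measurable_fun setT g.
  by apply: ge0_emeasurable_sum => // k t _ _; exact: dk0.
have intg : (\int[leb R]_t g t <= (2 : R)%:E)%E.
  rewrite integral_nneseries//.
  apply: lime_le.
    by apply: is_cvg_nneseries => k _ _; apply: integral_ge0 => t _; exact: dk0.
  apply: nearW => n; apply: (@le_trans _ _ (\sum_(0 <= k < n) (2^-1 ^+ k : R)%:E)%E).
    apply: lee_sum => k _.
    rewrite (@integralZlR R (4 ^+ k) (fun t => d k t ^+ 2)); first last.
    - by move=> t; exact: sqr_ge0.
    - exact: measurable_funX.
    - exact: exprn_ge0.
    apply: (le_trans (lee_wpmul2l _ (nd k))); first by rewrite lee_fin exprn_ge0.
    rewrite -EFinM -exprMn lee_fin lerXn2r ?nnegrE//; lra.
  rewrite sumEFin lee_fin.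
  have -> : \sum_(0 <= k < n) 2^-1 ^+ k = 2 - 2 * 2^-1 ^+ n :> R.
    elim: n => [|n ih]; first by rewrite big_nil expr0; ring.
    by rewrite big_nat_recr//= ih exprS; field.
  by rewrite gerBl mulr_ge0// exprn_ge0.
have gfin : {ae leb R, forall t, g t \is a fin_num}.
  have ig : (leb R).-integrable setT g.
    apply/integrableP; split => //.
    under eq_integral do rewrite gee0_abs ?nneseries_ge0//.
    by apply: le_lt_trans intg _; rewrite ltry.
  by have /ae_imp := integrable_ae measurableT ig; apply => t; exact.
have cvgf : {ae leb R, forall t, cvgn (fun k => f_ (phi k) t)}.
  (* From [4^k d_k^2 <= G <= (1 + G)^2] one gets [|d_k| <= (1 + G) 2^-k], without a square root of
     [G]. *)
  apply: ae_imp gfin _ => t gt; apply: (@cvg_geometric_increments _ (1 + fine (g t))).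
  move=> k; have : ((4 ^+ k * d k t ^+ 2)%:E <= g t)%E.
    apply: le_trans (nneseries_lim_ge k.+1 _) => //.
    rewrite big_nat_recr//= leeDr// sume_ge0// => j _; exact: dk0.
  rewrite -(fineK gt) lee_fin; set G := fine _ => dG.
  have G0 : 0 <= G by apply: le_trans dG; rewrite mulr_ge0 ?sqr_ge0// exprn_ge0.
  rewrite exprVn ler_pdivlMr ?exprn_gt0//.
  rewrite -(@ler_pXn2r _ 2)// ?nnegrE ?mulr_ge0 ?exprn_ge0 ?addr_ge0//.
  rewrite exprMn real_normK ?num_real// -exprM mulnC exprM mulrC -natrX.
  apply: (le_trans dG); rewrite /= -subr_ge0.
  have -> : (1 + G) ^+ 2 - G = 1 + G + G ^+ 2 by ring.
  by rewrite !addr_ge0// exprn_ge0.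
(* The limit superior is measurable on the whole line, also where the subsequence diverges, and
   [fine] makes it real; almost everywhere it is the limit. *)
pose f t := fine (limn_esup (fun k => (f_ (phi k) t)%:E)).
have mff : measurable_fun setT f.
  apply: measurableT_comp => //; apply: measurable_fun_limn_esup => k.
  exact/measurable_EFinP.
have cf : {ae leb R, forall t, f_ (phi k) t @[k --> \oo] --> f t}.
  apply: ae_imp cvgf _ => t ct.
  have cE : (f_ (phi k) t)%:E @[k --> \oo] --> (limn (fun k => f_ (phi k) t))%:E.
    by apply: cvg_EFin => //; exact: nearW.
  have -> : f t = limn (fun k => f_ (phi k) t).
    rewrite /f is_cvg_limn_esupE; last by apply/cvg_ex; eexists; exact: cE.
    by rewrite (cvg_lim _ cE).
  exact: ct.
exists f; split => //.
apply: cvge0_eps => [n|e e0]; first exact: nsq_ge0.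
have [N NP] := cauchy e e0.
exists N => n Nn.
(* Fatou along the subsequence transfers the Cauchy estimate to the limit for the full sequence; the
   shift by [N] ensures that every index used is at least [N]. *)
apply: (@fatou_le _ (fun k t => (f_ n t - f_ (phi (k + N)%N) t) ^+ 2) _
   (fun=> e%:E) e%:E).
- by move=> k; apply: measurable_funX; exact: measurable_funB.
- by move=> k t; exact: sqr_ge0.
- by apply: measurable_funX; exact: measurable_funB.
- by move=> t; exact: sqr_ge0.
- apply: ae_imp cf _ => t ct.
  have cN : f_ (phi (k + N)%N) t @[k --> \oo] --> f t 
    by exact: (@cvg_comp _ _ _ (fun k => (k + N)%N) (fun k => f_ (phi k) t) _ _ _ (@cvg_addnr N) ct).
  have cB : f_ n t - f_ (phi (k + N)%N) t @[k --> \oo] --> f_ n t - f t.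
    by apply: cvgB => //; exact: cvg_cst.
  exact: (cvgM cB cB).
- move=> k; apply: NP => //; apply: leq_trans (phik _); exact: leq_addl.
- exact: cvg_cst.
Qed.

End L2_completeness.

(** * Truncations and the energy inequality on L1 and L2 *)

Section truncations.
Context {R : realType}.
Implicit Types (v : R -> R).

Definition tr n v (t : R) := if `|t| <= n%:R then v t else 0.

(** Cutting both the argument and the value gives a bounded function of bounded support, to which
    [plancherel_bounded] applies; [tr] cuts the argument only, as the definition of the transform
    does. *)
Definition bt n v (t : R) := if (`|t| <= n%:R) && (`|v t| <= n%:R) then v t else 0.

Lemma measurable_tr n v : measurable_fun setT v -> measurable_fun setT (tr n v).
Proof.
move=> mv; apply: measurable_fun_ifT => //.
by apply: measurable_fun_ler => //; exact: measurableT_comp.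
Qed.

Lemma measurable_bt n v : measurable_fun setT v -> measurable_fun setT (bt n v).
Proof.
move=> mv; apply: measurable_fun_ifT => //.
apply: measurable_and; apply: measurable_fun_ler => //.
exact: measurableT_comp.
Qed.

Lemma normr_tr n v t : `|tr n v t| <= `|v t|.
Proof. by rewrite /tr; case: ifP => // _; rewrite normr0. Qed.

Lemma normr_bt n v t : `|bt n v t| <= `|v t|.
Proof. by rewrite /bt; case: ifP => // _; rewrite normr0. Qed.

Lemma normr_bt_le n v t : `|bt n v t| <= n%:R.
Proof. by rewrite /bt; case: ifP => [/andP[]//|_]; rewrite normr0. Qed.

(** On a bounded interval L2 embeds in L1: there [b] is dominated by the indicator of the interval
    plus [v^2], so no Cauchy-Schwarz inequality is needed. *)
Lemma L1_support n v (b : R -> R) : measurable_fun setT b ->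
  (forall t, `|t| > n%:R -> b t = 0) ->
  (forall t, `|b t| <= 1 + v t ^+ 2) -> (nsq v < +oo)%E -> measurable_fun setT v -> L1 b.
Proof.
move=> mb b0 bv nv mv.
have iv : L1 (fun t => v t ^+ 2).
  apply/integrableP; split; first exact: measurable_sqr.
  by under eq_integral do rewrite /= ger0_norm ?sqr_ge0//.
have i1 : L1 (\1_`[- n%:R, n%:R] : R -> R) by exact: integrable_indic_itv.
apply: (le_L1 mb _ (L1D i1 iv)) => t.
rewrite indicE mem_setE in_itv/= -ler_norml.
have [tn|tn] := boolP (`|t| <= n%:R).
  by have := bv t.
rewrite -ltNge in tn; rewrite b0//.
by rewrite normr0 addr_ge0// sqr_ge0.
Qed.

Lemma le_normr_1Dsqr (x : R) : `|x| <= 1 + x ^+ 2.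
Proof.
rewrite -(real_normK (num_real x)) -subr_ge0.
have -> : 1 + `|x| ^+ 2 - `|x| = (`|x| - 2^-1) ^+ 2 + 3 / 4 by field.
by rewrite addr_ge0 ?sqr_ge0.
Qed.

Lemma L1_tr n v : L2 v -> L1 (tr n v).
Proof.
move=> /L2P[mv nv]; apply: (@L1_support n v) => //; first exact: measurable_tr.
- by move=> t; rewrite /tr ltNge => /negbTE ->.
- by move=> t; apply: le_trans (normr_tr _ _ _) (le_normr_1Dsqr _).
Qed.

Lemma L1_bt n v : measurable_fun setT v -> L1 (bt n v).
Proof.
move=> mv; have i1 : L1 (\1_`[- n%:R, n%:R] : R -> R) by exact: integrable_indic_itv.
apply: (le_L1 (measurable_bt n mv) _ (L1Zl n%:R i1)) => t.
rewrite indicE mem_setE in_itv/= -ler_norml.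
have [tn|tn] := boolP (`|t| <= n%:R).
  by rewrite mulr1; exact: normr_bt_le.
rewrite -ltNge in tn.
by rewrite /bt (leNgt `|t|) tn/= normr0 mulr0.
Qed.

Lemma near_tr v t : \forall n \near \oo, tr n v t = v t.
Proof.
near=> n; rewrite /tr ifT//.
by near: n; exact: nbhs_infty_ger.
Unshelve. all: by end_near. Qed.

Lemma near_bt v t : \forall n \near \oo, bt n v t = v t.
Proof.
near=> n; rewrite /bt ifT//; apply/andP; split.
  by near: n; exact: nbhs_infty_ger.
by near: n; exact: nbhs_infty_ger.
Unshelve. all: by end_near. Qed.

Lemma dominated_cvgR (f_ : nat -> R -> R) (f g : R -> R) :
  (forall n, measurable_fun setT (f_ n)) -> measurable_fun setT f ->
  (forall t, f_ n t @[n --> \oo] --> f t) -> L1 g ->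
  (forall n t, `|f_ n t| <= g t) ->
  (\int[leb R]_t (f_ n t)%:E)%E @[n --> \oo] --> (\int[leb R]_t (f t)%:E)%E.
Proof.
move=> mf_ mf cf ig fg.
apply: (@dominated_cvg _ _ R (leb R) setT measurableT
  (fun n t => (f_ n t)%:E) (fun t => (f t)%:E) (EFin \o g)) => //.
- by move=> n; apply/measurable_EFinP; exact: mf_.
- by move=> t _; apply: cvg_EFin; [exact: nearW|exact: cf].
- by move=> n t _; rewrite /= lee_fin.
Qed.

Lemma cvg_nsq_dominated (f_ : nat -> R -> R) v : L2 v ->
  (forall n, measurable_fun setT (f_ n)) ->
  (forall n t, `|v t - f_ n t| <= `|v t|) ->
  (forall t, \forall n \near \oo, f_ n t = v t) ->
  nsq (v \- f_ n)%R @[n --> \oo] --> 0%E.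
Proof.
move=> /L2P[mv nv] mf fv fE.
have iv : L1 (fun t => v t ^+ 2).
  apply/integrableP; split; first exact: measurable_sqr.
  by under eq_integral do rewrite /= ger0_norm ?sqr_ge0//.
have -> : 0%E = (\int[leb R]_t (0 : R)%:E)%E by rewrite integral0.
apply: (dominated_cvgR (f_ := fun n t => (v t - f_ n t) ^+ 2) _ _ _ iv).
- by move=> n; apply: measurable_funX; exact: measurable_funB.
- exact: measurable_cst.
- move=> t; apply: cvg_near_cst.
  by apply: filterS (fE t) => n ->; rewrite subrr expr0n.
- move=> n t; rewrite ger0_norm ?sqr_ge0//.
  rewrite -(real_normK (num_real (v t))) -(real_normK (num_real (v t - _))).
  by rewrite lerXn2r ?nnegrE.
Qed.

Lemma cvg_nsq_tr v : L2 v -> nsq (v \- tr n v)%R @[n --> \oo] --> 0%E.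
Proof.
move=> /[dup] /L2P[mv _] iv; apply: cvg_nsq_dominated => //.
- by move=> n; exact: measurable_tr.
- by move=> n t; rewrite /tr; case: ifP; rewrite ?subrr ?normr0 ?subr0.
- by move=> t; exact: near_tr.
Qed.

Lemma cvg_nsq_bt v : L2 v -> nsq (v \- bt n v)%R @[n --> \oo] --> 0%E.
Proof.
move=> /[dup] /L2P[mv _] iv; apply: cvg_nsq_dominated => //.
- by move=> n; exact: measurable_bt.
- by move=> n t; rewrite /bt; case: ifP; rewrite ?subrr ?normr0 ?subr0.
- by move=> t; exact: near_bt.
Qed.

(** The identity holds for the truncations [bt n v], whose transforms converge pointwise by
    dominated convergence. Fatou keeps only an inequality, which suffices to make the transforms of
    [tr n v] a Cauchy sequence. *)
Lemma le_energy v : L1 v -> (nsq v < +oo)%E ->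
  (\int[leb R]_w (ct v w ^+ 2 + st v w ^+ 2)%:E <= (2 * pi)%:E * nsq v)%E.
Proof.
move=> iv nv; have mv := L1_measurable iv.
have mbt n := measurable_bt n mv.
have ibt n := L1_bt n mv.
have cvgT (c : R -> R) : measurable_fun setT c -> (forall t, `|c t| <= 1) ->
    \int[leb R]_t (bt n v t * c t) @[n --> \oo] --> \int[leb R]_t (v t * c t).
  move=> mc c1.
  have ivc := L1M_bounded iv mc c1.
  apply: fine_cvg; rewrite EFin_Rintegral//.
  apply: (dominated_cvgR (f_ := fun n t => bt n v t * c t) _ _ _ (integrable_norm iv)).
  - by move=> n; exact: measurable_funM.
  - exact: measurable_funM.
  - move=> t; apply: cvg_near_cst.
    by apply: filterS (near_bt v t) => n ->.
  - move=> n t; rewrite normrM -[leRHS]mulr1 ler_pM//.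
    exact: normr_bt.
apply: (@fatou_le _ (fun n w => ct (bt n v) w ^+ 2 + st (bt n v) w ^+ 2) _
    (fun=> (2 * pi)%:E * nsq v)%E).
- move=> n; apply: measurable_funD; apply: measurable_funX.
    exact: measurable_ct.
  exact: measurable_st.
- by move=> n x; rewrite addr_ge0 ?sqr_ge0.
- apply: measurable_funD; apply: measurable_funX; first exact: measurable_ct.
  exact: measurable_st.
- by move=> x; rewrite addr_ge0 ?sqr_ge0.
- apply: aeW => w.
  have c1 := cvgT _ (measurable_section1 w measurable_cosM) (fun t => normr_cos (w * t)).
  have c2 := cvgT _ (measurable_section1 w measurable_sinM) (fun t => normr_sin (w * t)).
  exact: (cvgD (cvgM c1 c1) (cvgM c2 c2)).
- move=> n; rewrite (plancherel_bounded (ibt n) (normr_bt_le n v)) EFinM.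
  apply: lee_wpmul2l; first by rewrite lee_fin mulr_ge0// pi_ge0.
  rewrite EFin_Rintegral; last exact: (L1_sqr_bounded (ibt n) (normr_bt_le n v)).
  by apply: le_nsq => // t; exact: normr_bt.
- exact: cvg_cst.
Qed.

End truncations.

(** * Existence, uniqueness and Plancherel's theorem for [fourier] *)

Section fourier_L2.
Context {R : realType}.
Local Open Scope complex_scope.
Local Open Scope ring_scope.
Implicit Types (v : R -> R) (V W : R -> R[i]).

Let c0 : R := (Num.sqrt (2 * pi))^-1.

Let c0_sqr : c0 ^+ 2 * (2 * pi) = 1.
Proof.
have p0 : 0 < 2 * pi :> R by rewrite mulr_gt0// pi_gt0.
by rewrite /c0 exprVn sqr_sqrtr ?ltW// mulVf// gt_eqF.
Qed.

Definition FT v (w : R) : R[i] := (c0 * ct v w) +i* (- (c0 * st v w)).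

Lemma measurableC_FT v : L1 v -> measurableC (FT v).
Proof.
move=> iv; split; rewrite /FT /=.
  by apply: measurable_funM => //; exact: measurable_ct.
apply: measurable_funN; apply: measurable_funM => //; exact: measurable_st.
Qed.

Lemma FTB v1 v2 (w : R) : L1 v1 -> L1 v2 -> FT (v1 \- v2) w = FT v1 w - FT v2 w.
Proof.
move=> i1 i2; apply/eqP; rewrite eq_complex ReB ImB /FT/= ctB// stB//.
by apply/andP; split; apply/eqP; ring.
Qed.

Lemma cnsq_FTE v : L1 v ->
  cnsq (FT v) = ((c0 ^+ 2)%:E * \int[leb R]_w (ct v w ^+ 2 + st v w ^+ 2)%:E)%E.
Proof.
move=> iv; rewrite -integralZlR; first last.
- by move=> t; rewrite addr_ge0 ?sqr_ge0.
- by apply: measurable_funD; apply: measurable_funX;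
    [exact: measurable_ct|exact: measurable_st].
- exact: sqr_ge0.
apply: eq_integral => w _; congr EFin.
by rewrite sqr_normcE /FT/=; ring.
Qed.

Lemma cnsq_FT_le v : L1 v -> (nsq v < +oo)%E -> (cnsq (FT v) <= nsq v)%E.
Proof.
move=> iv nv; rewrite cnsq_FTE//.
rewrite (le_trans (lee_wpmul2l _ (le_energy iv nv))) ?lee_fin ?sqr_ge0//.
by rewrite muleA -EFinM c0_sqr mul1e.
Qed.

Lemma cnsq_FT_bounded v M : L1 v -> (forall t, `|v t| <= M) -> cnsq (FT v) = nsq v.
Proof.
move=> iv vM; rewrite cnsq_FTE// (plancherel_bounded iv vM) -EFinM mulrA c0_sqr mul1r.
by rewrite EFin_Rintegral//; exact: (L1_sqr_bounded iv vM).
Qed.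

Lemma fourier_truncE n v (w : R) : L2 v -> fourier_trunc n v w = FT (tr n v) w.
Proof.
move=> iv; have pE (G : R -> R) t :
    (G \_ `[- n%:R, n%:R]) t = if `|t| <= n%:R then G t else 0.
  by rewrite patchE mem_setE in_itv/= -ler_norml.
have ReE : \int[leb R]_(t in `[- n%:R, n%:R])
    complex.Re ((v t)%:C * expC (0 +i* (- (w * t)))) = ct (tr n v) w.
  rewrite Rintegral_mkcond; apply: eq_Rintegral => t _.
  rewrite pE /tr; case: ifP => _; last by rewrite mul0r.
  by rewrite /= expR0 cosN; ring.
have ImE : \int[leb R]_(t in `[- n%:R, n%:R])
    complex.Im ((v t)%:C * expC (0 +i* (- (w * t)))) = - st (tr n v) w.
  rewrite Rintegral_mkcond /st -[RHS]mulN1r -RintegralZl//; last exact: (L1_sinM w (L1_tr n iv)).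
  apply: eq_Rintegral => t _.
  rewrite pE /tr; case: ifP => _; last by rewrite mul0r mulr0.
  by rewrite /= expR0 sinN; ring.
rewrite /fourier_trunc /Cintegral ReE ImE /FT -/c0.
by apply/eqP; rewrite eq_complex/=; apply/andP; split; apply/eqP; ring.
Qed.

Lemma cnsqBC V W : cnsq (fun w => V w - W w) = cnsq (fun w => W w - V w).
Proof. by apply: eq_integral => w _; rewrite -opprB normcN. Qed.

Lemma is_fourierP v V : L2 v -> is_fourier v V <->
  L2C V /\ cnsq (fun w => FT (tr n v) w - V w) @[n --> \oo] --> 0%E.
Proof.
move=> iv; rewrite /is_fourier /cnsq.
have -> : (fun n => \int[leb R]_w (Normc.normc (fourier_trunc n v w - V w) ^+ 2)%:E)%E
  = (fun n => \int[leb R]_w (Normc.normc (FT (tr n v) w - V w) ^+ 2)%:E)%E.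
  by apply/funext => n; apply: eq_integral => w _; rewrite fourier_truncE.
by [].
Qed.

Lemma nsq_tr_lty n v : L2 v -> (nsq (tr n v) < +oo)%E.
Proof.
move=> /L2P[mv nv]; apply: le_lt_trans nv; apply: le_nsq => //.
  exact: measurable_tr.
by move=> t; exact: normr_tr.
Qed.

Lemma L2_tr n v : L2 v -> L2 (tr n v).
Proof.
move=> iv; apply/L2P; split; last exact: nsq_tr_lty.
by apply: measurable_tr; case: ((L2P v).1 iv).
Qed.

Lemma L2B v1 v2 : L2 v1 -> L2 v2 -> L2 (v1 \- v2).
Proof.
move=> /L2P[m1 n1] /L2P[m2 n2]; apply/L2P; split; first exact: measurable_funB.
apply: le_lt_trans (young_nsq ltr01 m1 (measurable_funN m2)) _.
have -> : nsq (\- v2) = nsq v2 by apply: eq_integral => t _ /=; rewrite sqrrN.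
by rewrite lte_add_pinfty// lte_mul_pinfty// ?nsq_ge0// lee_fin addr_ge0// invr_ge0.
Qed.

Lemma trB n v1 v2 : tr n (v1 \- v2) = tr n v1 \- tr n v2.
Proof. by apply/funext => t; rewrite /tr/=; case: ifP => // _; rewrite subr0. Qed.

Lemma nsq_trB_le m n v : L2 v ->
  (nsq (tr m v \- tr n v)%R <= 2%:E * nsq (v \- tr m v)%R + 2%:E * nsq (v \- tr n v)%R)%E.
Proof.
move=> /L2P[mv nv]; have mt k := measurable_tr k mv.
have -> : (tr m v \- tr n v) = (fun t => (tr m v t - v t) + (v t - tr n v t)).
  by apply/funext => t /=; ring.
rewrite [X in (_ <= _ * X + _)%E]nsqBC.
have := @young_nsq R (tr m v \- v) (v \- tr n v) 1 ltr01.
rewrite invr1; apply; exact: measurable_funB.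
Qed.

(** By linearity and [cnsq_FT_le], distances between the transforms of [tr n v] are controlled by
    distances between the truncations themselves, which tend to 0; completeness then supplies the
    limit. *)
Lemma is_fourier_exists v : L2 v -> exists V, is_fourier v V.
Proof.
move=> iv; have [mv nv] := (L2P v).1 iv.
have itr n := L1_tr n iv.
have E (m n : nat) : (cnsq (fun w => FT (tr m v) w - FT (tr n v) w)%R <=
    2%:E * nsq (v \- tr m v)%R + 2%:E * nsq (v \- tr n v)%R)%E.
  apply: le_trans (nsq_trB_le m n iv).
  have -> : (fun w => FT (tr m v) w - FT (tr n v) w) = FT (tr m v \- tr n v).
    by apply/funext => w; rewrite FTB.
  apply: cnsq_FT_le; first exact: (L1B (itr m) (itr n)).
  exact: ((L2P _).1 (L2B (L2_tr m iv) (L2_tr n iv))).2.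
have y0 := eps_cvge0 (fun n => nsq_ge0 _) (cvg_nsq_tr iv).
(* [L2_complete] concerns real functions; [c] stands for the real and then for the imaginary
   part. *)
have cauchy (c : R[i] -> R) : (forall z1 z2, c (z1 - z2) = c z1 - c z2) ->
    (forall z, c z ^+ 2 <= Normc.normc z ^+ 2) ->
    (forall V, measurableC V -> measurable_fun setT (c \o V)) ->
    exists f, measurable_fun setT f /\
      nsq ((c \o FT (tr n v)) \- f)%R @[n --> \oo] --> 0%E.
  move=> cB cN cm; apply: L2_complete => [n|e e0].
    by apply: cm; exact: measurableC_FT.
  have e4 : 0 < e / 4 by rewrite divr_gt0.
  have [N NP] := y0 _ e4; exists N => m n Nm Nn.
  apply: (@le_trans _ _ (cnsq (fun w => FT (tr m v) w - FT (tr n v) w))).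
    apply: ge0_le_integral => //.
    - by move=> t _; rewrite lee_fin sqr_ge0.
    - apply: measurable_sqr; apply: measurable_funB; apply: cm; exact: measurableC_FT.
    - apply: measurable_sqr_normcE; apply: measurableCB; exact: measurableC_FT.
    - by move=> t _; rewrite lee_fin /= -cB.
  apply: (le_trans (E m n)).
  apply: (@le_trans _ _ (2%:E * (e / 4)%:E + 2%:E * (e / 4)%:E)%E).
    by apply: leeD; apply: lee_wpmul2l => //; exact: NP.
  by rewrite -!EFinM -EFinD lee_fin; lra.
have Re2 (z : R[i]) : complex.Re z ^+ 2 <= Normc.normc z ^+ 2.
  by rewrite sqr_normcE lerDl sqr_ge0.
have Im2 (z : R[i]) : complex.Im z ^+ 2 <= Normc.normc z ^+ 2.
  by rewrite sqr_normcE lerDr sqr_ge0.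
have [VR [mR cR]] := cauchy (@complex.Re R) (@ReB R) Re2 (fun V m => m.1).
have [VI [mI cI]] := cauchy (@complex.Im R) (@ImB R) Im2 (fun V m => m.2).
pose V w := VR w +i* VI w.
have mV : measurableC V by [].
have cV : cnsq (fun w => FT (tr n v) w - V w) @[n --> \oo] --> 0%E.
  have -> : (fun n => cnsq (fun w => FT (tr n v) w - V w)) =
      (fun n => nsq ((@complex.Re R \o FT (tr n v)) \- VR)%R +
                nsq ((@complex.Im R \o FT (tr n v)) \- VI)%R)%E.
    apply/funext => n; rewrite cnsqE; last by apply: measurableCB => //; exact: measurableC_FT.
    by congr (nsq _ + nsq _)%E; apply/funext => w; rewrite /= ?ReB ?ImB.
  by rewrite -(adde0 0%E); apply: cvgeD.
exists V; apply/is_fourierP => //; split => //; apply/L2CP; split => //.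
have [N NP] := eps_cvge0 (fun n => cnsq_ge0 _) cV ltr01.
have := @young_cnsq R V (FT (tr N v)) (fun w => V w - FT (tr N v) w) 1 ltr01 mV
  (measurableC_FT (itr N)) (measurableCB mV (measurableC_FT (itr N))).
move=> /(_ (aeW _ _)) H; apply: (le_lt_trans (H _)).
  by move=> w; rewrite addrC subrK.
rewrite lte_add_pinfty// lte_mul_pinfty//.
- exact: le_lt_trans (cnsq_FT_le (itr N) (nsq_tr_lty N iv)) (nsq_tr_lty N iv).
- by rewrite cnsqBC; apply: (le_lt_trans (NP N (leqnn N))); rewrite ltry.
Qed.

Lemma fourierP v : L2 v -> is_fourier v (fourier v).
Proof. by move=> /is_fourier_exists [V vV]; rewrite /fourier; exact: (xgetPex _ (ex_intro _ V vV)). Qed.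

Lemma fourier_L2C v : L2 v -> L2C (fourier v).
Proof. by move=> iv; case: (fourierP iv). Qed.

Lemma measurableC_fourier v : L2 v -> measurableC (fourier v).
Proof. by move=> iv; case: ((L2CP _).1 (fourier_L2C iv)). Qed.

Lemma cnsq_eq0 V : measurableC V -> cnsq V = 0%E -> {ae leb R, forall w, V w = 0}.
Proof.
move=> mV V0.
have : (\int[leb R]_w `|(Normc.normc (V w) ^+ 2)%:E| = 0)%E.
  rewrite -[RHS]V0; apply: eq_integral => w _.
  by rewrite gee0_abs// lee_fin sqr_ge0.
move=> /(ae_eq_integral_abs (leb R) measurableT (measurable_sqr_normcE mV)) H.
apply: (ae_imp H) => w /(_ I) /= [] /eqP; rewrite sqrf_eq0 => /eqP.
exact: Normc.eq0_normc.
Qed.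

Lemma young2_cnsq V W1 W2 : measurableC V -> measurableC W1 ->
  measurableC W2 -> {ae leb R, forall w, V w = W1 w + W2 w} ->
  (cnsq V <= 2%:E * cnsq W1 + 2%:E * cnsq W2)%E.
Proof.
by move=> mV m1 m2 VE; have := young_cnsq ltr01 mV m1 m2 VE; rewrite invr1.
Qed.

Lemma cvg_2D2 (a b : nat -> \bar R) : a @ \oo --> 0%E -> b @ \oo --> 0%E ->
  (2%:E * a n + 2%:E * b n)%E @[n --> \oo] --> 0%E.
Proof.
move=> a0 b0; rewrite -(adde0 0%E) -(mule0 2%:E).
by apply: cvgeD => //; apply: cvgeZl.
Qed.

Lemma is_fourier_unique v V W : L2 v -> is_fourier v V -> is_fourier v W ->
  {ae leb R, forall w, V w = W w}.
Proof.
move=> iv /(is_fourierP _ iv)[/L2CP[mV _] cV] /(is_fourierP _ iv)[/L2CP[mW _] cW].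
have mVW := measurableCB mV mW.
suff : cnsq (fun w => V w - W w) = 0%E.
  by move=> /(cnsq_eq0 mVW) H; apply: (ae_imp H) => w /eqP; rewrite subr_eq0 => /eqP.
apply/eqP; rewrite eq_le cnsq_ge0 andbT.
have c := cvg_2D2 cV cW.
rewrite -(cvg_lim _ c)//; apply: lime_ge; first by apply/cvg_ex; eexists; exact: c.
apply: nearW => n; rewrite [X in (_ <= _ * X + _)%E]cnsqBC.
have mF := measurableC_FT (L1_tr n iv).
apply: young2_cnsq => //; [exact: measurableCB..|].
by apply: aeW => w; ring.
Qed.

Lemma is_fourierB v1 v2 V1 V2 : L2 v1 -> L2 v2 ->
  is_fourier v1 V1 -> is_fourier v2 V2 ->
  is_fourier (v1 \- v2) (fun w => V1 w - V2 w).
Proof.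
move=> i1 i2 /(is_fourierP _ i1)[/L2CP[m1 n1] c1] /(is_fourierP _ i2)[/L2CP[m2 n2] c2].
have m12 := measurableCB m1 m2.
apply/is_fourierP; first exact: L2B.
have n12 : (2%:E * cnsq V1 + 2%:E * cnsq V2 < +oo)%E.
  by rewrite lte_add_pinfty// lte_mul_pinfty.
have nN (V : R -> R[i]) : cnsq (fun w => - V w) = cnsq V.
  by apply: eq_integral => w _; rewrite normcN.
split.
  apply/L2CP; split => //; apply: le_lt_trans n12.
  rewrite -[X in (_ <= _ + _ * X)%E]nN.
  by apply: young2_cnsq => //; [exact: measurableCN|exact: aeW].
apply: (squeeze_cvge _ (cvg_cst 0%E) (cvg_2D2 c1 c2)); apply: nearW => n.
rewrite cnsq_ge0/= -[X in (_ <= _ + _ * X)%E]nN.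
have mF1 := measurableC_FT (L1_tr n i1); have mF2 := measurableC_FT (L1_tr n i2).
apply: young2_cnsq.
- apply: measurableCB => //; apply: measurableC_FT; apply: L1_tr; exact: L2B.
- exact: measurableCB.
- by apply: measurableCN; exact: measurableCB.
- by apply: aeW => w; rewrite trB FTB; [ring|exact: L1_tr..].
Qed.

(* [fourier v] is picked by [xget], hence linear only up to a null set. *)
Lemma fourierB v1 v2 : L2 v1 -> L2 v2 ->
  {ae leb R, forall w, fourier (v1 \- v2) w = fourier v1 w - fourier v2 w}.
Proof.
move=> i1 i2; apply: (is_fourier_unique (L2B i1 i2) (fourierP (L2B i1 i2))).
by apply: is_fourierB => //; exact: fourierP.
Qed.

Lemma cnsq_fourier_le v : L2 v -> (cnsq (fourier v) <= nsq v)%E.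
Proof.
move=> iv; have [mv _] := (L2P v).1 iv.
have [_ cV] := (is_fourierP _ iv).1 (fourierP iv).
have mV := measurableC_fourier iv.
apply: (lee_cvg_young (nsq_ge0 v) _ cV) => th n th0.
have mF := measurableC_FT (L1_tr n iv).
rewrite cnsqBC.
have := @young_cnsq R _ (FT (tr n v)) (fun w => fourier v w - FT (tr n v) w) th th0 mV
  mF (measurableCB mV mF).
move=> /(_ (aeW _ _)) H; apply: (le_trans (H _)).
  by move=> w; rewrite addrC subrK.
apply: leeD => //; apply: lee_wpmul2l; first by rewrite lee_fin addr_ge0// ltW.
apply: le_trans (cnsq_FT_le (L1_tr n iv) (nsq_tr_lty n iv)) _.
by apply: le_nsq => //; [exact: measurable_tr|move=> t; exact: normr_tr].
Qed.

Lemma L2_bt n v : L2 v -> L2 (bt n v).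
Proof.
move=> /L2P[mv nv]; apply/L2P; split; first exact: measurable_bt.
apply: le_lt_trans nv; apply: le_nsq => //; first exact: measurable_bt.
by move=> t; exact: normr_bt.
Qed.

Lemma cnsq_fourier_bt n v : L2 v -> cnsq (fourier (bt n v)) = nsq (bt n v).
Proof.
move=> iv; have ib := L2_bt n iv; have [mv _] := (L2P v).1 iv.
have i1 := L1_bt n mv.
rewrite -(cnsq_FT_bounded i1 (normr_bt_le n v)).
suff fF : is_fourier (bt n v) (FT (bt n v)).
  have := is_fourier_unique ib (fourierP ib) fF => E.
  apply: ae_eq_integral => //.
  - by apply: measurable_sqr_normcE; exact: measurableC_fourier.
  - by apply: measurable_sqr_normcE; exact: measurableC_FT.
  - by apply: (ae_imp E) => w -> _.
apply/is_fourierP => //; split.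
  apply/L2CP; split; first exact: measurableC_FT.
  by apply: (le_lt_trans (cnsq_FT_le i1 _)); case: ((L2P _).1 ib).
(* For [m >= n] the truncation to [[- m, m]] leaves [bt n v] unchanged, so the defining sequence is
   eventually constant. *)
apply: cvg_near_cst; near=> m.
have -> : tr m (bt n v) = bt n v.
  apply/funext => t; rewrite /tr; case: ifPn => //; rewrite -ltNge => mt.
  rewrite /bt ifF//; apply/negbTE; rewrite negb_and -!ltNge; apply/orP; left.
  by apply: le_lt_trans mt; rewrite ler_nat; near: m; exact: nbhs_infty_ge.
rewrite /cnsq integral0_eq// => w _.
by rewrite subrr Normc.normc0 expr0n.
Unshelve. all: by end_near. Qed.

(** What remains is [nsq v <= cnsq (fourier v)]. The identity is exact for [bt n v], whose transform
    is that of [v] minus that of [v - bt n v]; the latter is small by [cnsq_fourier_le]. Young's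
    inequality, then Fatou in [n], then [lee_Dth] conclude. *)
Lemma plancherel v : L2 v -> cnsq (fourier v) = nsq v.
Proof.
move=> iv; apply/eqP; rewrite eq_le cnsq_fourier_le//=.
have [mv nv] := (L2P v).1 iv.
apply: lee_Dth; first exact: cnsq_ge0.
move=> th th0.
have c := cvg_comb (b := cnsq (fourier v)) (th := th) (cvg_nsq_bt iv).
apply: (@fatou_le _ (fun n t => bt n v t ^+ 2) _ _ _ _ _ _ _ _ _ c).
- by move=> n; apply: measurable_funX; exact: measurable_bt.
- by move=> n t; exact: sqr_ge0.
- exact: measurable_funX.
- by move=> t; exact: sqr_ge0.
- apply: aeW => t; apply: cvg_near_cst.
  by apply: filterS (near_bt v t) => n ->.
- move=> n; rewrite -/(nsq _) -(cnsq_fourier_bt n iv).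
  have ib := L2_bt n iv; have idf := L2B iv ib.
  rewrite -[X in (_ <= _ + _ * X)%E]/(nsq (v \- bt n v)%R).
  have H : (cnsq (fun w => - fourier (v \- bt n v) w)%R <= nsq (v \- bt n v)%R)%E.
    apply: le_trans (cnsq_fourier_le idf).
    by rewrite /cnsq; under eq_integral do rewrite normcN.
  apply: (@le_trans _ _ ((1 + th)%:E * cnsq (fourier v) +
      (1 + th^-1)%:E * cnsq (fun w => - fourier (v \- bt n v) w)%R)%E); last first.
    apply: leeD => //; apply: lee_wpmul2l => //.
    by rewrite lee_fin addr_ge0// invr_ge0 ltW.
  apply: young_cnsq => //; [exact: measurableC_fourier|exact: measurableC_fourier| |].
    by apply: measurableCN; exact: measurableC_fourier.
  apply: (ae_imp (fourierB iv ib)) => w ->.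
  by rewrite opprB addrC subrK.
Qed.

End fourier_L2.

(** * Parameters and hyperbolic functions *)

Section parameters.
Context {R : realType}.

Lemma powR_expR (a x : R) : 0 < a -> a `^ x = expR (x * ln a).
Proof. by move=> a0; rewrite /powR gt_eqF. Qed.

Lemma expR_half_le2 : expR (2^-1 : R) <= 2.
Proof.
have := expR_ge1Dx (- 2^-1 : R); rewrite expRN => h.
rewrite -[leLHS]invrK -[leRHS]invrK lef_pV2 ?posrE ?invr_gt0 ?expR_gt0//.
by apply: le_trans h; lra.
Qed.

(** All that the choice of [eps] is used for, with [N = 1 / eps] and [s = (alpha + mu) / 2]. The two
    growth bounds control the same quantity: the version with [A] is matched with the data error
    [delta], the version with [B] with the high-frequency forcing. *)
Record admissible (alpha s p K c gamma A B N delta : R) : Prop := Admissible {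
  adm_N : 1 < N;
  adm_delta : delta = expR (- ((A + B) * N `^ s));
  adm_growthA : (2 * N ^+ 2) `^ p * expR (2 * N `^ (alpha / 2) + 2 * K) <=
    2 * expR (2 * (A * N `^ s));
  adm_growthB : (2 * N ^+ 2) `^ p * expR (2 * N `^ (alpha / 2) + 2 * K) <=
    2 * expR (2 * (B * N `^ s));
  adm_pow : (2 * N ^+ 2) `^ p <= expR (2 * (B * N `^ s));
  adm_tail : p <= s * gamma * c * N `^ s }.

Lemma parameters_admissible (alpha s p K c gamma A B q delta eps : R) :
  0 < p -> 0 < K -> 0 < c -> 0 < gamma -> 2 <= q -> alpha / 2 <= q -> q < s ->
  A = p / 2 + 1 + K ^+ 2 * 2 `^ p -> 0 < B -> 0 < delta < 1 ->
  eps = ((A + B) / ln (1 / delta)) `^ (1 / s) ->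
  eps < 1 -> eps < (B / A) `^ (1 / (s - q)) -> eps < (s * gamma * c / p) `^ (1 / s) ->
  admissible alpha s p K c gamma A B (1 / eps) delta.
Proof.
move=> p0 K0 c0 g0 q2 aq qs AE B0 /andP[d0 d1] epsE eps1 epsBA epsp.
have s0 : 0 < s by apply: lt_trans qs; apply: lt_le_trans q2.
have p2 : 1 <= (2 : R) `^ p.
  by rewrite -[leLHS](powRr0 (2 : R)); apply: ler_powR; rewrite ?ler1n// ltW.
have A0 : 0 < A.
  by rewrite AE !addr_gt0 ?divr_gt0// mulr_gt0 ?exprn_gt0// powR_gt0.
have L0 : 0 < ln (1 / delta) by rewrite ln_gt0// ltr_pdivlMr// mul1r.
have t0 : 0 < (A + B) / ln (1 / delta) by rewrite divr_gt0// addr_gt0.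
have eps0 : 0 < eps by rewrite epsE powR_gt0.
have lnE : ln eps = 1 / s * ln ((A + B) / ln (1 / delta)) by rewrite epsE ln_powR.
set N := 1 / eps.
have N0 : 0 < N by rewrite divr_gt0.
have N1 : 1 < N by rewrite ltr_pdivlMr// mul1r.
pose l := ln N.
have l0 : 0 < l by exact: ln_gt0.
have lE : ln eps = - l by rewrite /l /N div1r lnV ?posrE// opprK.
have NE x : N `^ x = expR (x * l) by rewrite powR_expR.
have NsE : N `^ s = ln (1 / delta) / (A + B).
  rewrite NE (_ : s * l = - ln ((A + B) / ln (1 / delta))).
    by rewrite expRN lnK ?posrE// invf_div.
  by rewrite -[l]opprK -lE lnE; field; rewrite gt_eqF.
have AB0 : 0 < A + B by exact: addr_gt0.
have dE : delta = expR (- ((A + B) * N `^ s)).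
  rewrite NsE mulrCA divff ?gt_eqF// mulr1 div1r lnV ?posrE// opprK lnK// posrE.
have lnlt (x y : R) : 0 < x -> 0 < y -> x < y -> ln x < ln y.
  by move=> x0 y0; rewrite ltr_ln ?posrE.
have NAB : A * N `^ q <= B * N `^ s.
  have BA0 : 0 < B / A by exact: divr_gt0.
  have := lnlt _ _ eps0 (powR_gt0 _ BA0) epsBA.
  rewrite ln_powR lE ln_div ?posrE// mul1r ltr_pdivlMl ?subr_gt0// => h.
  rewrite !NE -[X in X * _ <= _](lnK (x := A)) ?posrE//.
  rewrite -[X in _ <= X * _](lnK (x := B)) ?posrE// -!expRD ler_expR.
  by move: h; lra.
have tail : p <= s * gamma * c * N `^ s.
  have x0 : 0 < s * gamma * c / p by rewrite divr_gt0// !mulr_gt0.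
  have := lnlt _ _ eps0 (powR_gt0 _ x0) epsp.
  rewrite ln_powR lE ln_div ?posrE ?mulr_gt0// mul1r ltr_pdivlMl// => h.
  rewrite NE -[leLHS](lnK (x := p)) ?posrE//.
  rewrite -[X in _ <= X * _](lnK (x := s * gamma * c)) ?posrE ?mulr_gt0//.
  by rewrite -expRD ler_expR; move: h; lra.
pose Q := N `^ q.
have Q1 : 1 <= Q by rewrite /Q NE -expR0 ler_expR mulr_ge0 ?ltW// (lt_le_trans _ q2).
have Qs : Q <= N `^ s by rewrite /Q !NE ler_expR ler_pM2r// ltW.
have Qa : N `^ (alpha / 2) <= Q by rewrite /Q !NE ler_expR ler_pM2r.
(* Since [exp (2 l) = N^2 <= Q], the logarithm of the Sobolev weight is at most [p Q]; this is where
   [2 <= q] enters. *)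
have Q2 : 1 + 2 * l <= Q.
  apply: (le_trans (expR_ge1Dx _)).
  by rewrite /Q NE ler_expR ler_pM2r.
have ln2 : ln 2 <= 1 :> R by have := @le_ln1Dx R 1; apply; lra.
have powE : (2 * N ^+ 2) `^ p = expR (p * (ln 2 + 2 * l)).
  have N2 : 0 < N ^+ 2 by exact: exprn_gt0.
  rewrite powR_expR; last exact: mulr_gt0.
  by rewrite lnM ?posrE// lnXn// -[l *+ 2]mulr_natl.
have pQ : p * (ln 2 + 2 * l) <= p * Q.
  by rewrite ler_pM2l//; move: ln2 Q2; lra.
have K2Q : K ^+ 2 <= K ^+ 2 * 2 `^ p * Q.
  by rewrite -mulrA; apply: ler_peMr; [exact: sqr_ge0|exact: mulr_ege1].
(* [A] contains [K^2] but the exponent contains [K]; completing the square leaves the constant 1/2,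
   and [exp (1/2) <= 2] is the factor 2 in the growth bounds. *)
have KK : 2 * K <= 2 * K ^+ 2 + 2^-1.
  rewrite -subr_ge0; have -> : 2 * K ^+ 2 + 2^-1 - 2 * K = 2 * (K - 2^-1) ^+ 2 by field.
  by apply: mulr_ge0 => //; exact: sqr_ge0.
have AQ : A * Q = p / 2 * Q + Q + K ^+ 2 * 2 `^ p * Q by rewrite AE; ring.
have growth (Y : R) : A * Q <= Y ->
    (2 * N ^+ 2) `^ p * expR (2 * N `^ (alpha / 2) + 2 * K) <= 2 * expR (2 * Y).
  move=> AY; rewrite powE -expRD.
  apply: (@le_trans _ _ (expR (2^-1 + 2 * Y))); last first.
    by rewrite expRD ler_wpM2r ?expR_ge0// expR_half_le2.
  by rewrite ler_expR; move: pQ Qa K2Q KK AQ AY; lra.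
split => //.
- by apply: growth; rewrite ler_pM2l.
- exact: growth.
- rewrite powE ler_expR; move: pQ AQ NAB; rewrite -/Q.
  have : 0 <= K ^+ 2 * 2 `^ p * Q by apply: le_trans K2Q; exact: sqr_ge0.
  by lra.
Qed.

(* On the high frequencies the a priori weight beats the polynomial one: the
   quotient is decreasing there as soon as [p <= s gamma c N^s]. *)
Lemma tail_weight_le (s p c gamma N w : R) : 0 < s -> 0 <= p -> 0 < gamma * c ->
  1 <= N -> p <= s * gamma * c * N `^ s -> N <= `|w| ->
  (1 + w ^+ 2) `^ p <= (2 * N ^+ 2) `^ p * expR (- (2 * gamma * c * N `^ s)) *
    expR (2 * gamma * c * `|w| `^ s).
Proof.
move=> s0 p0 gc0 N1 tail Nw.
have N0 : 0 < N by exact: lt_le_trans N1.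
have w0 : 0 < `|w| by exact: lt_le_trans Nw.
have w1 : 1 <= `|w| by exact: le_trans Nw.
rewrite -[w ^+ 2]real_normK ?num_real//.
move: `|w| w0 w1 Nw => v v0 v1 Nv.
apply: (@le_trans _ _ ((2 * v ^+ 2) `^ p)).
  apply: ge0_ler_powR => //; rewrite ?nnegrE.
  - by apply: addr_ge0 => //; exact: sqr_ge0.
  - by apply: mulr_ge0 => //; exact: sqr_ge0.
  - by rewrite mulrDl mul1r lerD2r exprn_ege1.
rewrite !powR_expR ?mulr_gt0 ?exprn_gt0// -!expRD ler_expR.
have lnE (x : R) : 0 < x -> ln (2 * x ^+ 2) = ln 2 + 2 * ln x.
  by move=> x0; rewrite lnM ?posrE ?exprn_gt0// expr2 lnM ?posrE//; lra.
rewrite !lnE//.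
pose r := ln v - ln N.
have r0 : 0 <= r by rewrite subr_ge0 ler_ln ?posrE.
have vE : expR (s * ln v) = N `^ s * expR (s * r).
  by rewrite powR_expR// -expRD; congr expR; rewrite /r; ring.
rewrite powR_expR// in tail vE *.
set X := expR (s * ln N) in tail vE *; rewrite vE.
have X0 : 0 < X by exact: expR_gt0.
have := expR_ge1Dx (s * r); set Y := expR (s * r) => Y1.
have h1 : p * r <= s * gamma * c * X * r by rewrite ler_wpM2r.
have h2 : gamma * c * X * (s * r) <= gamma * c * X * (Y - 1).
  by apply: ler_wpM2l; [rewrite mulr_ge0// ltW|lra].
have lvE : ln v = r + ln N by rewrite /r; ring.
rewrite lvE.
rewrite -subr_ge0.
have -> : p * (ln 2 + 2 * ln N) + - (2 * gamma * c * X) + 2 * gamma * c * (X * Y)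
   - p * (ln 2 + 2 * (r + ln N)) =
   2 * (gamma * c * X * (Y - 1) - gamma * c * X * (s * r))
   + 2 * (s * gamma * c * X * r - p * r) by ring.
by rewrite addr_ge0// mulr_ge0// subr_ge0.
Qed.

(** From [exp (K r - 1) >= K r] and [e >= 2] one gets [2 K r <= exp (K r)]; the left side is half
    the square of the ratio of these two quantities. *)
Lemma sqr_expR_kernel_le (K r : R) : 0 < K -> 0 <= r ->
  2 * K ^+ 2 * (r ^+ 2 * expR (- (2 * K * r))) <= 2^-1.
Proof.
move=> K0 r0.
have e2 : 2 <= expR 1 :> R by have := expR_ge1Dx (1 : R); lra.
have h : 2 * (K * r) <= expR (K * r).
  have := expR_ge1Dx (K * r - 1); rewrite expRD expRN.
  rewrite ler_pdivlMr ?expR_gt0// => h.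
  apply: le_trans h; rewrite addrC subrK mulrC.
  by apply: ler_wpM2l => //; rewrite mulr_ge0// ltW.
have e0 : 0 < expR (K * r) by exact: expR_gt0.
have -> : 2 * K * r = K * r + K * r by ring.
rewrite opprD expRD expRN.
have -> : 2 * K ^+ 2 * (r ^+ 2 * ((expR (K * r))^-1 * (expR (K * r))^-1)) =
    2^-1 * (2 * (K * r) / expR (K * r)) ^+ 2 by field; rewrite gt_eqF.
rewrite -[leRHS]mulr1 ler_pM2l ?invr_gt0// exprn_ile1//.
  by rewrite divr_ge0 ?expR_ge0// !mulr_ge0// ltW.
by rewrite ler_pdivrMr// mul1r.
Qed.

End parameters.

(** * Bounds on the hyperbolic functions of [k] *)

Section complex_hyperbolic.
Context {R : realType}.
Local Open Scope complex_scope.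
Local Open Scope ring_scope.
Implicit Types (z : R[i]) (a b y L : R).

Lemma half_complex a b : (a +i* b) / 2%:R = (a / 2) +i* (b / 2) :> R[i].
Proof.
have n2 : (2%:R : R[i]) != 0 by rewrite pnatr_eq0.
apply: (mulIf n2); rewrite divfK//.
have -> : (2%:R : R[i]) = (2 +i* 0).
  by rewrite -[2 in RHS]/(1 + 1) -[0 in RHS](addr0 0).
by apply/eqP; rewrite eq_complex /=; apply/andP; split; apply/eqP; field.
Qed.

Lemma expCE a b : expC (a +i* b) = (expR a * cos b) +i* (expR a * sin b) :> R[i].
Proof. by apply/eqP; rewrite eq_complex /=; apply/andP; split; apply/eqP; ring. Qed.

Lemma coshCE a b : coshC (a +i* b) =
  ((expR a + expR (- a)) / 2 * cos b) +i* ((expR a - expR (- a)) / 2 * sin b).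
Proof.
rewrite /coshC (_ : - (a +i* b) = (- a) +i* (- b))//.
rewrite !expCE cosN sinN [X in X / _](_ : _ =
  ((expR a + expR (- a)) * cos b) +i* ((expR a - expR (- a)) * sin b)).
  by rewrite half_complex; apply/eqP; rewrite eq_complex /=; apply/andP; split; apply/eqP; ring.
by apply/eqP; rewrite eq_complex /=; apply/andP; split; apply/eqP; ring.
Qed.

Lemma sinhCE a b : sinhC (a +i* b) =
  ((expR a - expR (- a)) / 2 * cos b) +i* ((expR a + expR (- a)) / 2 * sin b).
Proof.
rewrite /sinhC (_ : - (a +i* b) = (- a) +i* (- b))//.
rewrite !expCE cosN sinN [X in X / _](_ : _ =
  ((expR a - expR (- a)) * cos b) +i* ((expR a + expR (- a)) * sin b)).
  by rewrite half_complex; apply/eqP; rewrite eq_complex /=; apply/andP; split; apply/eqP; ring.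
by apply/eqP; rewrite eq_complex /=; apply/andP; split; apply/eqP; ring.
Qed.

(** For [z = a + i b] the square of the modulus is [cosh(a)^2 cos(b)^2 + sinh(a)^2 sin(b)^2], and
    both hyperbolic factors are at most [exp (2 a)]. *)
Lemma sqr_normc_coshC z : 0 <= complex.Re z ->
  Normc.normc (coshC z) ^+ 2 <= expR (complex.Re z) ^+ 2.
Proof.
case: z => [a b] a0; rewrite coshCE sqr_normcE; rewrite /= in a0 *.
have e1 : 1 <= expR a by rewrite -expR0 ler_expR.
have e2 : expR (- a) <= 1 by rewrite -expR0 ler_expR oppr_le0.
have e3 : 0 < expR (- a) by exact: expR_gt0.
have := cos2Dsin2 b.
move: (expR a) (expR (- a)) (cos b) (sin b) e1 e2 e3 => E F c s E1 F1 F0 cs.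
rewrite [X in X + _]exprMn [X in _ + X]exprMn.
apply: (@le_trans _ _ (E ^+ 2 * c ^+ 2 + E ^+ 2 * s ^+ 2)).
  apply: lerD; rewrite ler_wpM2r ?sqr_ge0//.
    by rewrite lerXn2r ?nnegrE; lra.
  by rewrite lerXn2r ?nnegrE; lra.
by rewrite -mulrDr cs mulr1.
Qed.

(** The square of the modulus is [sinh(a)^2 + sin(b)^2], where [sinh a <= a exp a] and
    [|sin b| <= |b|]. The factor [|z|^2] is what cancels the division by [k] in [sinhk], uniformly
    near frequency 0. *)
Lemma sqr_normc_sinhC z : 0 <= complex.Re z ->
  Normc.normc (sinhC z) ^+ 2 <= Normc.normc z ^+ 2 * expR (complex.Re z) ^+ 2.
Proof.
case: z => [a b] a0; rewrite sinhCE !sqr_normcE; rewrite /= in a0 *.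
have e1 : 1 <= expR a by rewrite -expR0 ler_expR.
have ef : expR a * expR (- a) = 1 by rewrite -expRD subrr expR0.
have e2 : expR (- a) <= 1 by rewrite -expR0 ler_expR oppr_le0.
have h : (expR a - expR (- a)) / 2 <= a * expR a.
  have := expR_ge1Dx (- (a + a)); rewrite opprD expRD => h1.
  have : 0 < expR a by exact: expR_gt0.
  by move: h1 ef; move: (expR a) (expR (- a)) => E F; nra.
have := cos2Dsin2 b; have sb : sin b ^+ 2 <= b ^+ 2.
  by rewrite -(real_normK (num_real (sin b))) -(real_normK (num_real b)) lerXn2r ?nnegrE// normr_sin_le.
move: (expR a) (expR (- a)) e1 ef e2 h => E F E1 EF F1 h.
move: (cos b) (sin b) sb => c s sb cs.
have h0 : 0 <= (E - F) / 2 by lra.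
have -> : ((E - F) / 2 * c) ^+ 2 + ((E + F) / 2 * s) ^+ 2 =
    ((E - F) / 2) ^+ 2 * (c ^+ 2 + s ^+ 2) + E * F * s ^+ 2 by field.
rewrite cs EF mulr1 mul1r [leRHS]mulrDl lerD//.
  by rewrite -exprMn lerXn2r ?nnegrE// (le_trans h0).
by apply: (le_trans sb); rewrite ler_peMr ?sqr_ge0// exprn_ege1.
Qed.

Context (alpha : R) (alpha01 : 0 < alpha < 1).

Let th : R := alpha * pi / 4.

Lemma cos_alpha_gt0 : 0 < cos (alpha * pi / 4).
Proof.
case/andP: alpha01 => a0 a1.
have p0 := pi_gt0 R.
apply: cos_gt0_pihalf; apply/andP; split.
  apply: (@lt_trans _ _ 0); first by rewrite oppr_lt0 divr_gt0.
  by rewrite divr_gt0// mulr_gt0.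
have h : alpha * pi < pi by rewrite -[ltRHS]mul1r ltr_pM2r.
by move: h p0; move: (alpha * pi) (pi : R) => x y; lra.
Qed.

Lemma Re_kM w y : complex.Re (k alpha w * y%:C) = `|w| `^ (alpha / 2) * cos th * y.
Proof. by rewrite /k /= -/th; ring. Qed.

Lemma Re_k_le w N : `|w| <= N -> complex.Re (k alpha w) <= N `^ (alpha / 2).
Proof.
move=> wN; rewrite /k /= -/th.
have a0 : 0 <= alpha / 2 by case/andP: alpha01 => a0 _; rewrite ltW// divr_gt0.
rewrite mul0r subr0 -[leRHS]mulr1 ler_pM ?powR_ge0 ?cos_le1//.
  exact: ltW cos_alpha_gt0.
by apply: ge0_ler_powR; rewrite ?nnegrE// (le_trans _ wN).
Qed.

Lemma Re_kM_ge0 w y : 0 <= y -> 0 <= complex.Re (k alpha w * y%:C).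
Proof. by move=> y0; rewrite Re_kM !mulr_ge0 ?powR_ge0// ltW// cos_alpha_gt0. Qed.

Lemma Re_kM_le w N y : 0 <= y -> `|w| <= N ->
  complex.Re (k alpha w * y%:C) <= N `^ (alpha / 2) * y.
Proof.
move=> y0 wN; rewrite (_ : complex.Re _ = complex.Re (k alpha w) * y).
  by rewrite ler_wpM2r// Re_k_le.
by rewrite Re_kM /k /= -/th; ring.
Qed.

Lemma sqr_expR (x : R) : expR x ^+ 2 = expR (2 * x).
Proof. by rewrite expr2 -expRD; congr expR; ring. Qed.

Lemma sqr_normc_cosh_k w N y : 0 <= y -> `|w| <= N ->
  Normc.normc (coshC (k alpha w * y%:C)) ^+ 2 <= expR (2 * N `^ (alpha / 2) * y).
Proof.
move=> y0 wN; apply: le_trans (sqr_normc_coshC (Re_kM_ge0 w y0)) _.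
by rewrite sqr_expR ler_expR -mulrA ler_pM2l// Re_kM_le.
Qed.

Lemma sqr_normc_sinhk w N y : 0 <= y -> `|w| <= N ->
  Normc.normc (sinhk alpha w y) ^+ 2 <= y ^+ 2 * expR (2 * N `^ (alpha / 2) * y).
Proof.
move=> y0 wN; rewrite /sinhk.
have e1 : 1 <= expR (2 * N `^ (alpha / 2) * y).
  by rewrite -expR0 ler_expR !mulr_ge0// powR_ge0.
case: eqP => [_|/eqP w0].
  by rewrite sqr_normcE /= expr0n addr0 ler_peMr ?sqr_ge0.
(* If [k] vanished, the convention that the inverse of 0 is 0 would make the quotient 0; this is
   simpler than proving that [k] is nonzero. *)
have [k0|k0] := eqVneq (k alpha w) 0.
  by rewrite k0 invr0 mulr0 Normc.normc0 expr0n/= mulr_ge0 ?sqr_ge0 ?expR_ge0.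
rewrite Normc.normcM Normc.normcV exprMn exprVn ler_pdivrMr; last first.
  rewrite exprn_gt0// lt_def; apply/andP; split.
    by apply: contra k0 => /eqP/Normc.eq0_normc ->.
  by case: (k alpha w) => ? ? /=; exact: sqrtr_ge0.
apply: le_trans (sqr_normc_sinhC (Re_kM_ge0 w y0)) _.
rewrite Normc.normcM exprMn [Normc.normc y%:C ^+ 2](_ : _ = y ^+ 2); last first.
  by rewrite sqr_normcE /= expr0n addr0.
rewrite [leRHS]mulrC [leRHS]mulrA; apply: ler_wpM2l.
  by apply: mulr_ge0; exact: sqr_ge0.
by rewrite sqr_expR ler_expR -mulrA ler_pM2l// Re_kM_le.
Qed.

End complex_hyperbolic.

(** * Low and high frequencies *)

Section kernel_integral.
Context {R : realType}.
Implicit Types (s F G : R -> R[i]) (g : R -> R).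

Lemma measurableCM F G : measurableC F -> measurableC G ->
  measurableC (fun z => F z * G z).
Proof.
move=> [a b] [c d]; split.
  have -> : (fun z => complex.Re (F z * G z)) =
    (fun z => complex.Re (F z) * complex.Re (G z) - complex.Im (F z) * complex.Im (G z)).
    by apply/funext => z; case: (F z) (G z) => [? ?] [? ?].
  by apply: measurable_funB; exact: measurable_funM.
have -> : (fun z => complex.Im (F z * G z)) =
  (fun z => complex.Re (F z) * complex.Im (G z) + complex.Im (F z) * complex.Re (G z)).
  by apply/funext => z; case: (F z) (G z) => [? ?] [? ?].
by apply: measurable_funD; exact: measurable_funM.
Qed.

Lemma measurableC_comp F (phi : R -> R) : measurable_fun setT phi ->
  measurableC F -> measurableC (fun z => F (phi z)).
Proof. by move=> mp [a b]; split; [exact: measurableT_comp a mp|exact: measurableT_comp b mp]. Qed.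

Lemma measurableC_if (P : R -> bool) F : measurable_fun setT P ->
  measurableC F -> measurableC (fun z => if P z then F z else 0).
Proof.
move=> mP [a b]; split.
  have -> : (fun z => complex.Re (if P z then F z else 0)) =
    (fun z => if P z then complex.Re (F z) else 0).
    by apply/funext => z; case: ifP.
  exact: measurable_fun_ifT.
have -> : (fun z => complex.Im (if P z then F z else 0)) =
  (fun z => if P z then complex.Im (F z) else 0).
  by apply/funext => z; case: ifP.
exact: measurable_fun_ifT.
Qed.

Lemma measurable_itvoo (a b : R) : measurable_fun setT (fun z : R => a < z < b).
Proof. by apply: measurable_and; exact: measurable_fun_ltr. Qed.

Lemma L1_support01 g : measurable_fun setT g -> (nsq g < +oo)%E ->
  (forall z, ~~ (0 < z < 1) -> g z = 0) -> L1 g.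
Proof.
move=> mg ng g0; apply: (@L1_support _ 1 g) => //.
- move=> t t1; apply: g0; rewrite negb_and -!leNgt.
  by move: t1; have [t0 _|t0] := lerP t 0 => //; rewrite gtr0_norm// => /ltW.
- by move=> t; exact: le_normr_1Dsqr.
Qed.

Lemma sqr_Rintegral_le g : measurable_fun setT g -> (nsq g < +oo)%E ->
  (forall z, ~~ (0 < z < 1) -> g z = 0) ->
  (((\int[leb R]_z g z) ^+ 2)%:E <= nsq g)%E.
Proof.
move=> mg ng g0; have ig := L1_support01 mg ng g0.
set I := \int[leb R]_z g z.
have i1 : L1 (\1_`]0, 1[ : R -> R) by exact: integrable_indic_itv.
have i2 : L1 (fun t => g t ^+ 2).
  apply/integrableP; split; first exact: measurable_sqr.
  by under eq_integral do rewrite /= ger0_norm ?sqr_ge0//.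
(* Cauchy-Schwarz on [(0, 1)], by integrating [2 I g - I^2 <= g^2]. *)
have : \int[leb R]_z (2 * I * g z - I ^+ 2 * \1_`]0, 1[ z) <= \int[leb R]_z (g z ^+ 2).
  apply: le_Rintegral => //; first by apply: L1B; exact: L1Zl.
  move=> z _; rewrite indicE mem_setE in_itv/=.
  have [_|z01] := boolP (0 < z < 1).
    rewrite -subr_ge0; have -> : g z ^+ 2 - (2 * I * g z - I ^+ 2 * 1) = (g z - I) ^+ 2 by ring.
    exact: sqr_ge0.
  by rewrite g0// !mulr0 subrr expr0n.
rewrite RintegralB//; [|exact: L1Zl|exact: L1Zl].
rewrite !RintegralZl// -/I.
have -> : \int[leb R]_z (\1_`]0, 1[ z : R) = 1.
  rewrite /Rintegral integral_indic//= setIT.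
  by rewrite lebesgue_measure_itv/= lte_fin ltr01 oppr0 adde0.
rewrite -lee_fin EFin_Rintegral//; apply: le_trans.
by rewrite lee_fin; lra.
Qed.

Lemma sqr_normc_Cintegral_le G : measurableC G -> (cnsq G < +oo)%E ->
  (forall z, ~~ (0 < z < 1) -> G z = 0) ->
  ((Normc.normc (Cintegral setT G) ^+ 2)%:E <= cnsq G)%E.
Proof.
move=> mG nG G0; have [[_ nR] [_ nI]] : (measurable_fun setT (fun z => complex.Re (G z)) /\
    nsq (fun z => complex.Re (G z)) < +oo)%E /\
    (measurable_fun setT (fun z => complex.Im (G z)) /\
    nsq (fun z => complex.Im (G z)) < +oo)%E.
  by have [/L2P ? /L2P ?] := (L2CP G).2 (conj mG nG).
case: (mG) => mR mI; rewrite sqr_normcE cnsqE// EFinD leeD//.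
  by apply: sqr_Rintegral_le => // z /G0 ->.
by apply: sqr_Rintegral_le => // z /G0 ->.
Qed.

(** A partial transform is prescribed only for [0 < z < 1], so an integrand of the solution formula
    is arbitrary at the endpoints. These are null, and [g] is the version cut off outside the open
    interval. *)
Lemma Rintegral_open (x : R) (f g : R -> R) : L1 g ->
  (forall z, 0 < z < x -> f z = g z) -> (forall z, ~~ (0 < z < x) -> g z = 0) ->
  \int[leb R]_(z in `[0, x]) f z = \int[leb R]_z g z.
Proof.
move=> ig fg g0.
have [x0|x0] := leP x 0.
  have -> : \int[leb R]_z g z = 0.
    under eq_Rintegral => z _.
      rewrite g0; last by rewrite negb_and -!leNgt; have [//|z0] := leP z 0; rewrite (le_trans x0)// ltW.
      over.
    by rewrite /Rintegral integral0.
  have [x1|x1] := ltP x 0.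
    by rewrite set_itv_ge ?Rintegral_set0// bnd_simp -ltNge.
  have -> : x = 0 by apply/eqP; rewrite eq_le x0.
  by rewrite set_itv1 Rintegral_set1.
have mf : measurable_fun `]0, x[ f.
  apply: (@eq_measurable_fun _ _ _ _ _ g) => //.
    by move=> z; rewrite inE/= in_itv/= => /fg ->.
  exact: measurable_funTS (L1_measurable ig).
rewrite [RHS](_ : _ = \int[leb R]_(z in `[0, x]) g z); last first.
  rewrite [RHS]Rintegral_mkcond; apply: eq_Rintegral => z _; rewrite patchE.
  case: ifPn => //; rewrite notin_setE/= in_itv/= => z0; apply: g0.
  by apply/negP => /andP[a b]; apply: z0; rewrite !ltW.
congr fine; apply: eq_integral_itv_bounded => //.
  exact: measurable_funTS (L1_measurable ig).
Qed.

Lemma Cintegral_open (x : R) (f g : R -> R[i]) :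
  L1 (fun z => complex.Re (g z)) -> L1 (fun z => complex.Im (g z)) ->
  (forall z, 0 < z < x -> f z = g z) -> (forall z, ~~ (0 < z < x) -> g z = 0) ->
  Cintegral `[0, x] f = Cintegral setT g.
Proof.
move=> iR iI fg g0; rewrite /Cintegral.
rewrite (@Rintegral_open x _ _ iR) => [|z /fg -> //|z /g0 -> //].
by rewrite (@Rintegral_open x _ _ iI) => [//|z /fg -> //|z /g0 -> //].
Qed.

Lemma CintegralB (g1 g2 : R -> R[i]) :
  L1 (fun z => complex.Re (g1 z)) -> L1 (fun z => complex.Im (g1 z)) ->
  L1 (fun z => complex.Re (g2 z)) -> L1 (fun z => complex.Im (g2 z)) ->
  Cintegral setT g1 - Cintegral setT g2 = Cintegral setT (fun z => g1 z - g2 z).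
Proof.
move=> a b c d; rewrite /Cintegral.
apply/eqP; rewrite eq_complex /= -!RintegralB//.
by apply/andP; split; apply/eqP; apply: eq_Rintegral => z _; rewrite ?ReB ?ImB.
Qed.

(** The integrand of a Volterra integral extended by 0, so that the variable upper limit disappears
    and integrals over the whole line can be compared. *)
Definition cut s G (x z : R) : R[i] := if 0 < z < x then s (x - z) * G z else 0.

Lemma measurableC_cut s G x : measurableC s -> measurableC G -> measurableC (cut s G x).
Proof.
move=> ms mG; apply: measurableC_if; first exact: measurable_itvoo.
apply: measurableCM => //; apply: measurableC_comp ms.
exact: measurable_funB.
Qed.

Lemma cut_fin s G x (C : R) : 0 <= x <= 1 -> measurableC s -> measurableC G ->
  (forall y, 0 <= y <= 1 -> Normc.normc (s y) ^+ 2 <= C) -> (cnsq G < +oo)%E ->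
  (cnsq (cut s G x) < +oo)%E.
Proof.
move=> /andP[x0 x1] ms mG sC nG.
have C0 : 0 <= C by apply: le_trans (sC 0 _); rewrite ?sqr_ge0 ?lexx ?ler01.
apply: (@le_lt_trans _ _ (C%:E * cnsq G)%E); last by rewrite lte_mul_pinfty.
rewrite -integralZlR//; [|exact: measurable_sqr_normc|by move=> z; exact: sqr_ge0].
apply: ge0_le_integral => //.
- by move=> z _; rewrite lee_fin sqr_ge0.
- by apply: measurable_sqr_normcE; exact: measurableC_cut.
- apply/measurable_EFinP; apply: measurable_funM => //.
  exact: measurable_sqr_normc.
- move=> z _; rewrite lee_fin /cut; case: ifPn => [/andP[z0 zx]|_].
    rewrite Normc.normcM exprMn ler_wpM2r ?sqr_ge0// sC//.
    by rewrite subr_ge0 (ltW zx)/=; move: z0 x1; lra.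
  by rewrite Normc.normc0 expr0n mulr_ge0// sqr_ge0.
Qed.

Lemma cut_eq0 s G x z : x <= 1 -> ~~ (0 < z < 1) -> cut s G x z = 0.
Proof.
move=> x1 z1; rewrite /cut ifF//; apply: contraNF z1 => /andP[-> zx]/=.
exact: lt_le_trans x1.
Qed.

Lemma L1_cut s G x (C : R) : 0 <= x <= 1 -> measurableC s -> measurableC G ->
  (forall y, 0 <= y <= 1 -> Normc.normc (s y) ^+ 2 <= C) -> (cnsq G < +oo)%E ->
  L1 (fun z => complex.Re (cut s G x z)) /\ L1 (fun z => complex.Im (cut s G x z)).
Proof.
move=> x01 ms mG sC nG; have mc := measurableC_cut x ms mG.
have [/L2P[mR nR] /L2P[mI nI]] := (L2CP _).2 (conj mc (cut_fin x01 ms mG sC nG)).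
by case/andP: x01 => _ x1; split; apply: L1_support01 => // z /(cut_eq0 s G x1) ->.
Qed.

(** Cauchy-Schwarz on an interval of length at most one. [C] serves only to make the integrals
    converge and does not enter the estimate, so a crude bound on the kernel will do. *)
Lemma sqr_normc_kernelB_le s (F1 F2 G1 G2 : R -> R[i]) x (C : R) : 0 <= x <= 1 ->
  measurableC s -> (forall y, 0 <= y <= 1 -> Normc.normc (s y) ^+ 2 <= C) ->
  measurableC G1 -> (cnsq G1 < +oo)%E -> (forall z, 0 < z < 1 -> F1 z = G1 z) ->
  measurableC G2 -> (cnsq G2 < +oo)%E -> (forall z, 0 < z < 1 -> F2 z = G2 z) ->
  ((Normc.normc (Cintegral `[0, x] (fun z => s (x - z) * F1 z) -
                 Cintegral `[0, x] (fun z => s (x - z) * F2 z)) ^+ 2)%:E <=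
    cnsq (cut s (fun z => (G1 z - G2 z)%R) x))%E.
Proof.
move=> x01 ms sC m1 n1 E1 m2 n2 E2; have /andP[x0 x1] := x01.
have [a b] := L1_cut x01 ms m1 sC n1; have [c d] := L1_cut x01 ms m2 sC n2.
have op (F G : R -> R[i]) : (forall z, 0 < z < 1 -> F z = G z) ->
    L1 (fun z => complex.Re (cut s G x z)) -> L1 (fun z => complex.Im (cut s G x z)) ->
    Cintegral `[0, x] (fun z => s (x - z) * F z) = Cintegral setT (cut s G x).
  move=> E i1 i2; apply: Cintegral_open => // z; rewrite /cut; last by move=> /negbTE ->.
  move=> zx; rewrite zx E//; case/andP: zx => -> zx/=; exact: lt_le_trans x1.
rewrite (op F1 G1)// (op F2 G2)// CintegralB//.
have -> : (fun z => cut s G1 x z - cut s G2 x z) = cut s (fun z => G1 z - G2 z) x.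
  by apply/funext => z; rewrite /cut; case: ifP => _; rewrite ?subrr// mulrBr.
have m12 := measurableCB m1 m2.
apply: sqr_normc_Cintegral_le; first exact: measurableC_cut.
- apply: (cut_fin x01 ms m12 sC).
  have := young_cnsq ltr01 m12 m1 (measurableCN m2) (aeW _ (fun=> erefl)).
  move/le_lt_trans; apply.
  have -> : cnsq (fun w => - G2 w) = cnsq G2.
    by apply: eq_integral => z _; rewrite normcN.
  by rewrite lte_add_pinfty// lte_mul_pinfty// ?cnsq_ge0// lee_fin.
- by move=> z; exact: cut_eq0.
Qed.

End kernel_integral.

(** * Functions on the strip and their slices *)

Section strips.
Context {R : realType}.
Implicit Types (v : R -> R -> R) (F : R -> R -> R[i]) (h : R * R -> R).

Lemma measurable_integral1 h : measurable_fun setT h -> (forall q, 0 <= h q) ->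
  measurable_fun setT (fun x => \int[leb R]_y (h (x, y))%:E)%E.
Proof.
move=> mh h0; apply: (@measurable_fun_fubini_tonelli_F _ _ _ _ _ (leb R) (EFin \o h)).
  exact/measurable_EFinP.
by move=> q; rewrite lee_fin.
Qed.

Lemma measurable_integral2 h : measurable_fun setT h -> (forall q, 0 <= h q) ->
  measurable_fun setT (fun y => \int[leb R]_x (h (x, y))%:E)%E.
Proof.
move=> mh h0; apply: (@measurable_fun_fubini_tonelli_G _ _ _ _ _ (leb R) (EFin \o h)).
  exact/measurable_EFinP.
by move=> q; rewrite lee_fin.
Qed.

Lemma integral_fin_ae (f : R -> \bar R) : measurable_fun setT f -> (forall x, 0 <= f x)%E ->
  (\int[leb R]_x f x < +oo)%E -> {ae leb R, forall x, (f x < +oo)%E}.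
Proof.
move=> mf f0 fi; have fint : (leb R).-integrable setT f.
  by apply/integrableP; split => //; under eq_integral do rewrite gee0_abs//.
apply: (ae_imp (integrable_ae measurableT fint)) => x /(_ I).
by rewrite ge0_fin_numE.
Qed.

Lemma ae_section1 h : measurable_fun setT h -> (forall q, 0 <= h q) ->
  (\int[leb R]_x \int[leb R]_y (h (x, y))%:E < +oo)%E ->
  {ae leb R, forall x, (\int[leb R]_y (h (x, y))%:E < +oo)%E}.
Proof.
move=> mh h0; apply: integral_fin_ae; first exact: measurable_integral1.
by move=> x; apply: integral_ge0 => y _; rewrite lee_fin.
Qed.

Lemma ae_section2 h : measurable_fun setT h -> (forall q, 0 <= h q) ->
  (\int[leb R]_x \int[leb R]_y (h (x, y))%:E < +oo)%E ->
  {ae leb R, forall y, (\int[leb R]_x (h (x, y))%:E < +oo)%E}.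
Proof.
move=> mh h0; rewrite tonelliR//; apply: integral_fin_ae; first exact: measurable_integral2.
by move=> y; apply: integral_ge0 => x _; rewrite lee_fin.
Qed.

Definition strip v (q : R * R) : R := if 0 < q.1 < 1 then v q.1 q.2 else 0.

(** Outside the open strip [F] is unconstrained; the cut-off makes it measurable on the plane, as
    Tonelli requires. *)
Definition cstrip F (q : R * R) : R[i] := if 0 < q.1 < 1 then F q.1 q.2 else 0.

Lemma stripE v : (fun q : R * R => v q.1 q.2) \_ (`]0, 1[ `*` setT) = strip v.
Proof.
apply/funext => -[z w]; rewrite patchE /strip /= in_setX in_setT andbT.
by rewrite mem_setE in_itv.
Qed.

Lemma L2stripP v : L2strip v -> measurable_fun setT (strip v) /\
  (\int[leb R]_z \int[leb R]_w (strip v (z, w) ^+ 2)%:E < +oo)%E.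
Proof.
rewrite /L2strip stripE => /andP[]; rewrite !inE /= => mv fv; split => //.
rewrite -(@fubini_tonelli1 _ _ _ _ _ (leb R) (leb R) (fun q => (strip v q ^+ 2)%:E)).
- have : (Lnorm (leb2 R) 2%:E (EFin \o strip v) `^ 2 < +oo)%E by rewrite poweR_lty.
  rewrite unlock -poweRrM mulVf// poweRe1; last first.
    by apply: integral_ge0 => q _; rewrite poweR_ge0.
  apply: le_lt_trans; rewrite le_eqVlt; apply/orP; left; apply/eqP.
  apply: eq_integral => q _ /=.
  by rewrite powR_mulrn// -normrX ger0_norm// sqr_ge0.
- by apply/measurable_EFinP; exact: measurable_funX.
- by move=> q; rewrite lee_fin sqr_ge0.
Qed.

Lemma L2strip_slice v : L2strip v -> {ae leb R, forall z, 0 < z < 1 -> L2 (v z)}.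
Proof.
move=> /L2stripP[mv nv].
apply: (ae_imp (ae_section1 (h := fun q => strip v q ^+ 2) _ _ nv)).
- exact: measurable_funX.
- by move=> q; exact: sqr_ge0.
move=> z nz z01; have E : v z = (fun w => strip v (z, w)).
  by apply/funext => w; rewrite /strip z01.
by apply/L2P; rewrite E; split => //; exact: measurable_section1 mv.
Qed.

Lemma cstripRe F q : complex.Re (cstrip F q) = strip (fun z w => complex.Re (F z w)) q.
Proof. by rewrite /cstrip /strip; case: ifP. Qed.

Lemma cstripIm F q : complex.Im (cstrip F q) = strip (fun z w => complex.Im (F z w)) q.
Proof. by rewrite /cstrip /strip; case: ifP. Qed.

Definition measurable2C (P : R * R -> R[i]) :=
  measurable_fun setT (fun q => complex.Re (P q)) /\
  measurable_fun setT (fun q => complex.Im (P q)).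

Lemma measurable2C_sqr P : measurable2C P ->
  measurable_fun setT (fun q => Normc.normc (P q) ^+ 2).
Proof.
move=> [mR mI]; under eq_fun do rewrite sqr_normcE.
by apply: measurable_funD; exact: measurable_funX.
Qed.

Lemma measurable2C1 P z : measurable2C P -> measurableC (fun w => P (z, w)).
Proof. by move=> [mR mI]; split; [exact: measurable_section1 mR|exact: measurable_section1 mI]. Qed.

Lemma measurable2C2 P w : measurable2C P -> measurableC (fun z => P (z, w)).
Proof. by move=> [mR mI]; split; [exact: measurable_section2 mR|exact: measurable_section2 mI]. Qed.

Lemma measurable2CB P Q : measurable2C P -> measurable2C Q ->
  measurable2C (fun q => P q - Q q).
Proof.
move=> [a b] [c d]; split.
  by under eq_fun do rewrite ReB; exact: measurable_funB.
by under eq_fun do rewrite ImB; exact: measurable_funB.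
Qed.

Lemma L2CstripP F : L2Cstrip F -> measurable2C (cstrip F) /\
  (\int[leb R]_z cnsq (fun w => cstrip F (z, w)) < +oo)%E.
Proof.
move=> [/L2stripP[mR nR] /L2stripP[mI nI]].
have mF : measurable2C (cstrip F).
  by split; [under eq_fun do rewrite cstripRe|under eq_fun do rewrite cstripIm].
split; first exact: mF.
under eq_integral => z _.
  rewrite cnsqE; last exact: measurable2C1.
  rewrite /nsq; under eq_integral do rewrite cstripRe.
  under [X in (_ + X)%E]eq_integral do rewrite cstripIm.
  over.
have i0 v : forall z, setT z -> (0 <= \int[leb R]_w (strip v (z, w) ^+ 2)%:E)%E.
  by move=> z _; apply: integral_ge0 => w _; rewrite lee_fin sqr_ge0.
have mi v : measurable_fun setT (strip v) ->
    measurable_fun setT (fun z => \int[leb R]_w (strip v (z, w) ^+ 2)%:E)%E.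
  move=> mv; apply: (measurable_integral1 (h := fun q => strip v q ^+ 2)).
    exact: measurable_funX.
  by move=> q; exact: sqr_ge0.
rewrite (ge0_integralD (leb R) measurableT (i0 _) (mi _ mR) (i0 _) (mi _ mI)).
exact: (lte_add_pinfty nR nI).
Qed.

(** Tonelli, slicing at a fixed frequency: for almost every [w] the integral over [z] in the
    solution formula is then a genuine one. *)
Lemma L2Cstrip_slice2 F : L2Cstrip F ->
  {ae leb R, forall w, (cnsq (fun z => cstrip F (z, w)) < +oo)%E}.
Proof.
move=> /L2CstripP[mF nF].
apply: (ae_section2 (h := fun q => Normc.normc (cstrip F q) ^+ 2)) => //.
  exact: measurable2C_sqr.
by move=> q; exact: sqr_ge0.
Qed.

(** Provides the finiteness that lets [gronwall_bound] start from a bounded low-frequency energy. *)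
Lemma cstripB_fin F1 F2 : L2Cstrip F1 -> L2Cstrip F2 ->
  (\int[leb R]_z cnsq (fun w => (cstrip F1 (z, w) - cstrip F2 (z, w))%R) < +oo)%E.
Proof.
move=> /L2CstripP[m1 n1] /L2CstripP[m2 n2].
have mc P : measurable2C P -> measurable_fun setT (fun z => cnsq (fun w => P (z, w))).
  move=> mP; apply: (measurable_integral1 (h := fun q => Normc.normc (P q) ^+ 2)).
    exact: measurable2C_sqr.
  by move=> q; exact: sqr_ge0.
apply: (@le_lt_trans _ _ (\int[leb R]_z ((1 + 1)%:E * cnsq (fun w => cstrip F1 (z, w)) +
   (1 + 1^-1)%:E * cnsq (fun w => cstrip F2 (z, w))))%E).
  apply: ge0_le_integral => //.
  - by move=> z _; exact: cnsq_ge0.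
  - by apply: (mc (fun q => cstrip F1 q - cstrip F2 q)); exact: measurable2CB.
  - by apply: emeasurable_funD; apply: emeasurable_funM => //; exact: mc.
  - move=> z _; have a := measurable2C1 z m1; have b := measurable2C1 z m2.
    have := young_cnsq ltr01 (measurableCB a b) a (measurableCN b) (aeW _ (fun=> erefl)).
    move/le_trans; apply; rewrite leeD2l// lee_wpmul2l// ?lee_fin//.
    by rewrite /cnsq; under eq_integral do rewrite normcN.
have c0 (P : R * R -> R[i]) : forall z : R, setT z -> (0 <= cnsq (fun w => P (z, w)))%E.
  by move=> z _; exact: cnsq_ge0.
have z2 : 0 <= 1 + 1 :> R by [].
have z2' : 0 <= 1 + 1^-1 :> R by rewrite invr1.
rewrite ge0_integralD//.
- rewrite (ge0_integralZl_EFin (leb R) measurableT (c0 _) (mc _ m1) z2).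
  rewrite (ge0_integralZl_EFin (leb R) measurableT (c0 _) (mc _ m2) z2').
  exact: (lte_add_pinfty (lte_mul_pinfty _ _ n1) (lte_mul_pinfty _ _ n2)).
- by move=> z _; apply: mule_ge0 => //; exact: cnsq_ge0.
- by apply: emeasurable_funM => //; exact: mc.
- by move=> z _; apply: mule_ge0; [rewrite lee_fin|exact: cnsq_ge0].
- by apply: emeasurable_funM => //; exact: mc.
Qed.

End strips.

(** * Splitting at the cut-off frequency *)

Section frequency_splitting.
Context {R : realType}.
Implicit Types (V U : R -> R[i]) (N C : R) (weight : R -> R).

Definition low N V : \bar R :=
  (\int[leb R]_w (if (`|w| <= N)%R then Normc.normc (V w) ^+ 2 else 0)%:E)%E.

Definition high N weight V : \bar R :=
  (\int[leb R]_w (if (`|w| <= N)%R then 0 else weight w * Normc.normc (V w) ^+ 2)%:E)%E.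

Lemma measurable_norm_le N : measurable_fun setT (fun w : R => `|w| <= N).
Proof. by apply: measurable_fun_ler => //; exact: measurableT_comp. Qed.

Lemma measurable_low N V : measurableC V ->
  measurable_fun setT (fun w : R => if `|w| <= N then Normc.normc (V w) ^+ 2 else 0).
Proof.
move=> mV; apply: measurable_fun_ifT => //; first exact: measurable_norm_le.
exact: measurable_sqr_normc.
Qed.

Lemma measurable_high N weight V : measurable_fun setT weight -> measurableC V ->
  measurable_fun setT
    (fun w : R => if `|w| <= N then 0 else weight w * Normc.normc (V w) ^+ 2).
Proof.
move=> mw mV; apply: measurable_fun_ifT => //; first exact: measurable_norm_le.
by apply: measurable_funM => //; exact: measurable_sqr_normc.
Qed.

Lemma low_ge0 N V : (0 <= low N V)%E.
Proof. by apply: integral_ge0 => w _; rewrite lee_fin; case: ifP => // _; exact: sqr_ge0. Qed.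

Lemma weighted_le_low_high N C weight V : 0 <= C -> (forall w, 0 <= weight w) ->
  measurable_fun setT weight -> measurableC V ->
  (forall w, `|w| <= N -> weight w <= C) ->
  (\int[leb R]_w (weight w * Normc.normc (V w) ^+ 2)%:E <=
   C%:E * low N V + high N weight V)%E.
Proof.
move=> C0 w0 mw mV wC; rewrite -[high N weight V]mul1e.
apply: le_integral_comb => //.
- by apply: measurable_funM => //; exact: measurable_sqr_normc.
- exact: measurable_low.
- exact: measurable_high.
- by move=> w; apply: mulr_ge0 => //; exact: sqr_ge0.
- by move=> w; case: ifP => // _; exact: sqr_ge0.
- by move=> w; case: ifP => // _; apply: mulr_ge0 => //; exact: sqr_ge0.
- apply: aeW => w; case: ifPn => wN; last by rewrite mulr0 add0r mul1r.
  by rewrite mulr0 addr0; apply: ler_wpM2r; [exact: sqr_ge0|exact: wC].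
Qed.

(** [V] is meant to be the transform of the error and [U] that of the exact solution: beyond [N] the
    regularized solution has no frequencies, hence the sign in [V w = - U w]. The a priori bound is
    the one with weight [e]. *)
Lemma high_le N C weight (e : R -> R) V U (m : \bar R) : 0 <= C -> measurableC V ->
  measurableC U -> measurable_fun setT weight -> measurable_fun setT e ->
  (forall w, 0 <= weight w) -> (forall w, 0 <= e w) ->
  {ae leb R, forall w, N < `|w| -> V w = - U w} ->
  (forall w, N < `|w| -> weight w <= C * e w) ->
  (\int[leb R]_w (e w * Normc.normc (U w) ^+ 2)%:E <= m)%E ->
  (high N weight V <= C%:E * m)%E.
Proof.
move=> C0 mV mU mw me w0 e0 VU we em.
apply: (@le_trans _ _ (C%:E * \int[leb R]_w (e w * Normc.normc (U w) ^+ 2)%:E)%E); last first.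
  by apply: lee_wpmul2l.
have meU : measurable_fun setT (fun w => e w * Normc.normc (U w) ^+ 2).
  by apply: measurable_funM => //; exact: measurable_sqr_normc.
have eU0 w : 0 <= e w * Normc.normc (U w) ^+ 2 by apply: mulr_ge0 => //; exact: sqr_ge0.
rewrite -integralZlR//; apply: ae_ge0_le_integral => //.
- by move=> w _; rewrite lee_fin; case: ifP => // _; apply: mulr_ge0 => //; exact: sqr_ge0.
- by apply/measurable_EFinP; exact: measurable_high.
- by move=> w _; rewrite lee_fin mulr_ge0.
- by apply/measurable_EFinP; exact: measurable_funM.
- apply: (ae_imp VU) => w Vw _; rewrite lee_fin; case: ifPn => [_|]; first by rewrite mulr_ge0.
  rewrite -ltNge => wN; rewrite Vw// normcN mulrA.
  by apply: ler_wpM2r; [exact: sqr_ge0|exact: we].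
Qed.

End frequency_splitting.

Section contraction.
Context {R : realType}.

(** Taking [C] to be the supremum [S] of [e] gives [S <= a + S / 2]; the first hypothesis makes [S]
    finite, so it can be subtracted. *)
Lemma contraction_bound (T : Type) (P : T -> Prop) (e : T -> R) (a : R) :
  (exists C, forall z, P z -> e z <= C) ->
  (forall C, (forall z, P z -> e z <= C) -> forall z, P z -> e z <= a + C / 2) ->
  forall z, P z -> e z <= 2 * a.
Proof.
move=> [C0 C0P] step z Pz.
pose S := [set e t | t in [set t | P t]].
have S0 : S !=set0 by exists (e z); exists z.
have uS : has_ubound S by exists C0 => _ [t Pt <-]; exact: C0P.
have h t : P t -> e t <= sup S by move=> Pt; apply: ub_le_sup => //; exists t.
have : sup S <= a + sup S / 2.
  by apply: ge_sup => // _ [t Pt <-]; exact: step.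
by have := h z Pz; lra.
Qed.

End contraction.

(** * The Lipschitz condition in frequency *)

Section sources.
Context {R : realType}.
Implicit Types (u ud : R -> R -> R).

Lemma plancherelB (v1 v2 : R -> R) : L2 v1 -> L2 v2 ->
  cnsq (fun w => fourier v1 w - fourier v2 w) = nsq (v1 \- v2).
Proof.
move=> i1 i2; rewrite -(plancherel (L2B i1 i2)); apply: ae_eq_integral => //.
- by apply: measurable_sqr_normcE; apply: measurableCB; exact: measurableC_fourier.
- by apply: measurable_sqr_normcE; apply: measurableC_fourier; exact: L2B.
- by apply: (ae_imp (fourierB i1 i2)) => w -> _.
Qed.

(** Plancherel is used twice at a fixed [z]: to bring the source difference back to time, where the
    Lipschitz condition is pointwise, and to return to frequencies. All of them are mixed by [f], so
    no cut-off survives on either side. *)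
Lemma source_difference_le (f : R -> R -> R -> R) (K : R) u ud F Fd : 0 <= K ->
  (forall x t v1 v2, 0 <= x <= 1 -> `|f x t v1 - f x t v2| <= K * `|v1 - v2|) ->
  (forall w, C01_L2 w -> L2strip (fun z t => f z t (w z t))) ->
  C01_L2 u -> C01_L2 ud ->
  is_partial_fourier (fun z t => f z t (u z t)) F ->
  is_partial_fourier (fun z t => f z t (ud z t)) Fd ->
  {ae leb R, forall z, 0 < z < 1 ->
    (cnsq (fun w => (cstrip Fd (z, w) - cstrip F (z, w))%R) <=
     (K ^+ 2)%:E * cnsq (fun w => (fourier (ud z) w - fourier (u z) w)%R))%E}.
Proof.
move=> K0 fK fL2 Cu Cud [LF FE] [LFd FdE].
have su := L2strip_slice (fL2 u Cu); have sud := L2strip_slice (fL2 ud Cud).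
have mF := (L2CstripP LF).1; have mFd := (L2CstripP LFd).1.
apply: (ae_imp2 (ae_imp2 FE FdE (fun z a b => conj a b))
                (ae_imp2 su sud (fun z a b => conj a b))).
move=> z [Fz Fdz] [uz udz] z01.
have z01' : 0 <= z <= 1 by case/andP: z01 => a b; rewrite !ltW.
have {uz}iu := uz z01; have {udz}iud := udz z01.
have Iu : L2 (u z) by case: Cu => _ + _; apply.
have Iud : L2 (ud z) by case: Cud => _ + _; apply.
set a := fun t => f z t (u z t) in iu *; set b := fun t => f z t (ud z t) in iud *.
have mab := L2B iud iu; have mud := L2B Iud Iu.
have EA : cnsq (fun w => cstrip Fd (z, w) - cstrip F (z, w)) = nsq (b \- a).
  transitivity (cnsq (fourier (b \- a))); last exact: plancherel.
  apply: ae_eq_integral => //.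
  - apply: measurable_sqr_normcE; apply: measurableCB; exact: measurable2C1.
  - by apply: measurable_sqr_normcE; exact: measurableC_fourier.
  - apply: (ae_imp2 (ae_imp2 (Fz z01) (Fdz z01) (fun z a b => conj a b)) (fourierB iud iu)).
    by move=> w [E1 E2] E3 _; rewrite E3 /cstrip z01 E1 E2.
rewrite EA (plancherelB Iud Iu).
have [mD _] := (L2P _).1 mud; have [mf _] := (L2P _).1 mab.
rewrite -integralZlR ?sqr_ge0//; [|exact: measurable_funX|by move=> t; exact: sqr_ge0].
apply: ge0_le_integral => //.
- by move=> t _; rewrite lee_fin sqr_ge0.
- exact: measurable_sqr.
- by apply/measurable_EFinP; apply: measurable_funM => //; exact: measurable_funX.
- move=> t _; rewrite lee_fin -exprMn -(real_normK (num_real ((b \- a) t))).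
  rewrite -(real_normK (num_real (K * _))) lerXn2r ?nnegrE//.
  by rewrite normrM (ger0_norm K0); exact: fK.
Qed.

End sources.

(** * The integral inequality for the low-frequency energy *)

Section low_frequencies.
Context {R : realType} (alpha : R) (alpha01 : 0 < alpha < 1).

Lemma measurableC_expC (a b : R -> R) : measurable_fun setT a -> measurable_fun setT b ->
  measurableC (fun y => expC (Complex (a y) (b y))).
Proof.
move=> ma mb; have me : measurable_fun setT (fun y => expR (a y)).
  exact: measurableT_comp.
split.
  under eq_fun do rewrite expCE /=; apply: measurable_funM => //.
  by apply: measurableT_comp mb; exact: measurable_cos.
under eq_fun do rewrite expCE /=; apply: measurable_funM => //.
by apply: measurableT_comp mb; exact: measurable_sin.
Qed.

Lemma measurableC_cst (c : R[i]) : measurableC (fun _ : R => c).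
Proof. by split. Qed.

Lemma measurableC_sinhk w : measurableC (sinhk alpha w).
Proof.
rewrite /sinhk; case: eqP => _; first by split => //=; exact: measurable_cst.
rewrite /sinhC; apply: measurableCM; last exact: measurableC_cst.
apply: measurableCM; last exact: measurableC_cst.
case: (k alpha w) => a b.
have ma c : measurable_fun setT (fun y : R => c * y) by exact: measurable_funM.
have E (y : R) : Complex a b * y%:C%C = Complex (a * y) (b * y).
  by apply/eqP; rewrite eq_complex /= !mulr0 subr0 add0r; apply/andP.
under eq_fun do rewrite E.
apply: measurableCB; first exact: measurableC_expC.
have E' (y : R) : - Complex (a * y) (b * y) = Complex ((- a) * y) ((- b) * y).
  by apply/eqP; rewrite eq_complex /= !mulNr !eqxx.
by under eq_fun do rewrite E'; exact: measurableC_expC.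
Qed.

(** With [L = N^(alpha / 2)], the majorant of the squared kernel [sinhk] at [x - z] that is common
    to all frequencies [|w| <= N]. *)
Definition kernel_bound (L x z : R) : R :=
  if 0 < z < x then (x - z) ^+ 2 * expR (2 * L * (x - z)) else 0.

Lemma kernel_bound_ge0 L x z : 0 <= kernel_bound L x z.
Proof.
by rewrite /kernel_bound; case: ifP => // _; apply: mulr_ge0; [exact: sqr_ge0|exact: expR_ge0].
Qed.

Lemma measurable_kernel_bound L x : measurable_fun setT (kernel_bound L x).
Proof.
apply: measurable_fun_ifT => //; first exact: measurable_itvoo.
have mB : measurable_fun setT (fun z : R => x - z) by exact: measurable_funB.
apply: measurable_funM; first exact: measurable_funX.
by apply: measurableT_comp => //; exact: measurable_funM.
Qed.

Lemma kernel_bound_le L x z : 0 <= L -> x <= 1 -> kernel_bound L x z <= expR (2 * L).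
Proof.
move=> L0 x1; rewrite /kernel_bound; case: ifP => [/andP[z0 zx]|_]; last exact: expR_ge0.
rewrite -[leRHS]mul1r; apply: ler_pM; rewrite ?expR_ge0//; first exact: sqr_ge0.
  by rewrite exprn_ile1//; lra.
by rewrite ler_expR ler_piMr ?mulr_ge0//; lra.
Qed.

(** Young's inequality with [th = 1], used twice: the integral term is doubled once, the two data
    terms twice. *)
Lemma sqr_normc_affineB_le (c s a1 a0 b1 b0 i1 i0 : R[i]) (e : R) :
  Normc.normc c ^+ 2 <= e -> Normc.normc s ^+ 2 <= e ->
  Normc.normc (c * a1 + s * b1 - i1 - (c * a0 + s * b0 - i0)) ^+ 2 <=
  4 * e * (Normc.normc (a1 - a0) ^+ 2 + Normc.normc (b1 - b0) ^+ 2) +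
  2 * Normc.normc (i1 - i0) ^+ 2.
Proof.
move=> ce se.
have -> : c * a1 + s * b1 - i1 - (c * a0 + s * b0 - i0) =
  (c * (a1 - a0) + s * (b1 - b0)) + - (i1 - i0) by ring.
move: (a1 - a0) (b1 - b0) (i1 - i0) => a b i.
have Y := young_normc (c * a + s * b) (- i) ltr01.
have D := young_normc (c * a) (s * b) ltr01.
rewrite normcN invr1 in Y; rewrite invr1 in D.
have Ca : Normc.normc (c * a) ^+ 2 <= e * Normc.normc a ^+ 2.
  by rewrite Normc.normcM exprMn; apply: ler_wpM2r => //; exact: sqr_ge0.
have Sb : Normc.normc (s * b) ^+ 2 <= e * Normc.normc b ^+ 2.
  by rewrite Normc.normcM exprMn; apply: ler_wpM2r => //; exact: sqr_ge0.
apply: (le_trans Y); rewrite mulrDr -!mulrA.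
move: D Ca Sb; move: (Normc.normc (c * a + s * b) ^+ 2) (Normc.normc (c * a) ^+ 2).
move: (Normc.normc (s * b) ^+ 2) (Normc.normc i ^+ 2).
move: (e * Normc.normc a ^+ 2) (e * Normc.normc b ^+ 2) => ea eb s' i' d' c' D Ca Sb.
by lra.
Qed.

Lemma sqr_normc_solution_difference_le (g h gd hd : R -> R) F Fd (N x w : R) :
  0 <= x <= 1 -> `|w| <= N ->
  measurable2C (cstrip F) -> (cnsq (fun z => cstrip F (z, w)) < +oo)%E ->
  measurable2C (cstrip Fd) -> (cnsq (fun z => cstrip Fd (z, w)) < +oo)%E ->
  ((Normc.normc (solution_formula alpha gd hd Fd x w -
                 solution_formula alpha g h F x w) ^+ 2)%:E <=
   (4 * expR (2 * N `^ (alpha / 2) * x) *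
    (Normc.normc (fourier gd w - fourier g w) ^+ 2 +
     Normc.normc (fourier hd w - fourier h w) ^+ 2))%:E +
   2%:E * \int[leb R]_z (kernel_bound (N `^ (alpha / 2)) x z *
     Normc.normc (cstrip Fd (z, w) - cstrip F (z, w)) ^+ 2)%:E)%E.
Proof.
move=> x01 wN mF nF mFd nFd; case/andP: (x01) => x0 x1.
set L := N `^ (alpha / 2).
have L0 : 0 <= L by exact: powR_ge0.
rewrite /solution_formula.
set c := coshC _; set s := sinhk alpha w x.
set Id := Cintegral _ _; set I0 := Cintegral _ _.
(* This uniform bound only ensures integrability; the estimate itself uses the sharper
   [kernel_bound], whose decay as [z] approaches [x] is needed for the contraction. *)
have ks (y : R) : 0 <= y <= 1 -> Normc.normc (sinhk alpha w y) ^+ 2 <= expR (2 * L).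
  move=> /andP[y0 y1]; apply: (le_trans (sqr_normc_sinhk alpha01 y0 wN)).
  rewrite -[leRHS]mul1r; apply: ler_pM; rewrite ?expR_ge0//; first exact: sqr_ge0.
    by rewrite exprn_ile1.
  by rewrite ler_expR ler_piMr// mulr_ge0.
have cst (F' : R -> R -> R[i]) : forall z, 0 < z < 1 -> F' z w = cstrip F' (z, w).
  by move=> z z01; rewrite /cstrip z01.
have := sqr_normc_kernelB_le x01 (measurableC_sinhk w) ks
  (measurable2C2 w mFd) nFd (cst Fd) (measurable2C2 w mF) nF (cst F).
rewrite -/Id -/I0 => IB.
have {IB}IB : ((Normc.normc (Id - I0) ^+ 2)%:E <= \int[leb R]_z (kernel_bound L x z *
     Normc.normc (cstrip Fd (z, w) - cstrip F (z, w)) ^+ 2)%:E)%E.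
  apply: (le_trans IB); apply: ge0_le_integral => //.
  - by move=> z _; rewrite lee_fin sqr_ge0.
  - apply: measurable_sqr_normcE; apply: measurableC_cut; first exact: measurableC_sinhk.
    by apply: measurableCB; exact: measurable2C2.
  - apply/measurable_EFinP; apply: measurable_funM; first exact: measurable_kernel_bound.
    apply: measurable_sqr_normc; by apply: measurableCB; exact: measurable2C2.
  - move=> z _; rewrite lee_fin /cut /kernel_bound; case: ifP => [/andP[z0 zx]|_].
      rewrite Normc.normcM exprMn; apply: ler_wpM2r; first exact: sqr_ge0.
      by apply: sqr_normc_sinhk => //; rewrite subr_ge0 ltW.
    by rewrite Normc.normc0 expr0n mul0r.
apply: (@le_trans _ _ ((4 * expR (2 * L * x) *
    (Normc.normc (fourier gd w - fourier g w) ^+ 2 +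
     Normc.normc (fourier hd w - fourier h w) ^+ 2) +
    2 * Normc.normc (Id - I0) ^+ 2)%:E)); last first.
  by rewrite EFinD leeD2l// EFinM lee_wpmul2l.
rewrite lee_fin; apply: sqr_normc_affineB_le; first exact: sqr_normc_cosh_k.
apply: (le_trans (sqr_normc_sinhk alpha01 x0 wN)).
by apply: ler_piMl; [exact: expR_ge0|rewrite exprn_ile1].
Qed.

Lemma low_difference_le (g h gd hd : R -> R) F Fd V (N x : R) :
  0 <= x <= 1 -> L2 g -> L2 h -> L2 gd -> L2 hd -> L2Cstrip F -> L2Cstrip Fd ->
  measurableC V ->
  {ae leb R, forall w, `|w| <= N -> V w = solution_formula alpha gd hd Fd x w -
     solution_formula alpha g h F x w} ->
  (low N V <= (4 * expR (2 * N `^ (alpha / 2) * x))%:E *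
     (nsq (gd \- g)%R + nsq (hd \- h)%R) +
   2%:E * \int[leb R]_z ((kernel_bound (N `^ (alpha / 2)) x z)%:E *
     cnsq (fun w => (cstrip Fd (z, w) - cstrip F (z, w))%R)))%E.
Proof.
move=> x01 Lg Lh Lgd Lhd LF LFd mV VE.
set L := N `^ (alpha / 2).
have [mF nF] := L2CstripP LF; have [mFd nFd] := L2CstripP LFd.
pose Phi q := cstrip Fd q - cstrip F q.
have mPhi : measurable2C Phi by exact: measurable2CB.
pose H (q : R * R) := kernel_bound L x q.1 * Normc.normc (Phi q) ^+ 2.
have mH : measurable_fun setT H.
  apply: measurable_funM; last exact: measurable2C_sqr.
  by apply: measurableT_comp; [exact: measurable_kernel_bound|exact: measurable_fst].
have H0 q : 0 <= H q by apply: mulr_ge0; [exact: kernel_bound_ge0|exact: sqr_ge0].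
pose A w := Normc.normc (fourier gd w - fourier g w) ^+ 2.
pose B w := Normc.normc (fourier hd w - fourier h w) ^+ 2.
have mdif (v1 v2 : R -> R) : L2 v1 -> L2 v2 -> measurableC (fun w => fourier v1 w - fourier v2 w).
  by move=> i1 i2; apply: measurableCB; exact: measurableC_fourier.
pose c := 4 * expR (2 * L * x).
have c0 : 0 <= c by apply: mulr_ge0 => //; exact: expR_ge0.
have mAB : measurable_fun setT (fun w => A w + B w).
  by apply: measurable_funD; apply: measurable_sqr_normc; exact: mdif.
have AB0 w : 0 <= A w + B w by apply: addr_ge0; exact: sqr_ge0.
have J0 w : (0 <= \int[leb R]_z (H (z, w))%:E)%E.
  by apply: integral_ge0 => z _; rewrite lee_fin.
have mJ := measurable_integral2 mH H0.
(* The restriction [|w| <= N] is dropped on the right: Tonelli and Plancherel then give full norms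
   of the data and of the source difference. *)
apply: (@le_trans _ _ (\int[leb R]_w ((c * (A w + B w))%:E +
   2%:E * \int[leb R]_z (H (z, w))%:E))%E).
  apply: ae_ge0_le_integral => //.
  - by move=> w _; rewrite lee_fin; case: ifP => // _; exact: sqr_ge0.
  - by apply/measurable_EFinP; exact: measurable_low.
  - by move=> w _; rewrite adde_ge0 ?mule_ge0// lee_fin mulr_ge0.
  - apply: emeasurable_funD; first by apply/measurable_EFinP; exact: measurable_funM.
    exact: emeasurable_funM.
  - apply: (ae_imp2 VE (ae_imp2 (L2Cstrip_slice2 LF) (L2Cstrip_slice2 LFd)
       (fun z a b => conj a b))) => w Vw [nw ndw] _.
    case: ifPn => [wN|_]; last by rewrite adde_ge0 ?mule_ge0// lee_fin mulr_ge0.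
    by rewrite Vw//; exact: sqr_normc_solution_difference_le.
rewrite ge0_integralD//; last first.
- exact: emeasurable_funM.
- by move=> w _; rewrite mule_ge0.
- by apply/measurable_EFinP; exact: measurable_funM.
- by move=> w _; rewrite lee_fin mulr_ge0.
rewrite integralZlR// ge0_integralZl_EFin//.
rewrite -tonelliR//; apply: leeD.
  apply: lee_wpmul2l; first by rewrite lee_fin.
  rewrite -(plancherelB Lgd Lg) -(plancherelB Lhd Lh) /cnsq -ge0_integralD//.
  - by move=> w _; rewrite lee_fin sqr_ge0.
  - by apply: measurable_sqr_normcE; exact: mdif.
  - by move=> w _; rewrite lee_fin sqr_ge0.
  - by apply: measurable_sqr_normcE; exact: mdif.
apply: lee_wpmul2l => //; apply: ge0_le_integral => //.
- by move=> z _; apply: integral_ge0 => w _; rewrite lee_fin.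
- exact: measurable_integral1.
- apply: emeasurable_funM; first by apply/measurable_EFinP; exact: measurable_kernel_bound.
  by apply: (measurable_integral1 (measurable2C_sqr mPhi)) => q; exact: sqr_ge0.
- move=> z _; rewrite /H /= integralZlR ?kernel_bound_ge0//.
    by apply: measurable_sqr_normc; exact: measurable2C1.
  by move=> w; exact: sqr_ge0.
Qed.

End low_frequencies.

(** * Closing the energy inequality *)

Section energy.
Context {R : realType}.

(** With [r = x - y], the rate [2 L + 2 K] is chosen so that [exp (2 L r) exp ((2 L + 2 K) y)]
    equals [exp ((2 L + 2 K) x) exp (- 2 K r)]: the excess [2 K] leaves a decaying factor, and
    [sqr_expR_kernel_le] makes [K^2 r^2 exp (- 2 K r)] at most 1/4. The term in [h] follows from
    [exp ((2 L + 2 K) y) >= 1]. *)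
Lemma kernel_bound_growth_le (K L C h x y : R) : 0 < K -> 0 <= L -> 0 <= C -> 0 <= h ->
  0 <= y <= x ->
  (x - y) ^+ 2 * expR (2 * L * (x - y)) *
    (K ^+ 2 * (expR ((2 * L + 2 * K) * y) * C + h)) <=
  expR ((2 * L + 2 * K) * x) * ((C + h) / 4).
Proof.
move=> K0 L0 C0 h0 /andP[y0 yx].
set r := x - y; have r0 : 0 <= r by rewrite subr_ge0.
have S := sqr_expR_kernel_le K0 r0.
set E := expR ((2 * L + 2 * K) * x).
have E0 : 0 <= E by exact: expR_ge0.
have E1 : expR (2 * L * r) * expR ((2 * L + 2 * K) * y) = E * expR (- (2 * K * r)).
  by rewrite -!expRD; congr expR; rewrite /r; ring.
have E2 : expR (2 * L * r) <= E * expR (- (2 * K * r)).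
  rewrite -E1 ler_peMr ?expR_ge0// -expR0 ler_expR mulr_ge0// addr_ge0// mulr_ge0//.
  exact: ltW.
have S' : r ^+ 2 * expR (- (2 * K * r)) * K ^+ 2 <= 1 / 4 by move: S; lra.
have T1 : r ^+ 2 * expR (2 * L * r) * (K ^+ 2 * (expR ((2 * L + 2 * K) * y) * C)) <=
    E * (C / 4).
  have -> : r ^+ 2 * expR (2 * L * r) * (K ^+ 2 * (expR ((2 * L + 2 * K) * y) * C)) =
    (E * C) * (r ^+ 2 * expR (- (2 * K * r)) * K ^+ 2).
    transitivity (r ^+ 2 * K ^+ 2 * C *
      (expR (2 * L * r) * expR ((2 * L + 2 * K) * y))); first by ring.
    by rewrite E1; ring.
  rewrite [leRHS]mulrA -[4^-1]div1r; apply: ler_wpM2l => //; exact: mulr_ge0.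
have T2 : r ^+ 2 * expR (2 * L * r) * (K ^+ 2 * h) <= E * (h / 4).
  apply: (@le_trans _ _ (r ^+ 2 * (E * expR (- (2 * K * r))) * (K ^+ 2 * h))).
    apply: ler_wpM2r; first by apply: mulr_ge0 => //; exact: sqr_ge0.
    by apply: ler_wpM2l => //; exact: sqr_ge0.
  have -> : r ^+ 2 * (E * expR (- (2 * K * r))) * (K ^+ 2 * h) =
    (E * h) * (r ^+ 2 * expR (- (2 * K * r)) * K ^+ 2) by ring.
  rewrite [leRHS]mulrA -[4^-1]div1r; apply: ler_wpM2l => //; exact: mulr_ge0.
by rewrite [(C + h) / 4]mulrDl [X in _ * X <= _]mulrDr [leLHS]mulrDr [leRHS]mulrDr lerD.
Qed.

(** Here [l] is the low-frequency energy, [G] the energy of the source difference and [h] the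
    high-frequency forcing. Only [G] is integrated, after being bounded through the supremum of the
    rescaled [l], so the measurability of [l] never comes up. *)
Lemma gronwall_bound (K L h d : R) (G l : R -> \bar R) : 0 < K -> 0 <= L ->
  0 <= h -> 0 <= d -> measurable_fun setT G -> (forall y, 0 <= G y)%E ->
  (\int[leb R]_y G y < +oo)%E -> (forall x, 0 <= l x)%E ->
  (forall x, 0 <= x < 1 -> (l x <= (4 * expR (2 * L * x) * d)%:E +
     2%:E * \int[leb R]_y ((kernel_bound L x y)%:E * G y))%E) ->
  {ae leb R, forall y, 0 < y < 1 -> (G y <= (K ^+ 2)%:E * (l y + h%:E))%E} ->
  forall x, 0 <= x < 1 -> (l x <= (expR ((2 * L + 2 * K) * x) * (8 * d + h))%:E)%E.
Proof.
move=> K0 L0 h0 d0 mG G0 Gfin l0 lE GE.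
have mk x : measurable_fun setT (fun y => (kernel_bound L x y)%:E * G y)%E.
  by apply: emeasurable_funM => //; apply/measurable_EFinP; exact: measurable_kernel_bound.
have k0 x y : (0 <= (kernel_bound L x y)%:E * G y)%E.
  by rewrite mule_ge0// lee_fin kernel_bound_ge0.
pose M := fine (\int[leb R]_y G y)%E.
have ME : (\int[leb R]_y G y)%E = M%:E.
  by rewrite fineK// ge0_fin_numE//; exact: integral_ge0.
have M0 : 0 <= M by rewrite -lee_fin -ME; exact: integral_ge0.
pose c := 2 * L + 2 * K.
have c0 : 0 < c by rewrite ltr_wpDl//; [exact: mulr_ge0|exact: mulr_gt0].
(* A crude bound whose value is irrelevant: it makes the supremum in [contraction_bound] finite. *)
have bound x : 0 <= x < 1 -> (l x <= (4 * expR (2 * L) * d + 2 * (expR (2 * L) * M))%:E)%E.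
  move=> /andP[x0 x1]; apply: (le_trans (lE x _)); first by rewrite x0.
  rewrite [leRHS]EFinD; apply: leeD.
    rewrite lee_fin; apply: ler_wpM2r => //; apply: ler_wpM2l => //.
    by rewrite ler_expR ler_piMr ?mulr_ge0// ltW.
  rewrite EFinM; apply: lee_wpmul2l => //; rewrite EFinM -ME -ge0_integralZl_EFin//.
  apply: ge0_le_integral => //.
  - exact: mk.
  - exact: emeasurable_funM.
  move=> y _; apply: lee_wpmul2r => //.
  by rewrite lee_fin kernel_bound_le// ltW.
have lfin x : 0 <= x < 1 -> l x = (fine (l x))%:E.
  by move=> x01; rewrite fineK// ge0_fin_numE//; apply: le_lt_trans (bound x x01) _; rewrite ltry.
pose e x := expR (- (c * x)) * fine (l x).
have e0 x : 0 <= e x by rewrite mulr_ge0 ?expR_ge0// fine_ge0.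
have eK x : expR (c * x) * e x = fine (l x).
  by rewrite /e mulrA -expRD subrr expR0 mul1r.
have main : forall x, 0 <= x < 1 -> e x <= 2 * (4 * d + h / 2).
  apply: contraction_bound.
    exists (4 * expR (2 * L) * d + 2 * (expR (2 * L) * M)) => x x01.
    have := bound x x01; rewrite (lfin x x01) lee_fin; apply: le_trans.
    rewrite /e; apply: ler_piMl; first exact: fine_ge0.
    rewrite -expR0 ler_expR oppr_le0 mulr_ge0//; first exact: ltW.
    by case/andP: x01.
  move=> C eC x x01; have C0 : 0 <= C.
    by apply: le_trans (eC 0 _); rewrite ?lexx ?ltr01.
  case/andP: (x01) => x0 x1.
  pose Q := expR (c * x) * ((C + h) / 4).
  have Q0 : 0 <= Q by rewrite mulr_ge0 ?expR_ge0// divr_ge0// addr_ge0.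
  have I : (\int[leb R]_y ((kernel_bound L x y)%:E * G y) <= Q%:E)%E.
    (* [Q] bounds the integrand for every [y] in an interval of length one, so it bounds the
       integral; doubled, it carries [C / 2], the contraction. *)
    apply: (@le_trans _ _ (\int[leb R]_y (Q * \1_`]0, 1[ y)%:E)%E).
      apply: ae_ge0_le_integral => //.
      - exact: mk.
      - by move=> y _; rewrite lee_fin mulr_ge0.
      - by apply/measurable_EFinP; apply: measurable_funM => //; exact: measurable_indic.
      apply: (ae_imp GE) => y Gy _; rewrite /kernel_bound; case: ifPn => [/andP[y0 yx]|_]; last first.
        by rewrite mul0e lee_fin mulr_ge0.
      have y1 : y < 1 by exact: lt_trans x1.
      have y01 : 0 <= y < 1 by rewrite (ltW y0).
      rewrite indicE mem_setE in_itv/= y0 y1 mulr1.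
      have a0 : 0 <= (x - y) ^+ 2 * expR (2 * L * (x - y)).
        by apply: mulr_ge0; [exact: sqr_ge0|exact: expR_ge0].
      apply: (@le_trans _ _ (((x - y) ^+ 2 * expR (2 * L * (x - y)))%:E *
          ((K ^+ 2) * (expR (c * y) * C + h))%:E)%E).
        apply: lee_wpmul2l => //; apply: (le_trans (Gy _)); first by rewrite y0.
        rewrite (lfin y y01) -EFinD -EFinM lee_fin; apply: ler_wpM2l; first exact: sqr_ge0.
        by rewrite lerD2r -eK; apply: ler_wpM2l; [exact: expR_ge0|exact: eC].
      by rewrite -EFinM lee_fin; apply: kernel_bound_growth_le => //; rewrite !ltW.
    have mi : measurable_fun setT (\1_`]0, 1[ : R -> R) by exact: measurable_indic.
    rewrite (integralZlR Q0 mi) => [|y]; last by rewrite indicE.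
    rewrite integral_indic//= setIT lebesgue_measure_itv/= lte_fin ltr01.
    by rewrite oppr0 adde0 mule1.
  have : (l x <= (4 * expR (2 * L * x) * d + 2 * Q)%:E)%E.
    apply: (le_trans (lE x x01)); rewrite [leRHS]EFinD; apply: leeD => //.
    by rewrite EFinM; exact: lee_wpmul2l.
  rewrite (lfin x x01) lee_fin -eK => H.
  have X0 := expR_gt0 (c * x).
  have H1 : expR (2 * L * x) * d <= expR (c * x) * d.
    apply: ler_wpM2r => //; rewrite ler_expR; apply: ler_wpM2r => //.
    by rewrite /c lerDl mulr_ge0// ltW.
  rewrite -(ler_pM2l X0); apply: (le_trans H); rewrite -mulrA.
  have -> : expR (c * x) * (4 * d + h / 2 + C / 2) =
    4 * (expR (c * x) * d) + 2 * Q by rewrite /Q; field.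
  by rewrite lerD2r ler_pM2l.
move=> x x01; rewrite (lfin x x01) lee_fin -eK -/c; apply: ler_wpM2l; first exact: expR_ge0.
by apply: (le_trans (main x x01)); lra.
Qed.

Lemma data_energy_le (a b : R -> R) (delta : R) : L2 a -> L2 b ->
  (Lnorm (leb R) 2%:E (EFin \o a) + Lnorm (leb R) 2%:E (EFin \o b) <= delta%:E)%E ->
  (nsq a + nsq b <= (delta ^+ 2)%:E)%E.
Proof.
move=> /L2P[_ na] /L2P[_ nb]; rewrite !Lnorm2E.
have fa : (nsq a)%E = (fine (nsq a))%:E by rewrite fineK// ge0_fin_numE ?nsq_ge0.
have fb : (nsq b)%E = (fine (nsq b))%:E by rewrite fineK// ge0_fin_numE ?nsq_ge0.
have a0 : 0 <= fine (nsq a) by rewrite fine_ge0// nsq_ge0.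
have b0 : 0 <= fine (nsq b) by rewrite fine_ge0// nsq_ge0.
rewrite fa fb !poweR_EFin -!EFinD !lee_fin.
have sq (x : R) : 0 <= x -> x = (x `^ 2^-1) ^+ 2.
  by move=> x0; rewrite -powR_mulrn ?powR_ge0// -powRrM mulVf// powRr1.
rewrite [X in _ -> X + _ <= _]sq// [X in _ -> _ + X <= _]sq//.
have := powR_ge0 (fine (nsq a)) 2^-1; have := powR_ge0 (fine (nsq b)) 2^-1.
move: (_ `^ _) (_ `^ _) => y x y0 x0 xy.
apply: (@le_trans _ _ ((x + y) ^+ 2)).
  have := mulr_ge0 x0 y0; have -> : (x + y) ^+ 2 = y ^+ 2 + x ^+ 2 + 2 * (y * x) by ring.
  by lra.
by rewrite lerXn2r ?nnegrE ?addr_ge0//; rewrite ?(addrC x)//; apply: le_trans xy; exact: addr_ge0.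
Qed.

Lemma sqrt_lee (a : \bar R) (b : R) : (0 <= a)%E -> 0 <= b -> (a <= (b ^+ 2)%:E)%E ->
  (a `^ 2^-1 <= b%:E)%E.
Proof.
move=> a0 b0 ab; apply: (@le_trans _ _ ((b ^+ 2)%:E `^ 2^-1)%E).
  by apply: gt0_ler_poweR => //; rewrite in_itv/= ?a0 leey ?andbT//= lee_fin sqr_ge0.
by rewrite poweR_EFin lee_fin -powR_mulrn// -powRrM divff// powRr1.
Qed.

End energy.

Section sobolev_norm.
Context {R : realType}.

Lemma indic_low_frequency (N w : R) :
  \1_(`[- N, N] : set R) w = (`|w| <= N)%R%:R :> R.
Proof. by rewrite indicE mem_setE in_itv/= -ler_norml. Qed.

Lemma Hnorm_le (p : R) (v1 v2 : R -> R) (N C b : R) : 0 <= p -> 0 <= N -> 0 <= b ->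
  (forall w, `|w| <= N -> (1 + w ^+ 2) `^ p <= C) -> 0 <= C -> L2 v1 -> L2 v2 ->
  (C%:E * low N (fun w => (fourier v1 w - fourier v2 w)%R) +
   high N (fun w => ((1 + w ^+ 2) `^ p)%R) (fun w => (fourier v1 w - fourier v2 w)%R)
   <= (b ^+ 2)%:E)%E ->
  (Hnorm p (v1 \- v2)%R <= b%:E)%E.
Proof.
move=> p0 N0 b0 wC C0 i1 i2 lh; apply: sqrt_lee => //.
  by apply: integral_ge0 => w _; rewrite lee_fin; apply: mulr_ge0; [exact: powR_ge0|exact: sqr_ge0].
have mw : measurable_fun setT (fun w : R => (1 + w ^+ 2) `^ p).
  apply: measurableT_comp (measurable_powR p) _.
  by apply: measurable_funD => //; exact: measurable_funX.
have m12 := measurableCB (measurableC_fourier i1) (measurableC_fourier i2).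
apply: le_trans lh.
apply: le_trans (weighted_le_low_high C0 (fun w => powR_ge0 _ _) mw m12 wC).
rewrite le_eqVlt; apply/orP; left; apply/eqP; apply: ae_eq_integral => //.
- apply/measurable_EFinP; apply: measurable_funM => //.
  by apply: measurable_sqr_normc; apply: measurableC_fourier; exact: L2B.
- by apply/measurable_EFinP; apply: measurable_funM => //; exact: measurable_sqr_normc.
- by apply: (ae_imp (fourierB i1 i2)) => w -> _.
Qed.

End sobolev_norm.

(** * Balance of the exponentials and conclusion *)

Section balance.
Context {R : realType}.

(** Each term is a multiple of [E = exp (- 2 B X)]: at most [16 E] from the data, [2 M^2 E] from the
    forcing and [M^2 E] from the tail. The constant [4 + 2 M] covers them since its square is at
    least [16 + 4 M^2]. *)
Lemma final_numerics (X A B P G8 M d : R) : 0 <= M -> 0 <= P ->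
  d = expR (- ((A + B) * X)) ->
  P * G8 <= 2 * expR (2 * (A * X)) -> P * G8 <= 2 * expR (2 * (B * X)) ->
  P <= expR (2 * (B * X)) ->
  P * (G8 * (8 * d ^+ 2 + expR (- (4 * (B * X))) * M ^+ 2)) +
    P * expR (- (4 * (B * X))) * M ^+ 2 <=
  ((4 + 2 * M) * expR (- (B * X))) ^+ 2.
Proof.
move=> M0 P0 -> hA hB hP.
set E := expR (- (2 * (B * X))).
have E0 : 0 <= E by exact: expR_ge0.
have e1 : expR (- (B * X)) ^+ 2 = E by rewrite sqr_expR; congr expR; ring.
have e2 : expR (2 * (A * X)) * expR (- ((A + B) * X)) ^+ 2 = E.
  by rewrite sqr_expR -expRD; congr expR; ring.
have e3 : expR (2 * (B * X)) * expR (- (4 * (B * X))) = E.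
  by rewrite -expRD; congr expR; ring.
have F0 := expR_ge0 (- (4 * (B * X))).
have D0 := sqr_ge0 (expR (- ((A + B) * X))).
move: (expR (- (4 * (B * X)))) (expR (- ((A + B) * X)) ^+ 2) F0 D0 e2 e3 => F D F0 D0 e2 e3.
have M20 := sqr_ge0 M.
have t1 : P * G8 * D <= 2 * E.
  by rewrite -e2 mulrA; apply: ler_wpM2r.
have t2 : P * G8 * F * M ^+ 2 <= 2 * E * M ^+ 2.
  by apply: ler_wpM2r => //; rewrite -e3 mulrA; apply: ler_wpM2r.
have t3 : P * F * M ^+ 2 <= E * M ^+ 2.
  by apply: ler_wpM2r => //; rewrite -e3; apply: ler_wpM2r.
rewrite exprMn e1.
have -> : P * (G8 * (8 * D + F * M ^+ 2)) + P * F * M ^+ 2 =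
  8 * (P * G8 * D) + P * G8 * F * M ^+ 2 + P * F * M ^+ 2 by ring.
have -> : (4 + 2 * M) ^+ 2 * E = 16 * E + 16 * (E * M) + 4 * (E * M ^+ 2) by ring.
have := mulr_ge0 E0 M0; have := mulr_ge0 E0 M20.
rewrite -mulrA in t2.
by move: t1 t2 t3; lra.
Qed.

End balance.

Theorem theorem3p2 (R : realType) (alpha : R) (halpha : 0 < alpha < 1)
  (f : R -> R -> R -> R) (K : R)
  (f_bounded :
    (fun q : R * R * R => f q.1.1 q.1.2 q.2) \_ (`[0, 1] `*` setT `*` setT)
      \in Lfun (leb3 R) +oo%E)
  (hK : 0 < K)
  (f_lipschitz : forall x t v1 v2 : R, 0 <= x <= 1 ->
    `|f x t v1 - f x t v2| <= K * `|v1 - v2|)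
  (f_L2 : forall w : R -> R -> R, C01_L2 w ->
    L2strip (fun z t => f z t (w z t)))
  (p : R) (hp : 0 < p)
  (g h gd hd : R -> R) (hg : L2 g) (hh : L2 h) (hgd : L2 gd) (hhd : L2 hd)
  (delta : R)
  (hdata : (Lnorm (leb R) 2%:E (EFin \o (gd \- g)%R)
            + Lnorm (leb R) 2%:E (EFin \o (hd \- h)%R) <= delta%:E)%E)
  (u : R -> R -> R) (hu : exact_solution alpha f g h u)
  (M2 gamma mu : R) (hM2 : 0 < M2) (hgamma : 0 < gamma)
  (hmu : Num.max (4 - alpha) (4 * p - alpha) < mu)
  (u_apriori : forall x : R, 0 <= x < 1 ->
    (\int[leb R]_w
       ((expR (2 * (1 + gamma - x) * `|w| `^ ((alpha + mu) / 2)
               * cos (alpha * pi / 4))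
         * Normc.normc (fourier (u x) w) ^+ 2)%R%:E)
     < (M2 ^+ 2)%:E)%E)
  (A B q C2 eps : R)
  (hA : A = p / 2 + 1 + K ^+ 2 * 2 `^ p)
  (hB : B = 1 / 2 * gamma * cos (alpha * pi / 4))
  (hq : q = Num.max (Num.max 2 (alpha / 2)) (2 * p))
  (hC2 : C2 = 4 + 2 * M2)
  (hdelta : 0 < delta < 1)
  (delta_small :
    ((A + B) / ln (1 / delta)) `^ (2 / (alpha + mu)) <
    Num.min
      (Num.min 1 ((B / A) `^ (1 / ((alpha + mu) / 2 - q))))
      (((alpha + mu) / 2 * gamma * cos (alpha * pi / 4) / p)
         `^ (2 / (alpha + mu))))
  (heps : eps = ((A + B) / ln (1 / delta)) `^ (2 / (alpha + mu)))
  (ud : R -> R -> R) (hud : regularized_solution alpha f eps gd hd ud)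
  (x : R) (hx : 0 <= x < 1) :
  (Hnorm p (fun t => (ud x t - u x t)%R)
    <= (C2 * delta `^ (B / (A + B)))%:E)%E.
Proof.
set c := cos (alpha * pi / 4) in u_apriori hB delta_small.
set s := (alpha + mu) / 2 in u_apriori delta_small.
have c0 : 0 < c by exact: cos_alpha_gt0.
have B0 : 0 < B by rewrite hB !mulr_gt0.
have [a0 a1] := andP halpha.
move: hmu; rewrite gt_max => /andP[mu1 mu2].
have s2 : 2 < s by rewrite /s; lra.
have s2p : 2 * p < s by rewrite /s; lra.
have s0 : 0 < s by lra.
have sE : 2 / (alpha + mu) = 1 / s.
  by rewrite /s div1r invf_div.
have qs : q < s by rewrite hq !gt_max s2 s2p !andbT; lra.
have q2 : 2 <= q by rewrite hq !le_max lexx.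
have qa : alpha / 2 <= q by rewrite hq !le_max lexx orbT.
rewrite sE in heps delta_small.
move: delta_small; rewrite -heps !lt_min => /andP[/andP[eps1 epsBA] epsp].
have AD := parameters_admissible hp hK c0 hgamma q2 qa qs hA B0 hdelta heps eps1 epsBA epsp.
set N := 1 / eps in AD.
have N1 := adm_N AD.
have N0 : 0 < N by lra.
set X := N `^ s in AD.
have X0 : 0 < X by exact: powR_gt0.
set L := N `^ (alpha / 2).
have L0 : 0 <= L by exact: powR_ge0.
have A0 : 0 < A by rewrite hA !addr_gt0 ?divr_gt0// mulr_gt0 ?exprn_gt0// powR_gt0.
(* The exponent left in the a priori weight at [x = 1] is [4 B]. Of this decay, [2 B] pays for the
   growth factors and [2 B] remains as the square of the final rate. *)
have gcE (y : R) : 2 * gamma * c * y = 4 * (B * y) by rewrite hB; field.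
case: hu => Cu [F PF uF]; case: hud => Cud [Fd PFd udF].
have LF := PF.1; have LFd := PFd.1.
have Lu z : 0 <= z < 1 -> L2 (u z).
  by case: Cu => _ + _ /andP[z0 z1]; apply; rewrite z0 ltW.
have Lud z : 0 <= z < 1 -> L2 (ud z).
  by case: Cud => _ + _ /andP[z0 z1]; apply; rewrite z0 ltW.
pose V z w := fourier (ud z) w - fourier (u z) w.
have mV z : 0 <= z < 1 -> measurableC (V z).
  by move=> z01; apply: measurableCB; apply: measurableC_fourier; [exact: Lud|exact: Lu].
pose e (z w : R) : R := expR (2 * (1 + gamma - z) * `|w| `^ s * c).
have me z : measurable_fun setT (e z).
  apply: measurableT_comp => //; apply: measurable_funM => //; apply: measurable_funM => //.
  by apply: measurableT_comp (measurable_powR s) _; exact: normr_measurable.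
have e_ge z w : z < 1 -> expR (2 * gamma * c * `|w| `^ s) <= e z w.
  move=> z1; rewrite /e ler_expR -[leRHS]mulrA [X in _ <= _ * X]mulrC [leRHS]mulrA.
  apply: ler_wpM2r; first exact: powR_ge0.
  by apply: ler_wpM2r; [exact: ltW|move: z1; clear; lra].
pose hM := expR (- (4 * (B * X))) * M2 ^+ 2.
have hM0 : 0 <= hM by apply: mulr_ge0; [exact: expR_ge0|exact: sqr_ge0].
have high_zero z : 0 <= z < 1 -> {ae leb R, forall w, N < `|w| -> V z w = - fourier (u z) w}.
  move=> z01; have z01' : 0 <= z <= 1 by case/andP: z01 => -> /ltW.
  apply: (ae_imp (udF z z01')) => w E Nw.
  by rewrite /V E indic_low_frequency leNgt Nw mul0r sub0r.
(* Used with two weights: the constant 1, for the forcing of the low frequencies, and the Sobolev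
   weight, for the tail of the final norm. *)
have high_est z (weight : R -> R) (C : R) : 0 <= z < 1 -> 0 <= C -> measurable_fun setT weight ->
    (forall w, 0 <= weight w) -> (forall w, N < `|w| -> weight w <= C * e z w) ->
    (high N weight (V z) <= (C * M2 ^+ 2)%:E)%E.
  move=> z01 C0 mw w0 we; rewrite EFinM.
  apply: (high_le C0 (mV z z01) (measurableC_fourier (Lu z z01)) mw (me z) w0 _
     (high_zero z z01) we) => [w|]; first exact: expR_ge0.
  exact: ltW (u_apriori z z01).
(* This closes the system: the full energy required by the Lipschitz estimate is the low one plus
   the constant [hM]. *)
have cV z : 0 <= z < 1 -> (cnsq (V z) <= low N (V z) + hM%:E)%E.
  move=> z01; have z1 : z < 1 by case/andP: z01.
  have := @weighted_le_low_high R N 1 (cst 1) (V z) ler01 (fun=> ler01) (measurable_cst _)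
    (mV z z01) (fun _ _ => lexx _).
  rewrite mul1e /cnsq; under eq_integral do rewrite mul1r.
  move/le_trans; apply; apply: leeD => //.
  apply: high_est => // w Nw.
  apply: (@le_trans _ _ (expR (- (4 * (B * X))) * expR (2 * gamma * c * `|w| `^ s))).
    rewrite -expRD -[leLHS]expR0 ler_expR.
    have Xw : X <= `|w| `^ s.
      by apply: ge0_ler_powR; rewrite ?nnegrE//; exact: ltW.
    have : B * X <= B * `|w| `^ s by rewrite ler_pM2l.
    by rewrite gcE; move: (B * X) (B * `|w| `^ s) => b1 b2; clear; lra.
  by apply: ler_wpM2l; [exact: expR_ge0|exact: e_ge].
have data := data_energy_le (L2B hgd hg) (L2B hhd hh) hdata.
have [mF _] := L2CstripP LF; have [mFd _] := L2CstripP LFd.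
have low_est z : 0 <= z < 1 -> (low N (V z) <=
    (expR ((2 * L + 2 * K) * z) * (8 * delta ^+ 2 + hM))%:E)%E.
  apply: (@gronwall_bound R K L hM (delta ^+ 2)
    (fun z => cnsq (fun w => cstrip Fd (z, w) - cstrip F (z, w))) (fun z => low N (V z))) => //.
  - exact: sqr_ge0.
  - apply: (measurable_integral1 (h := fun q => Normc.normc (cstrip Fd q - cstrip F q) ^+ 2)).
      by apply: (@measurable2C_sqr R (fun q => cstrip Fd q - cstrip F q)); exact: measurable2CB.
    by move=> q'; exact: sqr_ge0.
  - by move=> y; exact: cnsq_ge0.
  - exact: cstripB_fin.
  - by move=> y; exact: low_ge0.
  - move=> y y01; have y01' : 0 <= y <= 1 by case/andP: y01 => -> /ltW.
    apply: (le_trans (@low_difference_le R alpha halpha g h gd hd F Fd (V y) N y y01'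
       hg hh hgd hhd LF LFd (mV y y01) _)).
      apply: (ae_imp2 (udF y y01') (uF y y01')) => w E1 E2 wN.
      by rewrite /V E1 E2 indic_low_frequency wN mul1r.
    apply: leeD => //; rewrite [leRHS]EFinM; apply: lee_wpmul2l => //.
  - apply: (ae_imp (source_difference_le (ltW hK) f_lipschitz f_L2 Cu Cud PF PFd)).
    move=> y Ey y01; apply: (le_trans (Ey y01)); apply: lee_wpmul2l.
      by rewrite lee_fin sqr_ge0.
    by apply: cV; case/andP: y01 => /ltW ->.
have x1 : x < 1 by case/andP: hx.
set P := (2 * N ^+ 2) `^ p.
have P0 : 0 <= P by exact: powR_ge0.
have C20 : 0 < C2 by rewrite hC2 addr_gt0// mulr_gt0.
have AB0 : 0 < A + B by exact: addr_gt0.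
(* The choice of [eps] amounts to [delta = exp (- (A + B) X)], so the claimed power of [delta] is
   the decay rate of all the terms. *)
have dE : delta `^ (B / (A + B)) = expR (- (B * X)).
  rewrite powR_expR; last by case/andP: hdelta.
  by rewrite (adm_delta AD) expRK -/X; congr expR; field; rewrite gt_eqF.
rewrite dE.
apply: (@Hnorm_le R p (ud x) (u x) N P) => //; [exact: ltW|exact: ltW| | |exact: Lud|exact: Lu|].
- by apply: mulr_ge0; [exact: ltW|exact: expR_ge0].
- move=> w wN; apply: ge0_ler_powR; rewrite ?nnegrE; first exact: ltW.
  + by apply: addr_ge0 => //; exact: sqr_ge0.
  + by apply: mulr_ge0 => //; exact: sqr_ge0.
  + rewrite mulrDl mul1r; apply: lerD; first by rewrite exprn_ege1// ltW.
    by rewrite -(real_normK (num_real w)) lerXn2r ?nnegrE// ltW.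
apply: (@le_trans _ _ ((P * (expR (2 * L + 2 * K) * (8 * delta ^+ 2 + hM)) +
    P * expR (- (4 * (B * X))) * M2 ^+ 2)%:E)).
  rewrite [leRHS]EFinD; apply: leeD.
    rewrite [leRHS]EFinM; apply: lee_wpmul2l => //; apply: (le_trans (low_est x hx)).
    rewrite lee_fin; apply: ler_wpM2r.
      by apply: addr_ge0 => //; apply: mulr_ge0 => //; exact: sqr_ge0.
    rewrite ler_expR ler_piMr//; last exact: ltW.
    by rewrite addr_ge0 ?mulr_ge0// ltW.
  apply: high_est => //.
  - by apply: mulr_ge0 => //; exact: expR_ge0.
  - apply: measurableT_comp (measurable_powR p) _.
    by apply: measurable_funD => //; exact: measurable_funX.
  - by move=> w; exact: powR_ge0.
  - move=> w Nw.
    have gc0 : 0 < gamma * c by exact: mulr_gt0.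
    apply: (le_trans (tail_weight_le s0 (ltW hp) gc0 (ltW N1) (adm_tail AD) (ltW Nw))).
    rewrite (gcE (N `^ s)); apply: ler_wpM2l; last exact: e_ge.
    by apply: mulr_ge0 => //; exact: expR_ge0.
rewrite lee_fin hC2; apply: (final_numerics (A := A)).
- exact: ltW.
- exact: P0.
- exact: adm_delta AD.
- exact: adm_growthA AD.
- exact: adm_growthB AD.
- exact: adm_pow AD.
Qed.
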